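(* Let $u$ be the solution of the Poisson interface problem $$-\nabla^2u=f\ \text{in }\Omega\setminus\Gamma,\qquad u=g_0\ \text{on }\partial\Omega,\qquad [u]=g_1\ \text{on }\Gamma,\qquad [\nabla u\cdot\vec n]=g\ \text{on }\Gamma,$$ let $(x_i,y_j)$ be an irregular point of the uniform grid of mesh size $h$, and pick a base point $(x_i^*,y_j^* )\in\Gamma$ with $x_i^*=x_i-v_0$, $y_j^*=y_j-w_0$, $-h<v_0,w_0<h$. Then the compact scheme centered at $(x_i,y_j)$ for the numerical solution $(u_h)_{i,j}$, $$\begin{aligned}&(u_h)_{i-1,j-1}+4(u_h)_{i-1,j}+(u_h)_{i-1,j+1}+4(u_h)_{i,j-1}-20(u_h)_{i,j}+4(u_h)_{i,j+1}+(u_h)_{i+1,j-1}+4(u_h)_{i+1,j}+(u_h)_{i+1,j+1}\\&\quad=\sum_{(m,n)\in\Lambda_5}f_+^{(m,n)}J^+_{m,n}(h)+\sum_{(m,n)\in\Lambda_5}f_-^{(m,n)}J^-_{m,n}(h)+\sum_{(m,n)\in\Lambda_7}g_1^{(m,n)}J^{g_1}_{m,n}(h)+\sum_{(m,n)\in\Lambda_6}g^{(m,n)}J^{g}_{m,n}(h),\end{aligned}$$ with $J^\pm_{m,n},J^{g_1}_{m,n},J^g_{m,n}$ as defined in the context with $M=6$, achieves sixth order of accuracy; that is, when $(u_h)_{i+k,j+\ell}$ is replaced by the exact value $u(x_i+kh,y_j+\ell h)$ for $k,\ell\in\{-1,0,1\}$, the two sides differ by $\mathcal{O}(h^{8})$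 as $h\to0$. Moreover, for $M\in\{3,4,5\}$ the stencil of accuracy order $M$ is obtained from the sixth order compact scheme centered at $(x_i,y_j)$ with left-hand side $$(u_h)_{i-1,j-1}+4(u_h)_{i-1,j}+(u_h)_{i-1,j+1}+4(u_h)_{i,j-1}-20(u_h)_{i,j}+4(u_h)_{i,j+1}+(u_h)_{i+1,j-1}+4(u_h)_{i+1,j}+(u_h)_{i+1,j+1}$$ and right-hand side $$\sum_{(m,n)\in\Lambda_5}f_+^{(m,n)}J^+_{m,n}(h)+\sum_{(m,n)\in\Lambda_5}f_-^{(m,n)}J^-_{m,n}(h)+\sum_{(m,n)\in\Lambda_7}g_1^{(m,n)}J^{g_1}_{m,n}(h)+\sum_{(m,n)\in\Lambda_6}g^{(m,n)}J^{g}_{m,n}(h)$$ (the $J$'s being those for $M=6$) by dropping $G_{m,n}$ with $m+n>M+1$ and $H_{m,n}$ with $m+n>M-1$; that is, the scheme with the same left-hand side and with right-hand side $$\sum_{(m,n)\in\Lambda_{M-1}}\big(f_+^{(m,n)}J^+_{m,n}(h)+f_-^{(m,n)}J^-_{m,n}(h)\big)+\sum_{(m,n)\in\Lambda_{M+1}}g_1^{(m,n)}J^{g_1}_{m,n}(h)+\sum_{(m,n)\in\Lambda_M}g^{(m,n)}J^g_{m,n}(h),$$ where the $J$'s are those defined in the context for this $M$, has the two sides differing by $\mathcal{O}(h^{M+2})$ as $h\to0$ when the exact values of $u$ are inserted.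
   Context: Setting. $\Omega=(l_1,l_2)\times(l_3,l_4)$ with $l_4-l_3=N_0(l_2-l_1)$, $N_0$ a positive integer; for a positive integer $N_1$ put $N_2=N_0N_1$, $h=(l_2-l_1)/N_1$, $x_i=l_1+ih$ ($1\le i\le N_1-1$), $y_j=l_3+jh$ ($1\le j\le N_2-1$). $\psi$ is a smooth function of two variables; $\Gamma=\{(x,y)\in\Omega:\psi(x,y)=0\}$ is a smooth curve splitting $\Omega$ into $\Omega^+=\{\psi>0\}$ and $\Omega^-=\{\psi<0\}$, one lying on each side of $\Gamma$; $\vec n$ is the unit normal of $\Gamma$ pointing towards $\Omega^+$. For $(x_0,y_0)\in\Gamma$, $[u](x_0,y_0)$ is the limit of $u$ at $(x_0,y_0)$ from $\Omega^+$ minus its limit from $\Omega^-$, and $[\nabla u\cdot\vec n](x_0,y_0)$ is the limit of $\nabla u\cdot\vec n$ from $\Omega^+$ minus its limit from $\Omega^-$, where $\vec n=\vec n(x_0,y_0)$. Assumptions. $g_0,g_1,g$ are smooth ($g_1,g$ as functions of two variables). The restrictions $u_\pm,f_\pm$ of $u,f$ to $\Omega^\pm$ extend to smooth functions on a neighborhood of $\overline\Omega$, still denoted $u_\pm,f_\pm$. For $w\in\{u_\pm,f_\pm,g,g_1\}$ write $w^{(m,n)}=\frac{\partial^{m+n}w}{\partial x^m\partial y^n}(x_i^*,y_j^* )$. Irregular points. Let $d^+_{i,j}=\{(k,\ell)\in\{-1,0,1\}^2:\psi(x_i+kh,y_j+\ell h)\ge0\}$ and $d^-_{i,j}=\{(k,\ell)\in\{-1,0,1\}^2:\psi(x_i+kh,y_j+\ell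 h)<0\}$; $(x_i,y_j)$ is irregular if both sets are nonempty. The exact value $u(x_i+kh,y_j+\ell h)$ means $u_+(x_i+kh,y_j+\ell h)$ if $(k,\ell)\in d_{i,j}^+$ and $u_-(x_i+kh,y_j+\ell h)$ if $(k,\ell)\in d_{i,j}^-$. Index sets. $\mathbb{N}_0=\{0,1,2,\dots\}$, $\Lambda_K=\{(m,n)\in\mathbb{N}_0^2:m+n\le K\}$, $\Lambda^1_{M+1}=\{(m,n)\in\Lambda_{M+1}:m\in\{0,1\}\}$. Polynomials. $$G_{m,n}(x,y)=\sum_{\ell=0}^{\lfloor n/2\rfloor}(-1)^\ell\frac{x^{m+2\ell}y^{n-2\ell}}{(m+2\ell)!\,(n-2\ell)!}\quad(m\in\{0,1\},\ n\in\mathbb{N}_0),$$ $$H_{m,n}(x,y)=\sum_{\ell=1}^{1+\lfloor n/2\rfloor}(-1)^\ell\frac{x^{m+2\ell}y^{n-2\ell+2}}{(m+2\ell)!\,(n-2\ell+2)!}\quad(m,n\in\mathbb{N}_0).$$ Transmission coefficients. Near $(x_i^*,y_j^* )$ parameterize $\Gamma$ as $x=r(t)+x_i^*$, $y=s(t)+y_j^*$, $t\in(-\epsilon,\epsilon)$, with $r,s$ smooth, $r(0)=s(0)=0$, $(r')^2+(s')^2>0$. Let $\sigma=1$ if $(s',-r')/\sqrt{(r')^2+(s')^2}=\vec n$ along $\Gamma$ there, and $\sigma=-1$ if it is $-\vec n$. With $[t^p]\,\phi(t)=\frac1{p!}\phi^{(p)}(0)$, put $g_{m,n,p}=[t^p]G_{m,n}(r(t),s(t))$,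 $h_{m,n,p}=[t^p]H_{m,n}(r(t),s(t))$, $r_{m,n,p}=[t^p](r(t))^m(s(t))^n$, $\tilde g_{m,n,p}=[t^p](\nabla G_{m,n}(r(t),s(t))\cdot(s'(t),-r'(t)))$, $\tilde h_{m,n,p}=[t^p](\nabla H_{m,n}(r(t),s(t))\cdot(s'(t),-r'(t)))$, $\tilde r_{m,n,p}=[t^p]((r(t))^m(s(t))^n\sqrt{(r'(t))^2+(s'(t))^2})$. Let $$F_p=\sum_{(m,n)\in\Lambda_{M-1}}(f_-^{(m,n)}-f_+^{(m,n)})h_{m,n,p}+\sum_{(m,n)\in\Lambda_{M+1}}\frac{g_1^{(m,n)}}{m!\,n!}r_{m,n,p}\quad(1\le p\le M+1),$$ $$G_p=\sum_{(m,n)\in\Lambda_{M-1}}(f_-^{(m,n)}-f_+^{(m,n)})\tilde h_{m,n,p}+\sigma\sum_{(m,n)\in\Lambda_M}\frac{g^{(m,n)}}{m!\,n!}\tilde r_{m,n,p}\quad(0\le p\le M),$$ $$Q_p=\frac{1}{g_{0,p,p}\tilde g_{1,p-1,p-1}-g_{1,p-1,p}\tilde g_{0,p,p-1}}\begin{bmatrix}\tilde g_{1,p-1,p-1}&-g_{1,p-1,p}\\ -\tilde g_{0,p,p-1}&g_{0,p,p}\end{bmatrix}.$$ Define $U^{(m',n')}$, $(m',n')\in\Lambda_{M+1}^1$, by $U^{(0,0)}=g_1^{(0,0)}$ and, for $p=1,\ldots,M+1$, $$\begin{bmatrix} U^{(0,p)} \\ U^{(1,p-1)}\end{bmatrix}=Q_p\begin{bmatrix}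 F_p \\ G_{p-1}\end{bmatrix}-\sum_{n=1}^{p-1}Q_p\begin{bmatrix} U^{(0,n)}g_{0,n,p}+U^{(1,n-1)}g_{1,n-1,p} \\ U^{(0,n)}\tilde g_{0,n,p-1}+U^{(1,n-1)}\tilde g_{1,n-1,p-1}\end{bmatrix}.$$ Treating $f_\pm^{(m,n)},g_1^{(m,n)},g^{(m,n)}$ as formal symbols, define $T^\pm,T^{g_1},T^g$ as the coefficients in $$-U^{(m',n')}=\sum_{(m,n)\in\Lambda_{M-1}}(T^+_{m',n',m,n}f_+^{(m,n)}+T^-_{m',n',m,n}f_-^{(m,n)})+\sum_{(m,n)\in\Lambda_{M+1}}T^{g_1}_{m',n',m,n}g_1^{(m,n)}+\sum_{(m,n)\in\Lambda_M}T^g_{m',n',m,n}g^{(m,n)}.$$ Stencil quantities. Let $C_{0,0}=-20$, $C_{\pm1,0}=C_{0,\pm1}=4$, and $C_{k,\ell}=1$ for $k,\ell\in\{-1,1\}$. Put $$I^-_{m,n}(h)=\sum_{(k,\ell)\in d^-_{i,j}}C_{k,\ell}\,G_{m,n}(v_0+kh,w_0+\ell h),\qquad J^{\pm,0}_{m,n}(h)=\sum_{(k,\ell)\in d^\pm_{i,j}}C_{k,\ell}\,H_{m,n}(v_0+kh,w_0+\ell h),$$ $$J^{\pm}_{m,n}(h)=J^{\pm,0}_{m,n}(h)+\sum_{(m',n')\in\Lambda_{M+1}^1}I^-_{m',n'}(h)\,T^\pm_{m',n',m,n},$$ $$J^{g_1}_{m,n}(h)=\sum_{(m',n')\in\Lambda^1_{M+1}}I^-_{m',n'}(h)\,T^{g_1}_{m',n',m,n},\qquad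 J^{g}_{m,n}(h)=\sum_{(m',n')\in\Lambda^1_{M+1}}I^-_{m',n'}(h)\,T^{g}_{m',n',m,n}.$$ Convention. Accuracy order $M$ of a compact stencil normalized as here means that its two sides agree up to $\mathcal{O}(h^{M+2})$ as $h\to0$ when the exact solution is inserted. An empty sum is $0$. *)

(* Defs.v *)
From Stdlib Require Import Reals ZArith PeanoNat Lia FunctionalExtensionality.
From Coquelicot Require Import Coquelicot.

Open Scope R_scope.

(** * Geometry *)

Definition Omega (l1 l2 l3 l4 : R) (q : R * R) : Prop :=
  l1 < fst q < l2 /\ l3 < snd q < l4.

Definition closed_Omega (l1 l2 l3 l4 : R) (q : R * R) : Prop :=
  l1 <= fst q <= l2 /\ l3 <= snd q <= l4.

Definition boundary_Omega (l1 l2 l3 l4 : R) (q : R * R) : Prop :=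
  closed_Omega l1 l2 l3 l4 q /\ ~ Omega l1 l2 l3 l4 q.

Definition Gamma (l1 l2 l3 l4 : R) (psi : R -> R -> R) (q : R * R) : Prop :=
  Omega l1 l2 l3 l4 q /\ psi (fst q) (snd q) = 0.

Definition Omega_plus (l1 l2 l3 l4 : R) (psi : R -> R -> R) (q : R * R) : Prop :=
  Omega l1 l2 l3 l4 q /\ psi (fst q) (snd q) > 0.

Definition Omega_minus (l1 l2 l3 l4 : R) (psi : R -> R -> R) (q : R * R) : Prop :=
  Omega l1 l2 l3 l4 q /\ psi (fst q) (snd q) < 0.

(** Infinite differentiability on an open set: [ex_diff_n f k] is existence and
    continuity of all mixed partial derivatives of order at most [k]. *)
Definition smooth_on (D : R * R -> Prop) (f : R -> R -> R) : Prop :=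
  forall (k : nat) (x y : R), D (x, y) -> ex_diff_n f k x y.

(** [x = r(t) + x0], [y = s(t) + y0], [|t| < eps], is a regular smooth
    parameterization of the set [S] near [(x0, y0)].  The last clause says that
    arbitrarily short pieces of the arc already fill a neighbourhood of the
    point in [S], so that [S] has no other branch through [(x0, y0)]. *)
Definition local_parameterization (S : R * R -> Prop) (x0 y0 : R)
    (eps : R) (r s : R -> R) : Prop :=
  0 < eps /\
  (forall (k : nat) (t : R), Rabs t < eps -> ex_derive_n r k t /\ ex_derive_n s k t) /\
  r 0 = 0 /\ s 0 = 0 /\
  (forall t : R, Rabs t < eps -> 0 < Derive r t ^ 2 + Derive s t ^ 2) /\
  (forall t : R, Rabs t < eps -> S (r t + x0, s t + y0)) /\
  (forall delta : R, 0 < delta <= eps ->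
     locally ((x0, y0) : R * R)
       (fun q : R * R => S q ->
          exists t : R, Rabs t < delta /\ q = (r t + x0, s t + y0))).

Definition smooth_curve (S : R * R -> Prop) : Prop :=
  forall x0 y0 : R, S (x0, y0) ->
    exists (eps : R) (r s : R -> R), local_parameterization S x0 y0 eps r s.

(** [n] is a unit vector normal to the curve [S] at [(x0, y0)]; moving from the
    point along [n] enters [P], moving along [-n] enters [N].  In particular [P]
    and [N] lie on different sides of [S]. *)
Definition unit_normal_towards (S P N : R * R -> Prop) (x0 y0 : R) (n : R * R) : Prop :=
  fst n ^ 2 + snd n ^ 2 = 1 /\
  (forall (eps : R) (r s : R -> R), local_parameterization S x0 y0 eps r s ->
     fst n * Derive r 0 + snd n * Derive s 0 = 0) /\
  (exists delta : R, 0 < delta /\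
     forall tau : R, 0 < tau < delta ->
       P (x0 + tau * fst n, y0 + tau * snd n) /\
       N (x0 - tau * fst n, y0 - tau * snd n)).

(** * The interface problem *)

(** The limit of [w] at [(x0, y0)] from [P] minus its limit from [N] is [c]. *)
Definition jump (P N : R * R -> Prop) (w : R -> R -> R) (x0 y0 c : R) : Prop :=
  exists a b : R,
    filterlim (fun q : R * R => w (fst q) (snd q))
      (within P (locally ((x0, y0) : R * R))) (locally a) /\
    filterlim (fun q : R * R => w (fst q) (snd q))
      (within N (locally ((x0, y0) : R * R))) (locally b) /\
    a - b = c.

(** [nu] is the unit normal field along [Gamma].  The Dirichlet datum is the
    limit of [u] from inside the domain; at a boundary point where [psi]
    vanishes [u] has in general no such limit, and nothing is required. *)
Definition interface_problem (l1 l2 l3 l4 : R) (psi : R -> R -> R)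
    (nu : R -> R -> R * R) (u f g0 g1 g : R -> R -> R) : Prop :=
  let Om := Omega l1 l2 l3 l4 in
  let Ga := Gamma l1 l2 l3 l4 psi in
  let OmP := Omega_plus l1 l2 l3 l4 psi in
  let OmN := Omega_minus l1 l2 l3 l4 psi in
  (forall x y : R, Om (x, y) -> ~ Ga (x, y) ->
     - (partial_derive 2 0 u x y + partial_derive 0 2 u x y) = f x y) /\
  (forall x y : R, boundary_Omega l1 l2 l3 l4 (x, y) -> psi x y <> 0 ->
     filterlim (fun q : R * R => u (fst q) (snd q))
       (within (fun q => Om q /\ ~ Ga q) (locally ((x, y) : R * R)))
       (locally (g0 x y))) /\
  (forall x y : R, Ga (x, y) -> jump OmP OmN u x y (g1 x y)) /\
  (forall x y : R, Ga (x, y) ->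
     jump OmP OmN
       (fun a b : R => Derive (fun z => u z b) a * fst (nu x y)
                       + Derive (fun z => u a z) b * snd (nu x y))
       x y (g x y)).

(** Smoothness of the Dirichlet datum along each of the four sides. *)
Definition smooth_on_sides (l1 l2 l3 l4 : R) (g0 : R -> R -> R) : Prop :=
  (forall (k : nat) (x : R), l1 < x < l2 ->
     ex_derive_n (fun z => g0 z l3) k x /\ ex_derive_n (fun z => g0 z l4) k x) /\
  (forall (k : nat) (y : R), l3 < y < l4 ->
     ex_derive_n (fun z => g0 l1 z) k y /\ ex_derive_n (fun z => g0 l2 z) k y).

(** [w_P] and [w_N] are smooth on [D] and extend the restrictions of [w] to the
    two subdomains. *)
Definition smooth_extensions (l1 l2 l3 l4 : R) (psi : R -> R -> R) (D : R * R -> Prop)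
    (w w_P w_N : R -> R -> R) : Prop :=
  smooth_on D w_P /\ smooth_on D w_N /\
  (forall x y : R, Omega_plus l1 l2 l3 l4 psi (x, y) -> w_P x y = w x y) /\
  (forall x y : R, Omega_minus l1 l2 l3 l4 psi (x, y) -> w_N x y = w x y).

(** * Index sets and polynomials *)

(** Sum over the pairs [(m, n)] with [m + n <= K]. *)
Definition sum_Lambda {V : AbelianMonoid} (K : nat) (a : nat -> nat -> V) : V :=
  sum_n (fun m => sum_n (fun n => a m n) (K - m)) K.

(** Sum over the pairs [(m, n)] with [m + n <= K] and [m = 0] or [m = 1], for [1 <= K]. *)
Definition sum_Lambda1 {V : AbelianMonoid} (K : nat) (a : nat -> nat -> V) : V :=
  plus (sum_n (fun n => a 0%nat n) K) (sum_n (fun n => a 1%nat n) (K - 1)).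

Definition Gpoly (m n : nat) (x y : R) : R :=
  sum_n (fun l => (-1) ^ l *
                  (x ^ (m + 2 * l) * y ^ (n - 2 * l)
                   / (INR (fact (m + 2 * l)) * INR (fact (n - 2 * l)))))
        (n / 2).

(** The exponent is written [n + 2 - 2 l] because subtraction on [nat] truncates. *)
Definition Hpoly (m n : nat) (x y : R) : R :=
  sum_n_m (fun l => (-1) ^ l *
                    (x ^ (m + 2 * l) * y ^ (n + 2 - 2 * l)
                     / (INR (fact (m + 2 * l)) * INR (fact (n + 2 - 2 * l)))))
          1 (1 + n / 2).

(** * Transmission coefficients *)

Definition taylor_coef (p : nat) (phi : R -> R) : R := Derive_n phi p 0 / INR (fact p).

(** [grad w (r, s) . (s', -r')] at [t]. *)
Definition flux (w : R -> R -> R) (r s : R -> R) (t : R) : R :=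
  Derive (fun z => w z (s t)) (r t) * Derive s t
  - Derive (fun z => w (r t) z) (s t) * Derive r t.

Section Transmission.

Context (M : nat) (sigma : R) (r s : R -> R).

Definition g_coef (m n p : nat) : R := taylor_coef p (fun t => Gpoly m n (r t) (s t)).
Definition h_coef (m n p : nat) : R := taylor_coef p (fun t => Hpoly m n (r t) (s t)).
Definition r_coef (m n p : nat) : R := taylor_coef p (fun t => r t ^ m * s t ^ n).
Definition gt_coef (m n p : nat) : R := taylor_coef p (flux (Gpoly m n) r s).
Definition ht_coef (m n p : nat) : R := taylor_coef p (flux (Hpoly m n) r s).
Definition rt_coef (m n p : nat) : R :=
  taylor_coef p (fun t => r t ^ m * s t ^ n * sqrt (Derive r t ^ 2 + Derive s t ^ 2)).

(** The quantities [f_+^(m,n)], [f_-^(m,n)], [g_1^(m,n)], [g^(m,n)] live in an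
    arbitrary real vector space [V], so that they can be formal symbols. *)
Context {V : ModuleSpace R_Ring} (fP fN g1 g : nat -> nat -> V).

Definition Fvec (p : nat) : V :=
  plus (sum_Lambda (M - 1) (fun m n => scal (h_coef m n p) (minus (fN m n) (fP m n))))
       (sum_Lambda (M + 1) (fun m n =>
          scal (r_coef m n p / (INR (fact m) * INR (fact n))) (g1 m n))).

Definition Gvec (p : nat) : V :=
  plus (sum_Lambda (M - 1) (fun m n => scal (ht_coef m n p) (minus (fN m n) (fP m n))))
       (scal sigma (sum_Lambda M (fun m n =>
          scal (rt_coef m n p / (INR (fact m) * INR (fact n))) (g m n)))).

Definition Qmul (p : nat) (v : V * V) : V * V :=
  let d := g_coef 0 p p * gt_coef 1 (p - 1) (p - 1) - g_coef 1 (p - 1) p * gt_coef 0 p (p - 1) in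
  (scal (/ d) (minus (scal (gt_coef 1 (p - 1) (p - 1)) (fst v)) (scal (g_coef 1 (p - 1) p) (snd v))),
   scal (/ d) (minus (scal (g_coef 0 p p) (snd v)) (scal (gt_coef 0 p (p - 1)) (fst v)))).

(** The right-hand side of the recursion for [(U^(0,p), U^(1,p-1))], where [W n]
    stands for [(U^(0,n), U^(1,n-1))]. *)
Definition U_step (p : nat) (W : nat -> V * V) : V * V :=
  minus (Qmul p (Fvec p, Gvec (p - 1)))
    (sum_n_m (fun n =>
       Qmul p
         (plus (scal (g_coef 0 n p) (fst (W n))) (scal (g_coef 1 (n - 1) p) (snd (W n))),
          plus (scal (gt_coef 0 n (p - 1)) (fst (W n)))
               (scal (gt_coef 1 (n - 1) (p - 1)) (snd (W n)))))
       1 (p - 1)).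

(** [U_upto p n] is [(U^(0,n), U^(1,n-1))] for [n <= p]; the second component is
    meaningless when [n = 0]. *)
Fixpoint U_upto (p : nat) : nat -> V * V :=
  match p with
  | O => fun _ => (g1 0%nat 0%nat, zero)
  | S q => fun n => if n <=? q then U_upto q n else U_step (S q) (U_upto q)
  end.

Definition U_pair (p : nat) : V * V := U_upto p p.

(** [U m' n'] is [U^(m',n')]; only [m' = 0] and [m' = 1] are used. *)
Definition U (m' n' : nat) : V :=
  match m' with
  | O => fst (U_pair n')
  | _ => snd (U_pair (n' + 1))
  end.

Lemma U_upto_pair (p n : nat) : (n <= p)%nat -> U_upto p n = U_pair n.
Proof.
induction p as [|p IH]; intros Hn.
- now replace n with 0%nat by lia.
- destruct (Nat.eq_dec n (S p)) as [->|Hne]; [reflexivity|].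
  simpl. rewrite (proj2 (Nat.leb_le n p)) by lia. apply IH; lia.
Qed.

Lemma U_00 : U 0 0 = g1 0%nat 0%nat.
Proof. reflexivity. Qed.

Lemma U_rec (p : nat) : (1 <= p)%nat ->
  (U 0 p, U 1 (p - 1)) =
  minus (Qmul p (Fvec p, Gvec (p - 1)))
    (sum_n_m (fun n =>
       Qmul p (plus (scal (g_coef 0 n p) (U 0 n)) (scal (g_coef 1 (n - 1) p) (U 1 (n - 1))),
               plus (scal (gt_coef 0 n (p - 1)) (U 0 n))
                    (scal (gt_coef 1 (n - 1) (p - 1)) (U 1 (n - 1)))))
       1 (p - 1)).
Proof.
intros Hp. unfold U at 1 2. replace (p - 1 + 1)%nat with p by lia.
rewrite <- surjective_pairing.
destruct p as [|q]; [lia|].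
unfold U_pair at 1. cbn [U_upto].
rewrite (proj2 (Nat.leb_gt (S q) q)) by lia.
unfold U_step. f_equal. apply sum_n_m_ext_loc. intros n Hn.
rewrite U_upto_pair by lia. unfold U.
now replace (n - 1 + 1)%nat with n by lia.
Qed.

End Transmission.

(** Formal linear combinations of the symbols, as coefficient functions. *)
Inductive symbol : Set :=
  | sym_fP (m n : nat)
  | sym_fN (m n : nat)
  | sym_g1 (m n : nat)
  | sym_g (m n : nat).

Definition symbol_eq_dec (a b : symbol) : {a = b} + {a <> b}.
Proof. decide equality; apply Nat.eq_dec. Defined.

Definition form : Type := symbol -> R.

Lemma form_plus_comm (a b : form) : (fun c => a c + b c) = (fun c => b c + a c).
Proof. apply functional_extensionality; intros c; ring. Qed.

Lemma form_plus_assoc (a b d : form) :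
  (fun c => a c + (b c + d c)) = (fun c => (a c + b c) + d c).
Proof. apply functional_extensionality; intros c; ring. Qed.

Lemma form_plus_zero (a : form) : (fun c => a c + 0) = a.
Proof. apply functional_extensionality; intros c; ring. Qed.

Definition form_AbelianMonoid_mixin : AbelianMonoid.mixin_of form :=
  AbelianMonoid.Mixin form (fun a b c => a c + b c) (fun _ => 0)
    form_plus_comm form_plus_assoc form_plus_zero.

Canonical form_AbelianMonoid := AbelianMonoid.Pack form form_AbelianMonoid_mixin form.

Lemma form_plus_opp (a : form) : plus a (fun c => - a c) = zero.
Proof. apply functional_extensionality; intros c; apply Rplus_opp_r. Qed.

Definition form_AbelianGroup_mixin : AbelianGroup.mixin_of form_AbelianMonoid :=
  AbelianGroup.Mixin form_AbelianMonoid (fun a c => - a c) form_plus_opp.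

Canonical form_AbelianGroup := AbelianGroup.Pack form
  (AbelianGroup.Class form form_AbelianMonoid_mixin form_AbelianGroup_mixin) form.

Lemma form_scal_assoc (x y : R) (a : form) :
  (fun c => x * (y * a c)) = (fun c => x * y * a c).
Proof. apply functional_extensionality; intros c; ring. Qed.

Lemma form_scal_one (a : form) : (fun c => 1 * a c) = a.
Proof. apply functional_extensionality; intros c; ring. Qed.

Lemma form_scal_distr_l (x : R) (a b : form) :
  (fun c => x * (a c + b c)) = (fun c => x * a c + x * b c).
Proof. apply functional_extensionality; intros c; ring. Qed.

Lemma form_scal_distr_r (x y : R) (a : form) :
  (fun c => (x + y) * a c) = (fun c => x * a c + y * a c).
Proof. apply functional_extensionality; intros c; ring. Qed.

Definition form_ModuleSpace_mixin : ModuleSpace.mixin_of R_Ring form_AbelianGroup :=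
  ModuleSpace.Mixin R_Ring form_AbelianGroup (fun x a c => x * a c)
    form_scal_assoc form_scal_one form_scal_distr_l form_scal_distr_r.

Canonical form_ModuleSpace := ModuleSpace.Pack R_Ring form
  (ModuleSpace.Class R_Ring form
     (AbelianGroup.Class form form_AbelianMonoid_mixin form_AbelianGroup_mixin)
     form_ModuleSpace_mixin) form.

Definition sym (a : symbol) : form := fun c => if symbol_eq_dec a c then 1 else 0.

(** [U^(m',n')] computed on formal symbols. *)
Definition U_form (M : nat) (sigma : R) (r s : R -> R) (m' n' : nat) : form :=
  U M sigma r s
    (fun m n => sym (sym_fP m n)) (fun m n => sym (sym_fN m n))
    (fun m n => sym (sym_g1 m n)) (fun m n => sym (sym_g m n)) m' n'.

(** The coefficient of the symbol [c] in [- U^(m',n')]. *)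
Definition T (M : nat) (sigma : R) (r s : R -> R) (c : symbol) (m' n' : nat) : R :=
  - U_form M sigma r s m' n' c.

(** * The stencil *)

Definition stencil_coef (k l : Z) : R :=
  match k, l with
  | 0%Z, 0%Z => -20
  | 0%Z, _ => 4
  | _, 0%Z => 4
  | _, _ => 1
  end.

Definition in_stencil (k l : Z) : Prop := (-1 <= k <= 1)%Z /\ (-1 <= l <= 1)%Z.

Definition sum_stencil (a : Z -> Z -> R) : R :=
  a (-1)%Z (-1)%Z + a (-1)%Z 0%Z + a (-1)%Z 1%Z
  + a 0%Z (-1)%Z + a 0%Z 0%Z + a 0%Z 1%Z
  + a 1%Z (-1)%Z + a 1%Z 0%Z + a 1%Z 1%Z.

Section Stencil.

(** [(x, y)] is the centre [(x_i, y_j)]; the base point is [(x - v0, y - w0)]. *)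
Context (psi : R -> R -> R) (h x y v0 w0 : R).

Definition d_plus (k l : Z) : Prop :=
  in_stencil k l /\ psi (x + IZR k * h) (y + IZR l * h) >= 0.

Definition d_minus (k l : Z) : Prop :=
  in_stencil k l /\ psi (x + IZR k * h) (y + IZR l * h) < 0.

Definition irregular : Prop := (exists k l, d_plus k l) /\ (exists k l, d_minus k l).

(** Sums over [d_plus] and [d_minus]. *)
Definition sum_plus (a : Z -> Z -> R) : R :=
  sum_stencil (fun k l =>
    if Rge_dec (psi (x + IZR k * h) (y + IZR l * h)) 0 then a k l else 0).

Definition sum_minus (a : Z -> Z -> R) : R :=
  sum_stencil (fun k l =>
    if Rlt_dec (psi (x + IZR k * h) (y + IZR l * h)) 0 then a k l else 0).

Definition exact_value (uP uN : R -> R -> R) (k l : Z) : R :=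
  if Rge_dec (psi (x + IZR k * h) (y + IZR l * h)) 0
  then uP (x + IZR k * h) (y + IZR l * h)
  else uN (x + IZR k * h) (y + IZR l * h).

Definition scheme_lhs (w : Z -> Z -> R) : R :=
  w (-1)%Z (-1)%Z + 4 * w (-1)%Z 0%Z + w (-1)%Z 1%Z
  + 4 * w 0%Z (-1)%Z - 20 * w 0%Z 0%Z + 4 * w 0%Z 1%Z
  + w 1%Z (-1)%Z + 4 * w 1%Z 0%Z + w 1%Z 1%Z.

(** The families [Gs], [Hs] are [Gpoly], [Hpoly] or truncations of these. *)
Context (Gs Hs : nat -> nat -> R -> R -> R).

Definition I_minus (m n : nat) : R :=
  sum_minus (fun k l => stencil_coef k l * Gs m n (v0 + IZR k * h) (w0 + IZR l * h)).

Definition J0_plus (m n : nat) : R :=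
  sum_plus (fun k l => stencil_coef k l * Hs m n (v0 + IZR k * h) (w0 + IZR l * h)).

Definition J0_minus (m n : nat) : R :=
  sum_minus (fun k l => stencil_coef k l * Hs m n (v0 + IZR k * h) (w0 + IZR l * h)).

Context (M : nat) (sigma : R) (r s : R -> R).

Definition I_T (c : symbol) : R :=
  sum_Lambda1 (M + 1) (fun m' n' => I_minus m' n' * T M sigma r s c m' n').

Definition J_plus (m n : nat) : R := J0_plus m n + I_T (sym_fP m n).
Definition J_minus (m n : nat) : R := J0_minus m n + I_T (sym_fN m n).
Definition J_g1 (m n : nat) : R := I_T (sym_g1 m n).
Definition J_g (m n : nat) : R := I_T (sym_g m n).

Definition scheme_rhs (fP fN g1 g : R -> R -> R) : R :=
  let d w m n := partial_derive m n w (x - v0) (y - w0) in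
  sum_Lambda (M - 1) (fun m n => d fP m n * J_plus m n)
  + sum_Lambda (M - 1) (fun m n => d fN m n * J_minus m n)
  + sum_Lambda (M + 1) (fun m n => d g1 m n * J_g1 m n)
  + sum_Lambda M (fun m n => d g m n * J_g m n).

End Stencil.

(** Drops the members of a family whose index sum exceeds [K]. *)
Definition drop_above (K : nat) (P : nat -> nat -> R -> R -> R) (m n : nat) (x y : R) : R :=
  if m + n <=? K then P m n x y else 0.

(** * Grids and order of accuracy *)

Definition mesh (l1 l2 : R) (N1 : nat) : R := (l2 - l1) / INR N1.

(** On the grid with [N1] cells in the [x]-direction, [(x_i, y_j)] is an
    irregular interior point, [(x_i - v0, y_j - w0)] is a base point on [Gamma],
    [r], [s] parameterize [Gamma] near it, and [sigma] is the sign relating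
    [(s', -r') / |(r', s')|] to the normal field [nu]. *)
Definition stencil_configuration (l1 l2 l3 l4 : R) (N0 : nat) (psi : R -> R -> R)
    (nu : R -> R -> R * R) (N1 i j : nat) (v0 w0 : R) (r s : R -> R) (sigma : R) : Prop :=
  let h := mesh l1 l2 N1 in
  let x := l1 + INR i * h in
  let y := l3 + INR j * h in
  (1 <= N1)%nat /\ (1 <= i <= N1 - 1)%nat /\ (1 <= j <= N0 * N1 - 1)%nat /\
  irregular psi h x y /\
  - h < v0 < h /\ - h < w0 < h /\
  Gamma l1 l2 l3 l4 psi (x - v0, y - w0) /\
  (sigma = 1 \/ sigma = -1) /\
  exists eps : R,
    local_parameterization (Gamma l1 l2 l3 l4 psi) (x - v0) (y - w0) eps r s /\
    forall t : R, Rabs t < eps ->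
      let speed := sqrt (Derive r t ^ 2 + Derive s t ^ 2) in
      let n := nu (r t + (x - v0)) (s t + (y - w0)) in
      Derive s t / speed = sigma * fst n /\ - Derive r t / speed = sigma * snd n.

(** The two sides of the scheme with parameter [M] agree up to [O(h^(M+2))] as
    [h -> 0], uniformly in the irregular point, the base point and the
    parameterization. *)
Definition accuracy_order (M : nat) (l1 l2 l3 l4 : R) (N0 : nat) (psi : R -> R -> R)
    (nu : R -> R -> R * R) (uP uN fP fN g1 g : R -> R -> R) : Prop :=
  exists K h0 : R, 0 < h0 /\
    forall (N1 i j : nat) (v0 w0 : R) (r s : R -> R) (sigma : R),
      stencil_configuration l1 l2 l3 l4 N0 psi nu N1 i j v0 w0 r s sigma ->
      let h := mesh l1 l2 N1 in
      let x := l1 + INR i * h in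
      let y := l3 + INR j * h in
      h < h0 ->
      Rabs (scheme_lhs (exact_value psi h x y uP uN)
            - scheme_rhs psi h x y v0 w0 Gpoly Hpoly M sigma r s fP fN g1 g)
        <= K * h ^ (M + 2).

(* Main.v *)
Require Import Defs.
From Stdlib Require Import Reals Arith Lra Lia Classical ClassicalEpsilon.
From Coquelicot Require Import Coquelicot.

Open Scope R_scope.

(** Fix a base point on the interface and expand [uP] and [uN] there.  The
    equation [u_xx + u_yy = - f] eliminates from a Taylor polynomial every
    derivative of order at least two in [x]; what remains is a combination of
    the [G_{m,n}] with [m <= 1], weighted by derivatives of [u], and of the
    [H_{m,n}], weighted by derivatives of [f] ([jet_reorganisation]).

    Let [d^(m,n)] be the difference of the derivatives of [uP] and [uN] at the
    base point.  Along the curve [uP - uN = g1], and the difference of the fluxes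
    is [sigma] times the speed times [g].  After replacing each function by its
    Taylor polynomial, both identities hold up to a power of [t], and every term
    is a smooth function of [t]; hence all Taylor coefficients in [t] up to that
    power agree ([value_system], [flux_system]).  As [r] and [s] vanish at [0], a
    polynomial of degree [k] in them contributes nothing below [t^k], so these
    equations are block triangular in the [d^(m,n)] with [m <= 1].  The [p]-th
    diagonal block has determinant [p |z^p / p!|^2] with [z = s' + i r'] at the
    base point, because the [G_{0,p}] and [G_{1,p-1}] are the real and imaginary
    parts of [z^p / p!] ([transmission_determinant_neq_0]).  The recursion
    defining [U] is forward substitution in this system, so it returns the
    [d^(m,n)] ([U_jump]).

    For the scheme, write the Taylor polynomial at a node on the negative side as
    that of [uP], minus the [G] combination of the [d^(m,n)], with the [H] part of
    [fN].  The nine-point stencil annihilates the [G_{m,n}] of degree at most seven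
    ([stencil_annihilates_Gpoly]), and what is left is the right-hand side exactly
    ([scheme_exact_on_Taylor_polynomials]).  The error is therefore a sum of nine
    Taylor remainders.  These are of order [h^(M+2)] with a constant independent of
    the grid, since the derivatives of [uP] and [uN] are bounded on the closed
    rectangle ([uniform_Taylor]).

    The schemes of lower order arise by truncation for the same triangularity
    reason: the first equations of the system, hence the first unknowns, involve
    only data of low order ([U_order_independent]). *)

(** * Finite sums *)

(** The sums are stated in abstract groups; [ring] and [lra] recognise only the
    concrete operations and the concrete carrier. *)
Ltac to_R :=
  change (@plus R_AbelianMonoid) with Rplus in *; change (@mult R_Ring) with Rmult in *;
  change (@zero R_AbelianMonoid) with 0 in *;
  lazymatch goal with |- ?a = ?b => change (@eq R a b) | _ => idtac end.

Lemma sum_n_first {V : AbelianMonoid} (a : nat -> V) (n : nat) :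
  sum_n a (S n) = plus (a 0%nat) (sum_n (fun k => a (S k)) n).
Proof.
unfold sum_n. rewrite sum_Sn_m by lia. f_equal. symmetry; apply sum_n_m_S.
Qed.

Lemma sum_n_eq_zero {V : AbelianMonoid} (a : nat -> V) (n : nat) :
  (forall k, (k <= n)%nat -> a k = zero) -> sum_n a n = zero.
Proof.
intros Ha. rewrite (sum_n_ext_loc a (fun _ => zero)) by exact Ha.
apply sum_n_m_const_zero.
Qed.

Lemma sum_n_truncate {V : AbelianMonoid} (a : nat -> V) (n n' : nat) :
  (n <= n')%nat -> (forall k, (n < k)%nat -> a k = zero) -> sum_n a n' = sum_n a n.
Proof.
intros Hn Ha. induction Hn as [|n' Hn IH]; [reflexivity|].
rewrite sum_Sn, IH, Ha by lia. apply plus_zero_r.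
Qed.

Lemma sum_Lambda_ext {V : AbelianMonoid} (K : nat) (a b : nat -> nat -> V) :
  (forall m n, (m + n <= K)%nat -> a m n = b m n) -> sum_Lambda K a = sum_Lambda K b.
Proof.
intros Hab. apply sum_n_ext_loc; intros m Hm.
apply sum_n_ext_loc; intros n Hn. apply Hab; lia.
Qed.

Lemma sum_Lambda_eq_zero {V : AbelianMonoid} (K : nat) (a : nat -> nat -> V) :
  (forall m n, (m + n <= K)%nat -> a m n = zero) -> sum_Lambda K a = zero.
Proof.
intros Ha. apply sum_n_eq_zero; intros m Hm. apply sum_n_eq_zero; intros n Hn.
apply Ha; lia.
Qed.

Lemma sum_Lambda_plus {V : AbelianMonoid} (K : nat) (a b : nat -> nat -> V) :
  sum_Lambda K (fun m n => plus (a m n) (b m n)) = plus (sum_Lambda K a) (sum_Lambda K b).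
Proof.
unfold sum_Lambda. rewrite <- sum_n_plus. apply sum_n_ext; intros m. apply sum_n_plus.
Qed.

Lemma sum_Lambda_truncate {V : AbelianMonoid} (K K' : nat) (a : nat -> nat -> V) :
  (K <= K')%nat -> (forall m n, (K < m + n)%nat -> a m n = zero) ->
  sum_Lambda K' a = sum_Lambda K a.
Proof.
intros HK Ha. unfold sum_Lambda.
rewrite (sum_n_truncate _ K K') by
  (try assumption; intros m Hm; apply sum_n_eq_zero; intros; apply Ha; lia).
apply sum_n_ext_loc; intros m Hm. apply sum_n_truncate; [lia|].
intros n Hn; apply Ha; lia.
Qed.

(** Both index sets grow by one antidiagonal at a time; inductions on the order
    use this instead of the rows in which the sums are written. *)
Lemma sum_Lambda_S {V : AbelianMonoid} (K : nat) (a : nat -> nat -> V) :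
  sum_Lambda (S K) a = plus (sum_Lambda K a) (sum_n (fun m => a m (S K - m)%nat) (S K)).
Proof.
unfold sum_Lambda. rewrite !sum_Sn, plus_assoc, <- sum_n_plus.
f_equal.
- apply sum_n_ext_loc; intros m Hm.
  replace (S K - m)%nat with (S (K - m)) by lia. apply sum_Sn.
- now rewrite Nat.sub_diag, sum_O.
Qed.

Lemma sum_Lambda1_ext {V : AbelianMonoid} (K : nat) (a b : nat -> nat -> V) :
  (1 <= K)%nat -> (forall m n, (m <= 1)%nat -> (m + n <= K)%nat -> a m n = b m n) ->
  sum_Lambda1 K a = sum_Lambda1 K b.
Proof.
intros HK Hab. unfold sum_Lambda1.
f_equal; apply sum_n_ext_loc; intros n Hn; apply Hab; lia.
Qed.

Lemma sum_Lambda1_eq_zero {V : AbelianMonoid} (K : nat) (a : nat -> nat -> V) :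
  (1 <= K)%nat -> (forall m n, (m <= 1)%nat -> (m + n <= K)%nat -> a m n = zero) ->
  sum_Lambda1 K a = zero.
Proof.
intros HK Ha. unfold sum_Lambda1.
rewrite !sum_n_eq_zero, plus_zero_r; try reflexivity; intros; apply Ha; lia.
Qed.

Lemma sum_Lambda1_truncate {V : AbelianMonoid} (K K' : nat) (a : nat -> nat -> V) :
  (1 <= K <= K')%nat -> (forall m n, (K < m + n)%nat -> a m n = zero) ->
  sum_Lambda1 K' a = sum_Lambda1 K a.
Proof.
intros HK Ha. unfold sum_Lambda1.
f_equal; apply sum_n_truncate; try lia; intros; apply Ha; lia.
Qed.

Lemma sum_Lambda1_plus {V : AbelianMonoid} (K : nat) (a b : nat -> nat -> V) :
  sum_Lambda1 K (fun m n => plus (a m n) (b m n)) =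
  plus (sum_Lambda1 K a) (sum_Lambda1 K b).
Proof.
unfold sum_Lambda1. rewrite !sum_n_plus, <- !plus_assoc. f_equal.
rewrite !plus_assoc. f_equal. apply plus_comm.
Qed.

Lemma sum_Lambda1_S {V : AbelianMonoid} (K : nat) (a : nat -> nat -> V) :
  (1 <= K)%nat ->
  sum_Lambda1 (S K) a = plus (sum_Lambda1 K a) (plus (a 0%nat (S K)) (a 1%nat K)).
Proof.
intros HK. destruct K as [|K]; [lia|]. unfold sum_Lambda1.
rewrite sum_Sn. replace (S (S K) - 1)%nat with (S K) by lia.
replace (S K - 1)%nat with K by lia. rewrite (sum_Sn (fun n => a 1%nat n)).
rewrite <- !plus_assoc. f_equal. rewrite !plus_assoc. f_equal. apply plus_comm.
Qed.

(** * The polynomials [G] and [H] *)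

(** The divided power. *)
Definition dpow (n : nat) (x : R) : R := x ^ n / INR (fact n).

Lemma dpow_0 x : dpow 0 x = 1.
Proof. unfold dpow; simpl; field. Qed.

Lemma dpow_1 x : dpow 1 x = x.
Proof. unfold dpow; simpl; field. Qed.

Lemma dpow_S n x : INR (S n) * dpow (S n) x = x * dpow n x.
Proof.
unfold dpow. rewrite fact_simpl, mult_INR. simpl pow.
assert (INR (S n) <> 0) by (apply not_0_INR; lia).
assert (INR (fact n) <> 0) by apply INR_fact_neq_0.
field; auto.
Qed.

Lemma is_derive_Rconst (c x : R) : is_derive (fun _ => c) x 0.
Proof. apply (is_derive_const (K := R_AbsRing) (V := R_NormedModule)). Qed.

Lemma is_derive_dpow n x :
  is_derive (dpow n) x (match n with O => 0 | S k => dpow k x end).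
Proof.
destruct n as [|n].
- apply (is_derive_ext (fun _ => 1)).
  + intros t; now rewrite dpow_0.
  + apply is_derive_Rconst.
- apply (is_derive_ext (fun t => / INR (fact (S n)) * t ^ S n)).
  + intros t; unfold dpow, Rdiv; apply Rmult_comm.
  + replace (dpow n x) with (/ INR (fact (S n)) * (INR (S n) * 1 * x ^ pred (S n))).
    * apply is_derive_scal, (is_derive_pow (fun t => t)).
      apply (is_derive_id (K := R_AbsRing)).
    * unfold dpow. rewrite fact_simpl, mult_INR. simpl pred.
      assert (INR (S n) <> 0) by (apply not_0_INR; lia).
      assert (INR (fact n) <> 0) by apply INR_fact_neq_0.
      field; auto.
Qed.

(** In divided powers differentiation only shifts an index, and no factorial is
    left to simplify. *)
Lemma Gpoly_dpow m n x y :
  Gpoly m n x y =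
  sum_n (fun l => (-1) ^ l * (dpow (m + 2 * l) x * dpow (n - 2 * l) y)) (n / 2).
Proof.
apply sum_n_ext; intros l. unfold dpow. to_R.
assert (INR (fact (m + 2 * l)) <> 0) by apply INR_fact_neq_0.
assert (INR (fact (n - 2 * l)) <> 0) by apply INR_fact_neq_0.
field; auto.
Qed.

Lemma Gpoly_n0 m x y : Gpoly m 0 x y = dpow m x.
Proof.
rewrite Gpoly_dpow. change (0 / 2)%nat with 0%nat.
rewrite sum_O, dpow_0, Nat.add_0_r. simpl; ring.
Qed.

Lemma Gpoly_n1 m x y : Gpoly m 1 x y = dpow m x * y.
Proof.
rewrite Gpoly_dpow. change (1 / 2)%nat with 0%nat.
rewrite sum_O, dpow_1, Nat.add_0_r. simpl; ring.
Qed.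

Lemma shifted_Gpoly_sum m n x y :
  sum_n (fun l => (-1) ^ S l * (dpow (m + 2 * S l) x * dpow (S (S n) - 2 * S l) y)) (n / 2)
  = - Gpoly (S (S m)) n x y.
Proof.
rewrite Gpoly_dpow.
match goal with |- _ = - ?S => replace (- S) with (@mult R_Ring (-1) S) by (to_R; ring) end.
rewrite <- (sum_n_mult_l (K := R_Ring)).
apply sum_n_ext; intros l. to_R.
replace (S (S m) + 2 * l)%nat with (m + 2 * S l)%nat by lia.
replace (S (S n) - 2 * S l)%nat with (n - 2 * l)%nat by lia.
simpl pow; ring.
Qed.

(** Splitting off the summand of index [0] leaves, up to sign, a polynomial of
    the same shape; every identity for [G] below is an induction on this step. *)
Lemma Gpoly_SS m n x y :
  Gpoly m (S (S n)) x y = dpow m x * dpow (S (S n)) y - Gpoly (S (S m)) n x y.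
Proof.
rewrite Gpoly_dpow. replace (S (S n) / 2)%nat with (S (n / 2)) by
  (change (S (S n)) with (2 + n)%nat; rewrite <- Nat.div_add_l with (b := 2%nat) (a := 1%nat);
   [reflexivity | lia]).
rewrite sum_n_first, shifted_Gpoly_sum. to_R.
rewrite Nat.mul_0_r, Nat.add_0_r, Nat.sub_0_r. simpl pow; ring.
Qed.

(** The summation in [H] starts where that of [G] has its second term, so facts
    about [G] with an arbitrary first index apply to [H]. *)
Lemma Hpoly_Gpoly m n x y : Hpoly m n x y = - Gpoly (S (S m)) n x y.
Proof.
rewrite <- shifted_Gpoly_sum. unfold Hpoly.
change (1 + n / 2)%nat with (S (n / 2)). rewrite <- sum_n_m_S.
apply sum_n_m_ext; intros l. unfold dpow. to_R.
replace (n + 2 - 2 * S l)%nat with (S (S n) - 2 * S l)%nat by lia.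
assert (INR (fact (m + 2 * S l)) <> 0) by apply INR_fact_neq_0.
assert (INR (fact (S (S n) - 2 * S l)) <> 0) by apply INR_fact_neq_0.
field; auto.
Qed.

Lemma nat_ind2 (P : nat -> Prop) :
  P 0%nat -> P 1%nat -> (forall n, P n -> P (S (S n))) -> forall n, P n.
Proof.
intros H0 H1 HS n. enough (P n /\ P (S n)) by tauto.
induction n as [|n [IH IH']]; auto.
Qed.

(** Differentiating in [x] lowers the first index.  From [0] it reaches [-1],
    where the divided power of [x] vanishes and [Gpoly_SS] reads
    [G_{-1,n+2} = - G_{1,n}]. *)
Definition Gpoly_dx (m n : nat) (x y : R) : R :=
  match m, n with
  | S m', _ => Gpoly m' n x y
  | O, S (S n') => - Gpoly 1 n' x y
  | O, _ => 0
  end.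

Definition Gpoly_dy (m n : nat) (x y : R) : R :=
  match n with
  | O => 0
  | S n' => Gpoly m n' x y
  end.

Lemma is_derive_value (f : R -> R) x l l' : is_derive f x l -> l = l' -> is_derive f x l'.
Proof. now intros H <-. Qed.

Lemma is_derive_Rmult (f g : R -> R) x l l' :
  is_derive f x l -> is_derive g x l' ->
  is_derive (fun t => f t * g t) x (l * g x + f x * l').
Proof. intros Hf Hg. apply (is_derive_mult f g); auto. intros; apply Rmult_comm. Qed.

Lemma is_derive_Gpoly_x n : forall m x y,
  is_derive (fun z => Gpoly m n z y) x (Gpoly_dx m n x y).
Proof.
induction n as [| |n IH] using nat_ind2; intros m x y.
- apply (is_derive_ext (dpow m)); [intros; now rewrite Gpoly_n0|].
  generalize (is_derive_dpow m x).
  destruct m; simpl; rewrite ?Gpoly_n0; auto.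
- apply (is_derive_ext (fun z => dpow m z * y)); [intros; now rewrite Gpoly_n1|].
  eapply is_derive_value.
  + apply (is_derive_Rmult _ _ _ _ 0 (is_derive_dpow m x)).
    apply is_derive_Rconst.
  + destruct m; simpl; rewrite ?Gpoly_n1; ring.
- apply (is_derive_ext (fun z => dpow m z * dpow (S (S n)) y - Gpoly (S (S m)) n z y));
    [intros; now rewrite Gpoly_SS|].
  eapply is_derive_value.
  + apply (is_derive_minus (K := R_AbsRing) (V := R_NormedModule)); [|apply IH].
    apply (is_derive_Rmult _ _ _ _ 0 (is_derive_dpow m x) (is_derive_Rconst _ _)).
  + unfold minus, plus, opp; simpl.
    destruct m; simpl; rewrite ?Gpoly_SS; simpl; ring.
Qed.

Lemma is_derive_Gpoly_y n : forall m x y,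
  is_derive (fun z => Gpoly m n x z) y (Gpoly_dy m n x y).
Proof.
induction n as [| |n IH] using nat_ind2; intros m x y.
- apply (is_derive_ext (fun _ => dpow m x)); [intros; now rewrite Gpoly_n0|].
  apply is_derive_Rconst.
- apply (is_derive_ext (fun z => dpow m x * z)); [intros; now rewrite Gpoly_n1|].
  simpl. rewrite Gpoly_n0. auto_derive; [exact I|ring].
- apply (is_derive_ext (fun z => dpow m x * dpow (S (S n)) z - Gpoly (S (S m)) n x z));
    [intros; now rewrite Gpoly_SS|].
  eapply is_derive_value.
  + apply (is_derive_minus (K := R_AbsRing) (V := R_NormedModule)); [|apply IH].
    apply (is_derive_Rmult (fun _ => dpow m x) _ y 0 _ (is_derive_Rconst _ _)
             (is_derive_dpow (S (S n)) y)).
  + unfold minus, plus, opp; simpl. destruct n; simpl.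
    * rewrite Gpoly_n1, dpow_1. ring.
    * rewrite Gpoly_SS. ring.
Qed.

(** Euler's relation.  For [m <= 1] it is the complex recursion
    [p (z^p / p!) = z (z^(p-1) / (p-1)!)] split into real and imaginary parts. *)
Lemma Gpoly_Euler n : forall m x y,
  INR (m + n) * Gpoly m n x y = x * Gpoly_dx m n x y + y * Gpoly_dy m n x y.
Proof.
induction n as [| |n IH] using nat_ind2; intros m x y.
- rewrite Nat.add_0_r, Gpoly_n0. destruct m; simpl Gpoly_dx; simpl Gpoly_dy.
  + rewrite dpow_0; simpl; ring.
  + rewrite Gpoly_n0, dpow_S; ring.
- rewrite plus_INR, Gpoly_n1. simpl Gpoly_dy. rewrite Gpoly_n0.
  destruct m; simpl Gpoly_dx.
  + simpl; ring.
  + rewrite Gpoly_n1. replace (x * (dpow m x * y)) with (INR (S m) * dpow (S m) x * y)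
      by (rewrite dpow_S; ring).
    change (INR 1) with 1; ring.
- specialize (IH (S (S m)) x y).
  replace (m + S (S n))%nat with (S (S m) + n)%nat by lia.
  rewrite Gpoly_SS. rewrite Rmult_minus_distr_l, IH.
  replace (INR (S (S m) + n)) with (INR m + INR (S (S n))) by (rewrite <- plus_INR; f_equal; lia).
  rewrite Rmult_plus_distr_r.
  replace (INR (S (S n)) * (dpow m x * dpow (S (S n)) y)) with
    (dpow m x * (INR (S (S n)) * dpow (S (S n)) y)) by ring.
  rewrite dpow_S.
  replace (INR m * (dpow m x * dpow (S (S n)) y)) with
    (INR m * dpow m x * dpow (S (S n)) y) by ring.
  assert (Hm : INR m * dpow m x = x * match m with O => 0 | S k => dpow k x end).
  { destruct m; [simpl; ring|apply dpow_S]. }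
  rewrite Hm. simpl Gpoly_dx. simpl Gpoly_dy.
  destruct m; destruct n; simpl Gpoly_dx; simpl Gpoly_dy; rewrite ?Gpoly_n1, ?Gpoly_SS, ?dpow_1; ring.
Qed.

(** With [z = b + i a], the two polynomials are the real and imaginary parts of
    [z^p / p!], and [z] is not zero. *)
Lemma Gpoly_pair_nonzero p : forall a b, 0 < a ^ 2 + b ^ 2 ->
  (1 <= p)%nat -> 0 < Gpoly 0 p a b ^ 2 + Gpoly 1 (p - 1) a b ^ 2.
Proof.
intros a b Hab. induction p as [|p IH]; intros Hp; [lia|].
replace (S p - 1)%nat with p by lia.
destruct p as [|p].
- rewrite Gpoly_n1, Gpoly_n0, dpow_0, dpow_1. nra.
- specialize (IH ltac:(lia)). replace (S p - 1)%nat with p in IH by lia.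
  assert (H0 := Gpoly_Euler (S (S p)) 0 a b). assert (H1 := Gpoly_Euler (S p) 1 a b).
  simpl Gpoly_dx in H0, H1. simpl Gpoly_dy in H0, H1.
  change (0 + S (S p))%nat with (S (S p)) in H0.
  change (1 + S p)%nat with (S (S p)) in H1.
  set (c := Gpoly 0 (S p) a b) in *. set (d := Gpoly 1 p a b) in *.
  set (N := INR (S (S p))) in *.
  set (c' := Gpoly 0 (S (S p)) a b) in *. set (d' := Gpoly 1 (S p) a b) in *.
  assert (Hprod : N ^ 2 * (c' ^ 2 + d' ^ 2) = (a ^ 2 + b ^ 2) * (c ^ 2 + d ^ 2)).
  { replace (N ^ 2 * (c' ^ 2 + d' ^ 2)) with ((N * c') ^ 2 + (N * d') ^ 2) by ring.
    rewrite H0, H1; ring. }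
  assert (Hpos : 0 < (a ^ 2 + b ^ 2) * (c ^ 2 + d ^ 2)) by (apply Rmult_lt_0_compat; assumption).
  rewrite <- Hprod in Hpos.
  destruct (Rle_or_lt (c' ^ 2 + d' ^ 2) 0) as [Hle|]; [|assumption].
  assert (0 <= N ^ 2) by apply pow2_ge_0. nra.
Qed.

(** The determinant of the [p]-th pair of transmission equations, [(a, b)] being
    the tangent vector at the base point.  The rotated derivative
    [b d/dx - a d/dy] of [z^p / p!] at [z = b + i a] is [i p z^p / p!], so the
    determinant is [p] times the squared modulus of [z^p / p!]. *)
Lemma leading_determinant_neq_0 p a b : 0 < a ^ 2 + b ^ 2 -> (1 <= p)%nat ->
  Gpoly 0 p a b * (Gpoly_dx 1 (p - 1) a b * b - Gpoly_dy 1 (p - 1) a b * a)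
  - Gpoly 1 (p - 1) a b * (Gpoly_dx 0 p a b * b - Gpoly_dy 0 p a b * a) <> 0.
Proof.
intros Hab Hp. assert (Hpos := Gpoly_pair_nonzero p a b Hab Hp).
destruct p as [|p]; [lia|]. replace (S p - 1)%nat with p in * by lia.
assert (H0 := Gpoly_Euler (S p) 0 a b). assert (H1 := Gpoly_Euler p 1 a b).
assert (Hx : Gpoly_dx 0 (S p) a b = - Gpoly_dy 1 p a b)
  by (destruct p; simpl; ring).
assert (Hy : Gpoly_dy 0 (S p) a b = Gpoly_dx 1 p a b) by reflexivity.
change (0 + S p)%nat with (S p) in H0. change (1 + p)%nat with (S p) in H1.
rewrite Hx, Hy in *.
set (c := Gpoly 0 (S p) a b) in *. set (d := Gpoly 1 p a b) in *.
replace (c * (Gpoly_dx 1 p a b * b - Gpoly_dy 1 p a b * a)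
         - d * (- Gpoly_dy 1 p a b * b - Gpoly_dx 1 p a b * a))
  with (INR (S p) * (c ^ 2 + d ^ 2)).
- apply Rmult_integral_contrapositive_currified; [apply not_0_INR; lia|lra].
- transitivity (c * (INR (S p) * c) + d * (INR (S p) * d)); [ring|].
  rewrite H0, H1; ring.
Qed.

(** Eliminating every derivative of order at least two in the first variable
    through [a_{m+2,n} + a_{m,n+2} = - f_{m,n}] turns the monomials of a Taylor
    polynomial into [G] and [H]; one degree at a time. *)
Lemma homogeneous_reorganisation (N : nat) (a f : nat -> nat -> R) (x y : R) :
  (forall m n, (m + n = N)%nat -> a (S (S m)) n + a m (S (S n)) = - f m n) ->
  sum_n (fun m => a m (S (S N) - m)%nat * (dpow m x * dpow (S (S N) - m) y)) (S (S N)) =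
  a 0%nat (S (S N)) * Gpoly 0 (S (S N)) x y + a 1%nat (S N) * Gpoly 1 (S N) x y
  + sum_n (fun m => f m (N - m)%nat * Hpoly m (N - m) x y) N.
Proof.
intros Hf.
set (P := fun m => a m (S (S N) - m)%nat * Gpoly m (S (S N) - m) x y).
transitivity (sum_n P (S (S N))
   + sum_n (fun m => a m (S (S (N - m))) * Gpoly (S (S m)) (N - m) x y) N).
- rewrite !sum_Sn. to_R.
  rewrite (sum_n_ext_loc _
    (fun m => plus (P m) (a m (S (S (N - m))) * Gpoly (S (S m)) (N - m) x y)) N).
  + rewrite sum_n_plus. to_R.
    unfold P. replace (S (S N) - S (S N))%nat with 0%nat by lia.
    replace (S (S N) - S N)%nat with 1%nat by lia.
    rewrite Gpoly_n0, Gpoly_n1, dpow_0, dpow_1. ring.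
  + intros m Hm. unfold P. replace (S (S N) - m)%nat with (S (S (N - m))) by lia.
    rewrite Gpoly_SS. to_R. ring.
- rewrite 2!sum_n_first. unfold P at 1 2. to_R.
  rewrite Nat.sub_0_r. replace (S (S N) - 1)%nat with (S N) by lia.
  rewrite !Rplus_assoc. do 2 f_equal.
  rewrite <- (sum_n_plus (G := R_AbelianMonoid)). apply sum_n_ext_loc; intros m Hm.
  unfold P. to_R. rewrite Hpoly_Gpoly.
  replace (S (S N) - S (S m))%nat with (N - m)%nat by lia.
  rewrite Ropp_mult_distr_r_reverse, Ropp_mult_distr_l, <- Hf by lia. ring.
Qed.

Lemma jet_reorganisation (K : nat) (a f : nat -> nat -> R) (x y : R) :
  (forall m n, (m + n <= K)%nat -> a (S (S m)) n + a m (S (S n)) = - f m n) ->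
  sum_Lambda (S (S K)) (fun m n => a m n * (dpow m x * dpow n y)) =
  sum_Lambda1 (S (S K)) (fun m n => a m n * Gpoly m n x y)
  + sum_Lambda K (fun m n => f m n * Hpoly m n x y).
Proof.
intros Hf. induction K as [|K IH].
- rewrite 2!sum_Lambda_S, sum_Lambda1_S by lia.
  rewrite (homogeneous_reorganisation 0 a f) by (intros; apply Hf; lia).
  to_R. unfold sum_Lambda, sum_Lambda1.
  simpl Nat.sub. rewrite !sum_Sn, !sum_O. to_R.
  rewrite !Gpoly_n0, !Gpoly_n1, !dpow_0, !dpow_1. simpl Nat.sub.
  ring.
- rewrite sum_Lambda_S, IH by (intros; apply Hf; lia).
  rewrite (homogeneous_reorganisation (S K) a f) by (intros; apply Hf; lia).
  rewrite (sum_Lambda1_S (S (S K))), (sum_Lambda_S K) by lia.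
  to_R. ring.
Qed.

(** In the complex variable [z = y + i x] the nine weights applied to the
    offsets [zeta = l + i k] satisfy [sum C zeta^j = 0] for [j <= 7]: the
    fourfold symmetry leaves only [j = 0] and [j = 4], which cancel. *)
Lemma stencil_annihilates_Gpoly m n v w h : (m <= 1)%nat -> (m + n <= 7)%nat ->
  sum_stencil (fun k l => stencil_coef k l * Gpoly m n (v + IZR k * h) (w + IZR l * h)) = 0.
Proof.
intros Hm Hn.
assert (Hf : forall j, INR (fact j) = IZR (Z.of_nat (fact j))) by (intros; apply INR_IZR_INZ).
unfold sum_stencil, stencil_coef.
destruct m as [|[|m]]; [| |lia];
  destruct n as [|[|[|[|[|[|[|[|n]]]]]]]]; try lia;
  rewrite ?Gpoly_SS, ?Gpoly_n1, ?Gpoly_n0; unfold dpow; rewrite !Hf;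
  cbv [fact Nat.mul Nat.add Z.of_nat Pos.of_succ_nat Pos.succ]; field.
Qed.

(** * Taylor coefficients of functions of one variable *)

Definition smooth1 (eps : R) (f : R -> R) : Prop :=
  forall (k : nat) (t : R), Rabs t < eps -> ex_derive_n f k t.

(** The derivatives are carried as witnesses, so that closure properties need
    no rewriting under [Derive]. *)
Fixpoint diff_tower (eps : R) (k : nat) (f : R -> R) : Prop :=
  match k with
  | O => True
  | S k' => exists f', (forall t, Rabs t < eps -> is_derive f t (f' t)) /\ diff_tower eps k' f'
  end.

Lemma locally_Rabs_lt (eps t : R) : Rabs t < eps -> locally t (fun z : R => Rabs z < eps).
Proof.
intros Ht. exists (mkposreal (eps - Rabs t) ltac:(lra)). intros z Hz.
unfold ball in Hz; simpl in Hz. unfold AbsRing_ball, abs, minus, plus, opp in Hz; simpl in Hz.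
replace z with ((z + - t) + t) by ring.
eapply Rle_lt_trans; [apply Rabs_triang|lra].
Qed.

Lemma Derive_n_Derive f n t : Derive_n (Derive f) n t = Derive_n f (S n) t.
Proof.
change (Derive f) with (Derive_n f 1). rewrite Derive_n_comp. f_equal; lia.
Qed.

Lemma smooth1_Derive eps f : smooth1 eps f -> smooth1 eps (Derive f).
Proof.
intros Hf k t Ht. destruct k as [|k]; [exact I|].
apply (ex_derive_ext (Derive_n f (S k))).
- intros z; symmetry; apply Derive_n_Derive.
- apply (Hf (S (S k)) t Ht).
Qed.

Lemma smooth1_is_derive eps f t : smooth1 eps f -> Rabs t < eps -> is_derive f t (Derive f t).
Proof. intros Hf Ht. apply Derive_correct. exact (Hf 1%nat t Ht). Qed.

Lemma diff_tower_Derive_n eps k : forall f, diff_tower eps k f ->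
  forall j t, (j <= k)%nat -> Rabs t < eps -> ex_derive_n f j t.
Proof.
induction k as [|k IH]; intros f Hf j t Hj Ht.
- replace j with 0%nat by lia. exact I.
- destruct Hf as [f' [Hf Hf']]. destruct j as [|[|j]].
  + exact I.
  + exists (f' t). now apply Hf.
  + apply (ex_derive_ext_loc (Derive_n f' j)).
    * apply (filter_imp (fun z => Rabs z < eps)); [|now apply locally_Rabs_lt].
      intros z Hz. rewrite <- Derive_n_Derive. apply Derive_n_ext_loc.
      apply (filter_imp (fun z => Rabs z < eps)); [|now apply locally_Rabs_lt].
      intros w Hw. symmetry. now apply is_derive_unique, Hf.
    * apply (IH f' Hf' (S j) t); [lia|exact Ht].
Qed.

Lemma smooth1_diff_tower eps f : smooth1 eps f <-> forall k, diff_tower eps k f.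
Proof.
split.
- intros Hf k. revert f Hf. induction k as [|k IH]; intros f Hf; [exact I|].
  exists (Derive f). split.
  + intros t Ht; now apply smooth1_is_derive with eps.
  + now apply IH, smooth1_Derive.
- intros Hf k t Ht. now apply (diff_tower_Derive_n eps k f (Hf k) k t).
Qed.

Lemma diff_tower_pred eps k : forall f, diff_tower eps (S k) f -> diff_tower eps k f.
Proof.
induction k as [|k IH]; intros f [f' [Hf Hf']]; [exact I|].
exists f'. split; [exact Hf|]. now apply IH.
Qed.

Lemma diff_tower_const eps k c : diff_tower eps k (fun _ => c).
Proof.
revert c; induction k as [|k IH]; intros c; [exact I|].
exists (fun _ => 0). split; [intros; apply is_derive_Rconst|apply IH].
Qed.

Lemma diff_tower_plus eps k : forall f g,
  diff_tower eps k f -> diff_tower eps k g -> diff_tower eps k (fun t => f t + g t).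
Proof.
induction k as [|k IH]; intros f g; [easy|]. intros [f' [Hf Hf']] [g' [Hg Hg']].
exists (fun t => f' t + g' t). split; [|now apply IH].
intros t Ht. apply (is_derive_plus (K := R_AbsRing) (V := R_NormedModule)); auto.
Qed.

Lemma diff_tower_mult eps k : forall f g,
  diff_tower eps k f -> diff_tower eps k g -> diff_tower eps k (fun t => f t * g t).
Proof.
induction k as [|k IH]; intros f g; [easy|]. intros Hf Hg.
assert (Hf0 := diff_tower_pred _ _ _ Hf). assert (Hg0 := diff_tower_pred _ _ _ Hg).
destruct Hf as [f' [Hf Hf']]. destruct Hg as [g' [Hg Hg']].
exists (fun t => f' t * g t + f t * g' t). split.
- intros t Ht. apply is_derive_Rmult; auto.
- apply diff_tower_plus; now apply IH.
Qed.

(** [z = 1 / sqrt phi] satisfies [z' = - z^3 phi' / 2], so its differentiability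
    bootstraps from that of [phi]. *)
Lemma diff_tower_inv_sqrt eps k : forall phi,
  (forall t, Rabs t < eps -> 0 < phi t) ->
  diff_tower eps k phi -> diff_tower eps k (fun t => / sqrt (phi t)).
Proof.
induction k as [|k IH]; intros phi Hpos Hphi; [exact I|].
assert (Hz := IH phi Hpos (diff_tower_pred _ _ _ Hphi)).
destruct Hphi as [phi' [Hphi Hphi']].
exists (fun t => - / 2 * ((/ sqrt (phi t) * (/ sqrt (phi t) * / sqrt (phi t))) * phi' t)).
split.
- intros t Ht. assert (Hp := Hpos t Ht). assert (Hs := sqrt_lt_R0 _ Hp).
  eapply is_derive_value.
  + apply is_derive_inv; [|lra].
    apply (is_derive_comp sqrt phi t (/ (2 * sqrt (phi t)))); [|now apply Hphi].
    apply is_derive_Reals, derivable_pt_lim_sqrt, Hp.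
  + unfold scal; simpl; unfold mult; simpl. field. lra.
- apply diff_tower_mult; [apply diff_tower_const|].
  repeat apply diff_tower_mult; auto.
Qed.

Lemma smooth1_ext eps f g :
  (forall t, Rabs t < eps -> f t = g t) -> smooth1 eps f -> smooth1 eps g.
Proof.
intros Hfg Hf k t Ht. apply (ex_derive_n_ext_loc f).
- apply (filter_imp (fun z => Rabs z < eps)); [exact Hfg|now apply locally_Rabs_lt].
- now apply Hf.
Qed.

Lemma smooth1_const eps c : smooth1 eps (fun _ => c).
Proof. apply smooth1_diff_tower. intros k; apply diff_tower_const. Qed.

Lemma smooth1_plus eps f g : smooth1 eps f -> smooth1 eps g -> smooth1 eps (fun t => f t + g t).
Proof. rewrite !smooth1_diff_tower. intros Hf Hg k. now apply diff_tower_plus. Qed.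

Lemma smooth1_mult eps f g : smooth1 eps f -> smooth1 eps g -> smooth1 eps (fun t => f t * g t).
Proof. rewrite !smooth1_diff_tower. intros Hf Hg k. now apply diff_tower_mult. Qed.

Lemma smooth1_scal eps c f : smooth1 eps f -> smooth1 eps (fun t => c * f t).
Proof. apply (smooth1_mult eps (fun _ => c) f), smooth1_const. Qed.

Lemma smooth1_minus eps f g : smooth1 eps f -> smooth1 eps g -> smooth1 eps (fun t => f t - g t).
Proof.
intros Hf Hg. apply (smooth1_ext eps (fun t => f t + (-1) * g t)); [intros; ring|].
now apply smooth1_plus, smooth1_scal.
Qed.

Lemma smooth1_pow eps f n : smooth1 eps f -> smooth1 eps (fun t => f t ^ n).
Proof.
intros Hf. induction n as [|n IH]; [exact (smooth1_const eps 1)|].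
apply (smooth1_mult eps f (fun t => f t ^ n)); assumption.
Qed.

Lemma smooth1_sqrt eps f :
  (forall t, Rabs t < eps -> 0 < f t) -> smooth1 eps f -> smooth1 eps (fun t => sqrt (f t)).
Proof.
intros Hpos Hf. apply (smooth1_ext eps (fun t => f t * / sqrt (f t))).
- intros t Ht. assert (Hp := Hpos t Ht). assert (Hs := sqrt_lt_R0 _ Hp).
  rewrite <- (sqrt_sqrt (f t)) at 1 by lra. field. lra.
- apply smooth1_mult; [assumption|]. apply smooth1_diff_tower. intros k.
  apply diff_tower_inv_sqrt; [assumption|]. now apply smooth1_diff_tower.
Qed.

Lemma smooth1_sum_n eps (f : nat -> R -> R) n :
  (forall k, (k <= n)%nat -> smooth1 eps (f k)) ->
  smooth1 eps (fun t => sum_n (fun k => f k t) n).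
Proof.
intros Hf. induction n as [|n IH].
- apply (smooth1_ext eps (f 0%nat)); [intros; now rewrite sum_O|apply Hf; lia].
- apply (smooth1_ext eps (fun t => sum_n (fun k => f k t) n + f (S n) t)).
  + intros; now rewrite sum_Sn.
  + apply smooth1_plus; [apply IH; intros; apply Hf; lia|apply Hf; lia].
Qed.

Lemma smooth1_near0 eps f p : 0 < eps -> smooth1 eps f ->
  locally 0 (fun y : R => forall k, (k <= p)%nat -> ex_derive_n f k y).
Proof.
intros He Hf. apply (filter_imp (fun z => Rabs z < eps)).
- intros z Hz k Hk. now apply Hf.
- apply locally_Rabs_lt. now rewrite Rabs_R0.
Qed.

Lemma taylor_coef_plus eps f g p : 0 < eps -> smooth1 eps f -> smooth1 eps g ->
  taylor_coef p (fun t => f t + g t) = taylor_coef p f + taylor_coef p g.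
Proof.
intros He Hf Hg. unfold taylor_coef. rewrite Derive_n_plus by
  (eapply smooth1_near0; eassumption). unfold Rdiv; ring.
Qed.

Lemma taylor_coef_scal c f p : taylor_coef p (fun t => c * f t) = c * taylor_coef p f.
Proof. unfold taylor_coef. rewrite Derive_n_scal_l. unfold Rdiv; ring. Qed.

Lemma taylor_coef_minus eps f g p : 0 < eps -> smooth1 eps f -> smooth1 eps g ->
  taylor_coef p (fun t => f t - g t) = taylor_coef p f - taylor_coef p g.
Proof.
intros He Hf Hg. unfold taylor_coef. rewrite Derive_n_minus by
  (eapply smooth1_near0; eassumption). unfold Rdiv; ring.
Qed.

Lemma taylor_coef_ext eps f g p : 0 < eps ->
  (forall t, Rabs t < eps -> f t = g t) -> taylor_coef p f = taylor_coef p g.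
Proof.
intros He Hfg. unfold taylor_coef. f_equal. apply Derive_n_ext_loc.
apply (filter_imp (fun z => Rabs z < eps)); [exact Hfg|].
apply locally_Rabs_lt. now rewrite Rabs_R0.
Qed.

Lemma taylor_coef_sum_n eps (f : nat -> R -> R) n p : 0 < eps ->
  (forall k, (k <= n)%nat -> smooth1 eps (f k)) ->
  taylor_coef p (fun t => sum_n (fun k => f k t) n) = sum_n (fun k => taylor_coef p (f k)) n.
Proof.
intros He Hf. induction n as [|n IH].
- rewrite sum_O. apply (taylor_coef_ext eps); [assumption|]. intros; now rewrite sum_O.
- rewrite sum_Sn, <- IH by (intros; apply Hf; lia). to_R.
  rewrite <- (taylor_coef_plus eps);
    [|assumption|apply smooth1_sum_n; intros; apply Hf; lia|apply Hf; lia].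
  apply (taylor_coef_ext eps); [assumption|]. intros; now rewrite sum_Sn.
Qed.

(** Only [t > 0] is considered: one side determines the Taylor coefficients of a
    smooth function.  With [L = 0] this is the class [O(t^(p+1))], so that one
    calculus serves both leading terms and remainders. *)
Definition lead (p : nat) (f : R -> R) (L : R) : Prop :=
  exists C d : R, 0 < d /\ forall t, 0 < t < d -> Rabs (f t - L * t ^ p) <= C * t ^ S p.

Lemma lead_ext eps p f g L : 0 < eps ->
  (forall t, 0 < t < eps -> f t = g t) -> lead p f L -> lead p g L.
Proof.
intros He Hfg (C & d & Hd & H). exists C, (Rmin d eps).
split; [now apply Rmin_glb_lt|]. intros t Ht.
assert (Rmin d eps <= d) by apply Rmin_l. assert (Rmin d eps <= eps) by apply Rmin_r.
rewrite <- Hfg by lra. apply H; lra.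
Qed.

Lemma lead_const c : lead 0 (fun _ => c) c.
Proof.
exists 0, 1. split; [lra|]. intros t Ht. simpl pow.
replace (c - c * 1) with 0 by ring. rewrite Rabs_R0. nra.
Qed.

Lemma lead_plus p f g L L' : lead p f L -> lead p g L' -> lead p (fun t => f t + g t) (L + L').
Proof.
intros (C & d & Hd & H) (C' & d' & Hd' & H'). exists (C + C'), (Rmin d d').
split; [now apply Rmin_glb_lt|]. intros t Ht.
assert (Rmin d d' <= d) by apply Rmin_l. assert (Rmin d d' <= d') by apply Rmin_r.
replace (f t + g t - (L + L') * t ^ p) with ((f t - L * t ^ p) + (g t - L' * t ^ p)) by ring.
eapply Rle_trans; [apply Rabs_triang|]. rewrite Rmult_plus_distr_r.
apply Rplus_le_compat; [apply H|apply H']; lra.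
Qed.

Lemma lead_mult p q f g L L' :
  lead p f L -> lead q g L' -> lead (p + q) (fun t => f t * g t) (L * L').
Proof.
intros (C & d & Hd & H) (C' & d' & Hd' & H').
exists ((Rabs L + C) * C' + Rabs L' * C), (Rmin 1 (Rmin d d')).
split; [repeat apply Rmin_glb_lt; lra|]. intros t Ht.
assert (Rmin d d' <= d) by apply Rmin_l. assert (Rmin d d' <= d') by apply Rmin_r.
assert (Rmin 1 (Rmin d d') <= 1) by apply Rmin_l.
assert (Rmin 1 (Rmin d d') <= Rmin d d') by apply Rmin_r.
specialize (H t ltac:(lra)). specialize (H' t ltac:(lra)).
assert (Htp : 0 < t ^ p) by (apply pow_lt; lra).
assert (Htq : 0 < t ^ q) by (apply pow_lt; lra).
simpl pow in H, H'. rewrite pow_add. simpl pow. rewrite pow_add.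
set (tp := t ^ p) in *. set (tq := t ^ q) in *.
assert (HC : 0 <= C).
{ apply Rnot_lt_le; intros Hn. assert (0 <= C * (t * tp)) by (eapply Rle_trans; [apply Rabs_pos|exact H]).
  assert (0 < t * tp) by (apply Rmult_lt_0_compat; lra). nra. }
assert (Hf : Rabs (f t) <= (Rabs L + C) * tp).
{ replace (f t) with (L * tp + (f t - L * tp)) by ring.
  eapply Rle_trans; [apply Rabs_triang|]. rewrite Rabs_mult, (Rabs_pos_eq tp) by lra.
  assert (C * (t * tp) <= C * tp) by (apply Rmult_le_compat_l; nra). lra. }
replace (f t * g t - L * L' * (tp * tq)) with
  (f t * (g t - L' * tq) + L' * tq * (f t - L * tp)) by ring.
eapply Rle_trans; [apply Rabs_triang|]. rewrite !Rabs_mult, (Rabs_pos_eq tq) by lra.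
replace (((Rabs L + C) * C' + Rabs L' * C) * (t * (tp * tq))) with
  ((Rabs L + C) * tp * (C' * (t * tq)) + Rabs L' * tq * (C * (t * tp))) by ring.
apply Rplus_le_compat.
- apply Rmult_le_compat; auto using Rabs_pos.
- apply Rmult_le_compat_l; [|exact H]. apply Rmult_le_pos; [apply Rabs_pos|lra].
Qed.

Lemma lead_scal p c f L : lead p f L -> lead p (fun t => c * f t) (c * L).
Proof. intros Hf. apply (lead_mult 0 p (fun _ => c) f c L); [apply lead_const|exact Hf]. Qed.

Lemma lead_minus p f g L L' : lead p f L -> lead p g L' -> lead p (fun t => f t - g t) (L - L').
Proof.
intros Hf Hg. replace (L - L') with (L + (-1) * L') by ring.
apply (lead_ext 1 p (fun t => f t + (-1) * g t)); [lra|intros; ring|].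
apply lead_plus, lead_scal; assumption.
Qed.

Lemma lead_pow f a n : lead 1 f a -> lead n (fun t => f t ^ n) (a ^ n).
Proof.
intros Hf. induction n as [|n IH]; [exact (lead_const 1)|].
apply (lead_mult 1 n f (fun t => f t ^ n) a (a ^ n)); assumption.
Qed.

Lemma lead_weaken p f L : lead (S p) f L -> lead p f 0.
Proof.
intros (C & d & Hd & H). exists (Rabs L + Rabs C), (Rmin 1 d).
split; [apply Rmin_glb_lt; lra|]. intros t Ht.
assert (Rmin 1 d <= 1) by apply Rmin_l. assert (Rmin 1 d <= d) by apply Rmin_r.
specialize (H t ltac:(lra)). assert (Htp : 0 < t ^ p) by (apply pow_lt; lra).
simpl pow in *. set (tp := t ^ p) in *.
assert (0 < t * tp) by (apply Rmult_lt_0_compat; lra).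
replace (f t - 0 * tp) with ((f t - L * (t * tp)) + L * (t * tp)) by ring.
eapply Rle_trans; [apply Rabs_triang|].
rewrite Rabs_mult, (Rabs_pos_eq (t * tp)) by lra.
assert (C <= Rabs C) by apply Rle_abs. assert (0 <= Rabs C) by apply Rabs_pos.
assert (C * (t * (t * tp)) <= Rabs C * (t * tp)); [|lra].
apply Rle_trans with (Rabs C * (t * (t * tp))).
- apply Rmult_le_compat_r; nra.
- apply Rmult_le_compat_l; [lra|]. rewrite <- (Rmult_1_l (t * tp)) at 2.
  apply Rmult_le_compat_r; lra.
Qed.

Lemma lead_zero_le p q f L : (p < q)%nat -> lead q f L -> lead p f 0.
Proof.
intros Hpq. revert L. induction Hpq as [|q Hpq IH]; intros L Hf.
- now apply lead_weaken with L.
- apply (IH 0). now apply lead_weaken with L.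
Qed.

Lemma lead_unique p f L L' : lead p f L -> lead p f L' -> L = L'.
Proof.
intros Hf Hf'. destruct (lead_minus p f f L L' Hf Hf') as (C & d & Hd & H).
destruct (Req_dec L L') as [|Hne]; [assumption|exfalso].
assert (Hpos : 0 < Rabs (L - L')) by (apply Rabs_pos_lt; lra).
set (m := Rabs (L - L')) in *.
(* any positive [t] below [m / C] violates [m <= C t] *)
set (t := Rmin (d / 2) (m / (2 * (Rabs C + 1)))).
assert (HC := Rabs_pos C).
assert (0 < m / (2 * (Rabs C + 1))) by (apply Rdiv_lt_0_compat; lra).
assert (Ht : 0 < t) by (apply Rmin_glb_lt; lra).
assert (t <= d / 2) by apply Rmin_l.
assert (Ht2 : t <= m / (2 * (Rabs C + 1))) by apply Rmin_r.
specialize (H t ltac:(lra)).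
replace (f t - f t - (L - L') * t ^ p) with (- ((L - L') * t ^ p)) in H by ring.
assert (Htp : 0 < t ^ p) by (apply pow_lt; lra).
rewrite Rabs_Ropp, Rabs_mult, (Rabs_pos_eq (t ^ p)) in H by lra. simpl pow in H.
fold m in H. assert (H2 : m * t ^ p <= (C * t) * t ^ p) by lra.
apply Rmult_le_reg_r in H2; [|assumption].
assert (C <= Rabs C) by apply Rle_abs.
assert (Ht3 : t * (2 * (Rabs C + 1)) <= m).
{ apply (Rmult_le_compat_r (2 * (Rabs C + 1))) in Ht2; [|lra].
  unfold Rdiv in Ht2. rewrite Rmult_assoc, Rinv_l in Ht2; lra. }
nra.
Qed.

(** Taylor's formula at [0]; the remainder is bounded because the derivative in
    it is continuous at [0]. *)
Lemma smooth1_lead eps f p : 0 < eps -> smooth1 eps f ->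
  (forall i, (i < p)%nat -> taylor_coef i f = 0) -> lead p f (taylor_coef p f).
Proof.
intros He Hf Hz.
assert (Hcont : continuous (Derive_n f (S p)) 0).
{ apply (ex_derive_continuous (K := R_AbsRing) (V := R_NormedModule)).
  apply (Hf (S (S p)) 0). now rewrite Rabs_R0. }
destruct (proj1 (filterlim_locally _ _) Hcont (mkposreal 1 Rlt_0_1)) as [del Hdel].
set (B := Rabs (Derive_n f (S p) 0) + 1).
exists (B / INR (fact (S p))), (Rmin del eps).
split; [apply Rmin_glb_lt; [apply cond_pos|assumption]|]. intros t Ht.
assert (Rmin del eps <= del) by apply Rmin_l. assert (Rmin del eps <= eps) by apply Rmin_r.
destruct (Taylor_Lagrange f p 0 t) as [z [Hz1 Hz2]]; [lra| |].
{ intros u Hu k Hk. apply Hf. rewrite Rabs_pos_eq; lra. }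
rewrite Hz2. rewrite Rminus_0_r.
assert (Hsum : sum_f_R0 (fun m => t ^ m / INR (fact m) * Derive_n f m 0) p
               = taylor_coef p f * t ^ p).
{ rewrite (sum_eq _ (fun m => taylor_coef m f * t ^ m))
    by (intros; unfold taylor_coef, Rdiv; ring).
  destruct p as [|p]; [reflexivity|]. rewrite tech5.
  rewrite (sum_eq_R0 _ p) by (intros; rewrite Hz by lia; ring). ring. }
rewrite Hsum.
match goal with |- Rabs (?a + ?b - ?c) <= _ => replace (a + b - c) with b by ring end.
assert (Hfact : 0 < INR (fact (S p))) by (apply INR_fact_lt_0).
assert (Htp : 0 < t ^ S p) by (apply pow_lt; lra).
rewrite Rabs_mult, Rabs_pos_eq by (apply Rlt_le, Rdiv_lt_0_compat; assumption).
replace (B / INR (fact (S p)) * t ^ S p) with (t ^ S p / INR (fact (S p)) * B)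
  by (unfold Rdiv; ring).
apply Rmult_le_compat_l; [apply Rlt_le, Rdiv_lt_0_compat; assumption|].
assert (Hball : ball (Derive_n f (S p) 0) 1 (Derive_n f (S p) z)).
{ apply Hdel. unfold ball; simpl. unfold AbsRing_ball, abs, minus, plus, opp; simpl.
  rewrite Rabs_pos_eq; lra. }
unfold ball in Hball; simpl in Hball.
unfold AbsRing_ball, abs, minus, plus, opp in Hball; simpl in Hball.
unfold B. change (Derive_n f (S p)) with (Derive (Derive_n f p)).
replace (Derive (Derive_n f p) z) with
  (Derive (Derive_n f p) 0 + (Derive (Derive_n f p) z + - Derive (Derive_n f p) 0)) by ring.
eapply Rle_trans; [apply Rabs_triang|lra].
Qed.

(** By induction: once the lower coefficients vanish, the next Taylor coefficient
    is a leading coefficient, and leading coefficients are unique.  This turns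
    estimates along the curve into equations between Taylor coefficients without
    differentiating any composition with a function of two variables. *)
Lemma lead_taylor_coef_below eps f p L : 0 < eps -> smooth1 eps f -> lead p f L ->
  forall i, (i < p)%nat -> taylor_coef i f = 0.
Proof.
intros He Hf HL i. induction i as [i IH] using lt_wf_ind. intros Hi.
apply (lead_unique i f).
- apply (smooth1_lead eps); [assumption..|]. intros k Hk; apply IH; lia.
- now apply (lead_zero_le i p f L).
Qed.

Lemma lead_taylor_coef eps f p L : 0 < eps -> smooth1 eps f -> lead p f L ->
  taylor_coef p f = L.
Proof.
intros He Hf HL. apply (lead_unique p f); [|assumption].
apply (smooth1_lead eps); [assumption..|]. now apply lead_taylor_coef_below with eps L.
Qed.

(** * Leading coefficients along a parameterized curve *)

Section Curve.

Context (eps : R) (r s : R -> R).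
Context (eps_pos : 0 < eps) (r_smooth : smooth1 eps r) (s_smooth : smooth1 eps s)
  (r_0 : r 0 = 0) (s_0 : s 0 = 0)
  (regular : forall t, Rabs t < eps -> 0 < Derive r t ^ 2 + Derive s t ^ 2).

Let a := Derive r 0.
Let b := Derive s 0.

Lemma lead_vanishing_at_0 f : smooth1 eps f -> f 0 = 0 -> lead 1 f (Derive f 0).
Proof.
intros Hf H0. replace (Derive f 0) with (taylor_coef 1 f)
  by (unfold taylor_coef; change (Derive_n f 1 0) with (Derive f 0); simpl INR; field).
apply (smooth1_lead eps); [assumption..|]. intros i Hi.
replace i with 0%nat by lia. unfold taylor_coef; simpl. rewrite H0; field.
Qed.

Lemma lead_value_at_0 f : smooth1 eps f -> lead 0 f (f 0).
Proof.
intros Hf. replace (f 0) with (taylor_coef 0 f) by (unfold taylor_coef; simpl; field).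
apply (smooth1_lead eps); [assumption..|]. intros i Hi; lia.
Qed.

Lemma lead_r : lead 1 r a.
Proof. now apply lead_vanishing_at_0. Qed.

Lemma lead_s : lead 1 s b.
Proof. now apply lead_vanishing_at_0. Qed.

Lemma lead_dpow f c n : lead 1 f c -> lead n (fun t => dpow n (f t)) (dpow n c).
Proof.
intros Hf. unfold dpow, Rdiv. rewrite Rmult_comm.
apply (lead_ext 1 n (fun t => / INR (fact n) * f t ^ n)); [lra|intros; ring|].
apply lead_scal. now apply lead_pow.
Qed.

Lemma smooth1_dpow f n : smooth1 eps f -> smooth1 eps (fun t => dpow n (f t)).
Proof.
intros Hf. apply (smooth1_ext eps (fun t => / INR (fact n) * f t ^ n));
  [intros; unfold dpow, Rdiv; ring|].
now apply smooth1_scal, smooth1_pow.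
Qed.

Lemma smooth1_Gpoly n : forall m, smooth1 eps (fun t => Gpoly m n (r t) (s t)).
Proof.
induction n as [| |n IH] using nat_ind2; intros m.
- apply (smooth1_ext eps (fun t => dpow m (r t))); [intros; now rewrite Gpoly_n0|].
  now apply smooth1_dpow.
- apply (smooth1_ext eps (fun t => dpow m (r t) * s t)); [intros; now rewrite Gpoly_n1|].
  apply smooth1_mult; [now apply smooth1_dpow|assumption].
- apply (smooth1_ext eps
    (fun t => dpow m (r t) * dpow (S (S n)) (s t) - Gpoly (S (S m)) n (r t) (s t)));
    [intros; now rewrite Gpoly_SS|].
  apply smooth1_minus; [|apply IH]. apply smooth1_mult; now apply smooth1_dpow.
Qed.

(** A homogeneous polynomial of degree [m + n] in [(r, s) = t (a, b) + O(t^2)]. *)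
Lemma lead_Gpoly n : forall m,
  lead (m + n) (fun t => Gpoly m n (r t) (s t)) (Gpoly m n a b).
Proof.
induction n as [| |n IH] using nat_ind2; intros m.
- rewrite Nat.add_0_r, Gpoly_n0.
  apply (lead_ext 1 m (fun t => dpow m (r t))); [lra|intros; now rewrite Gpoly_n0|].
  apply lead_dpow, lead_r.
- rewrite Gpoly_n1.
  apply (lead_ext 1 _ (fun t => dpow m (r t) * s t)); [lra|intros; now rewrite Gpoly_n1|].
  apply lead_mult; [apply lead_dpow, lead_r|apply lead_s].
- rewrite Gpoly_SS.
  apply (lead_ext 1 _
    (fun t => dpow m (r t) * dpow (S (S n)) (s t) - Gpoly (S (S m)) n (r t) (s t)));
    [lra|intros; now rewrite Gpoly_SS|].
  apply lead_minus.
  + apply lead_mult; apply lead_dpow; [apply lead_r|apply lead_s].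
  + replace (m + S (S n))%nat with (S (S m) + n)%nat by lia. apply IH.
Qed.

Lemma flux_Gpoly m n t : flux (Gpoly m n) r s t =
  Gpoly_dx m n (r t) (s t) * Derive s t - Gpoly_dy m n (r t) (s t) * Derive r t.
Proof.
unfold flux.
rewrite (is_derive_unique (fun z : R => Gpoly m n z (s t)) _ _ (is_derive_Gpoly_x n m (r t) (s t))).
now rewrite (is_derive_unique (fun z : R => Gpoly m n (r t) z) _ _ (is_derive_Gpoly_y n m (r t) (s t))).
Qed.

Lemma smooth1_flux_Gpoly m n : smooth1 eps (flux (Gpoly m n) r s).
Proof.
apply (smooth1_ext eps (fun t =>
  Gpoly_dx m n (r t) (s t) * Derive s t - Gpoly_dy m n (r t) (s t) * Derive r t));
  [intros; symmetry; apply flux_Gpoly|].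
apply smooth1_minus; apply smooth1_mult.
- destruct m as [|m]; [destruct n as [|[|n]]|]; simpl;
    [apply smooth1_const|apply smooth1_const| |apply smooth1_Gpoly].
  apply (smooth1_ext eps (fun t => (-1) * Gpoly 1 n (r t) (s t))); [intros; ring|].
  apply smooth1_scal, smooth1_Gpoly.
- now apply (smooth1_Derive eps s).
- destruct n as [|n]; simpl; [apply smooth1_const|apply smooth1_Gpoly].
- now apply (smooth1_Derive eps r).
Qed.

Lemma lead_zero p : lead p (fun _ => 0) 0.
Proof.
exists 0, 1. split; [lra|]. intros t Ht. rewrite Rmult_0_l, Rminus_0_r, Rabs_R0. lra.
Qed.

(** The flux loses one degree: the gradient has degree [m + n - 1] and the tangent
    vector does not vanish. *)
Lemma lead_flux_Gpoly m n p : (m + n = S p)%nat ->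
  lead p (flux (Gpoly m n) r s) (Gpoly_dx m n a b * b - Gpoly_dy m n a b * a).
Proof.
intros Hp.
apply (lead_ext 1 p (fun t =>
  Gpoly_dx m n (r t) (s t) * Derive s t - Gpoly_dy m n (r t) (s t) * Derive r t));
  [lra|intros; symmetry; apply flux_Gpoly|].
rewrite <- (Nat.add_0_r p).
apply lead_minus; apply lead_mult.
- destruct m as [|m]; [destruct n as [|[|n]]|]; simpl;
    [apply lead_zero|apply lead_zero| |].
  + replace p with (1 + n)%nat by lia.
    replace (- Gpoly 1 n a b) with ((-1) * Gpoly 1 n a b) by ring.
    apply (lead_ext 1 _ (fun t => (-1) * Gpoly 1 n (r t) (s t))); [lra|intros; ring|].
    apply lead_scal, lead_Gpoly.
  + replace p with (m + n)%nat by lia. apply lead_Gpoly.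
- apply (lead_value_at_0 (Derive s)); now apply smooth1_Derive.
- destruct n as [|n]; simpl; [apply lead_zero|].
  replace p with (m + n)%nat by lia. apply lead_Gpoly.
- apply (lead_value_at_0 (Derive r)); now apply smooth1_Derive.
Qed.

Lemma g_coef_below m n p : (p < m + n)%nat -> g_coef r s m n p = 0.
Proof.
intros Hp. apply (lead_taylor_coef_below eps _ (m + n) (Gpoly m n a b));
  auto using smooth1_Gpoly, lead_Gpoly.
Qed.

Lemma gt_coef_below m n p : (S p < m + n)%nat -> gt_coef r s m n p = 0.
Proof.
intros Hp.
apply (lead_taylor_coef_below eps _ (pred (m + n)) (Gpoly_dx m n a b * b - Gpoly_dy m n a b * a));
  auto using smooth1_flux_Gpoly; [|lia].
apply lead_flux_Gpoly; lia.
Qed.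

Lemma flux_opp w t : flux (fun x y => - w x y) r s t = - flux w r s t.
Proof.
unfold flux. rewrite (Derive_opp (fun z => w z (s t))), (Derive_opp (fun z => w (r t) z)).
ring.
Qed.

Lemma h_coef_Gpoly m n p : h_coef r s m n p = - g_coef r s (S (S m)) n p.
Proof.
unfold h_coef, g_coef.
replace (- taylor_coef p (fun t => Gpoly (S (S m)) n (r t) (s t))) with
  ((-1) * taylor_coef p (fun t => Gpoly (S (S m)) n (r t) (s t))) by ring.
rewrite <- taylor_coef_scal. apply (taylor_coef_ext eps); [assumption|].
intros; cbv beta; rewrite Hpoly_Gpoly; ring.
Qed.

Lemma flux_Hpoly m n t : flux (Hpoly m n) r s t = - flux (Gpoly (S (S m)) n) r s t.
Proof.
rewrite <- flux_opp. unfold flux. f_equal; f_equal;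
  apply Derive_ext; intros; apply Hpoly_Gpoly.
Qed.

Lemma ht_coef_Gpoly m n p : ht_coef r s m n p = - gt_coef r s (S (S m)) n p.
Proof.
unfold ht_coef, gt_coef.
replace (- taylor_coef p (flux (Gpoly (S (S m)) n) r s)) with
  ((-1) * taylor_coef p (flux (Gpoly (S (S m)) n) r s)) by ring.
rewrite <- taylor_coef_scal. apply (taylor_coef_ext eps); [assumption|].
intros; cbv beta; rewrite flux_Hpoly; ring.
Qed.

Lemma h_coef_below m n p : (p < S (S (m + n)))%nat -> h_coef r s m n p = 0.
Proof. intros Hp. rewrite h_coef_Gpoly, g_coef_below by lia. ring. Qed.

Lemma ht_coef_below m n p : (p < S (m + n))%nat -> ht_coef r s m n p = 0.
Proof. intros Hp. rewrite ht_coef_Gpoly, gt_coef_below by lia. ring. Qed.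

Lemma smooth1_monomial m n : smooth1 eps (fun t => r t ^ m * s t ^ n).
Proof. apply smooth1_mult; now apply smooth1_pow. Qed.

Lemma lead_monomial m n : lead (m + n) (fun t => r t ^ m * s t ^ n) (a ^ m * b ^ n).
Proof. apply lead_mult; apply lead_pow; [apply lead_r|apply lead_s]. Qed.

Lemma smooth1_speed : smooth1 eps (fun t => sqrt (Derive r t ^ 2 + Derive s t ^ 2)).
Proof.
apply smooth1_sqrt; [exact regular|].
apply smooth1_plus; apply smooth1_pow; now apply smooth1_Derive.
Qed.

Lemma r_coef_below m n p : (p < m + n)%nat -> r_coef r s m n p = 0.
Proof.
intros Hp. apply (lead_taylor_coef_below eps _ (m + n) (a ^ m * b ^ n));
  auto using smooth1_monomial, lead_monomial.
Qed.

Lemma rt_coef_below m n p : (p < m + n)%nat -> rt_coef r s m n p = 0.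
Proof.
intros Hp. unfold rt_coef.
set (speed := fun t => sqrt (Derive r t ^ 2 + Derive s t ^ 2)).
apply (lead_taylor_coef_below eps _ (m + n) (a ^ m * b ^ n * speed 0)); auto.
- apply (smooth1_mult eps (fun t => r t ^ m * s t ^ n) speed);
    [apply smooth1_monomial|apply smooth1_speed].
- rewrite <- (Nat.add_0_r (m + n)).
  apply (lead_mult _ _ (fun t => r t ^ m * s t ^ n) speed); [apply lead_monomial|].
  apply lead_value_at_0, smooth1_speed.
Qed.

Lemma transmission_determinant_neq_0 p : (1 <= p)%nat ->
  g_coef r s 0 p p * gt_coef r s 1 (p - 1) (p - 1)
  - g_coef r s 1 (p - 1) p * gt_coef r s 0 p (p - 1) <> 0.
Proof.
intros Hp.
assert (Hg0 : g_coef r s 0 p p = Gpoly 0 p a b)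
  by (apply (lead_taylor_coef eps); auto using smooth1_Gpoly; apply (lead_Gpoly p 0)).
assert (Hg1 : g_coef r s 1 (p - 1) p = Gpoly 1 (p - 1) a b).
{ apply (lead_taylor_coef eps); auto using smooth1_Gpoly.
  replace p with (1 + (p - 1))%nat at 1 by lia. apply lead_Gpoly. }
assert (Ht0 : gt_coef r s 0 p (p - 1) = Gpoly_dx 0 p a b * b - Gpoly_dy 0 p a b * a)
  by (apply (lead_taylor_coef eps); auto using smooth1_flux_Gpoly; apply lead_flux_Gpoly; lia).
assert (Ht1 : gt_coef r s 1 (p - 1) (p - 1) =
              Gpoly_dx 1 (p - 1) a b * b - Gpoly_dy 1 (p - 1) a b * a)
  by (apply (lead_taylor_coef eps); auto using smooth1_flux_Gpoly; apply lead_flux_Gpoly; lia).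
rewrite Hg0, Hg1, Ht0, Ht1. apply leading_determinant_neq_0; [|assumption].
apply regular. now rewrite Rabs_R0.
Qed.

End Curve.

(** * The recursion for the transmission unknowns *)

Lemma sum_n_m_morphism {V W : AbelianMonoid} (L : V -> W) (a : nat -> V) (n m : nat) :
  L zero = zero -> (forall x y, L (plus x y) = plus (L x) (L y)) ->
  L (sum_n_m a n m) = sum_n_m (fun k => L (a k)) n m.
Proof.
intros L0 Lplus. induction m as [|m IH].
- destruct n as [|n]; [now rewrite !sum_n_n|now rewrite !sum_n_m_zero by lia].
- destruct (le_lt_dec n (S m)) as [Hn|Hn].
  + now rewrite !sum_n_Sm, Lplus, IH by lia.
  + now rewrite !sum_n_m_zero by lia.
Qed.

Definition linear_map {V W : ModuleSpace R_Ring} (L : V -> W) : Prop :=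
  (forall x y, L (plus x y) = plus (L x) (L y)) /\
  (forall c x, L (scal c x) = scal c (L x)).

Section LinearMap.

Context {V W : ModuleSpace R_Ring} (L : V -> W) (HL : linear_map L).

Lemma linear_map_zero : L zero = zero.
Proof. rewrite <- (scal_zero_l (zero : V)), (proj2 HL). apply scal_zero_l. Qed.

Lemma linear_map_minus x y : L (minus x y) = minus (L x) (L y).
Proof.
unfold minus. rewrite (proj1 HL). f_equal.
rewrite <- (scal_opp_one y), <- (scal_opp_one (L y)). apply (proj2 HL).
Qed.

Lemma linear_map_sum_Lambda K (a : nat -> nat -> V) :
  L (sum_Lambda K a) = sum_Lambda K (fun m n => L (a m n)).
Proof.
unfold sum_Lambda, sum_n.
rewrite (sum_n_m_morphism L) by (apply linear_map_zero || apply HL).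
apply sum_n_m_ext; intros m.
apply (sum_n_m_morphism L); [apply linear_map_zero|apply HL].
Qed.

Definition map_pair (v : V * V) : W * W := (L (fst v), L (snd v)).

Context (M : nat) (sigma : R) (r s : R -> R) (fP fN g1 g : nat -> nat -> V).

Lemma Fvec_linear p :
  L (Fvec M r s fP fN g1 p) =
  Fvec M r s (fun m n => L (fP m n)) (fun m n => L (fN m n)) (fun m n => L (g1 m n)) p.
Proof.
unfold Fvec. rewrite (proj1 HL), !linear_map_sum_Lambda.
f_equal; apply sum_Lambda_ext; intros m n _;
  now rewrite (proj2 HL), ?linear_map_minus.
Qed.

Lemma Gvec_linear p :
  L (Gvec M sigma r s fP fN g p) =
  Gvec M sigma r s (fun m n => L (fP m n)) (fun m n => L (fN m n)) (fun m n => L (g m n)) p.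
Proof.
unfold Gvec. rewrite (proj1 HL), (proj2 HL), !linear_map_sum_Lambda.
f_equal; [|f_equal]; apply sum_Lambda_ext; intros m n _;
  now rewrite (proj2 HL), ?linear_map_minus.
Qed.

Lemma Qmul_linear p v : map_pair (Qmul r s p v) = Qmul r s p (map_pair v).
Proof.
unfold map_pair, Qmul; cbn [fst snd].
now rewrite !(proj2 HL), !linear_map_minus, !(proj2 HL).
Qed.

End LinearMap.

Lemma U_pair_S {V : ModuleSpace R_Ring} M sigma r s (fP fN g1 g : nat -> nat -> V) q :
  U_pair M sigma r s fP fN g1 g (S q) =
  U_step M sigma r s fP fN g1 g (S q) (U_pair M sigma r s fP fN g1 g).
Proof.
unfold U_pair at 1. cbn [U_upto]. rewrite (proj2 (Nat.leb_gt (S q) q)) by lia.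
unfold U_step. f_equal. apply sum_n_m_ext_loc. intros n Hn.
now rewrite U_upto_pair by lia.
Qed.

Lemma U_of_U_pair {V : ModuleSpace R_Ring} M sigma r s (fP fN g1 g : nat -> nat -> V) m n :
  U M sigma r s fP fN g1 g m n =
  match m with
  | O => fst (U_pair M sigma r s fP fN g1 g n)
  | S _ => snd (U_pair M sigma r s fP fN g1 g (S n))
  end.
Proof. unfold U. now rewrite Nat.add_1_r. Qed.

(** The recursion uses only module operations, so it commutes with linear maps.
    Applied to substitution in formal combinations, this links the coefficients [T]
    to the numbers that the recursion computes. *)
Lemma U_pair_linear {V W : ModuleSpace R_Ring} (L : V -> W) M sigma r s
    (fP fN g1 g : nat -> nat -> V) p : linear_map L ->
  map_pair L (U_pair M sigma r s fP fN g1 g p) =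
  U_pair M sigma r s (fun m n => L (fP m n)) (fun m n => L (fN m n))
    (fun m n => L (g1 m n)) (fun m n => L (g m n)) p.
Proof.
intros HL. induction p as [p IH] using lt_wf_ind. destruct p as [|q].
- unfold map_pair, U_pair; simpl. now rewrite (linear_map_zero L HL).
- rewrite !U_pair_S. unfold U_step.
  assert (Hminus : forall v w, map_pair L (minus v w) = minus (map_pair L v) (map_pair L w)).
  { intros v w. unfold map_pair, minus, plus, opp; simpl. unfold prod_plus, prod_opp; simpl.
    f_equal; apply linear_map_minus, HL. }
  rewrite Hminus, Qmul_linear by exact HL.
  rewrite (sum_n_m_morphism (V := prod_AbelianMonoid V V) (W := prod_AbelianMonoid W W) (map_pair L)).
  + unfold map_pair at 1; cbn [fst snd].
    rewrite Fvec_linear, Gvec_linear by exact HL. f_equal.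
    apply sum_n_m_ext_loc; intros n Hn.
    rewrite Qmul_linear, <- IH by (exact HL || lia).
    unfold map_pair; cbn [fst snd]. now rewrite !(proj1 HL), !(proj2 HL).
  + unfold map_pair, zero; simpl. unfold prod_zero; simpl. now rewrite (linear_map_zero L HL).
  + intros v w. unfold map_pair, plus; simpl. unfold prod_plus; simpl.
    now rewrite !(proj1 HL).
Qed.

(** Serves both to replace the data outside their index range and to change the
    order [M]: neither affects the right-hand sides of the first [P] systems. *)
Lemma U_pair_ext {V : ModuleSpace R_Ring} M M' sigma r s P
    (fP fN g1 g fP' fN' g1' g' : nat -> nat -> V) :
  g1 0%nat 0%nat = g1' 0%nat 0%nat ->
  (forall p, (1 <= p <= P)%nat -> Fvec M r s fP fN g1 p = Fvec M' r s fP' fN' g1' p) ->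
  (forall p, (p < P)%nat -> Gvec M sigma r s fP fN g p = Gvec M' sigma r s fP' fN' g' p) ->
  forall p, (p <= P)%nat ->
  U_pair M sigma r s fP fN g1 g p = U_pair M' sigma r s fP' fN' g1' g' p.
Proof.
intros H0 HF HG p. induction p as [p IH] using lt_wf_ind. intros Hp. destruct p as [|q].
- unfold U_pair; simpl. now rewrite H0.
- rewrite !U_pair_S. unfold U_step. rewrite HF, HG by lia. f_equal.
  apply sum_n_m_ext_loc; intros n Hn. now rewrite IH by lia.
Qed.

Lemma U_ext {V : ModuleSpace R_Ring} M M' sigma r s P
    (fP fN g1 g fP' fN' g1' g' : nat -> nat -> V) :
  g1 0%nat 0%nat = g1' 0%nat 0%nat ->
  (forall p, (1 <= p <= P)%nat -> Fvec M r s fP fN g1 p = Fvec M' r s fP' fN' g1' p) ->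
  (forall p, (p < P)%nat -> Gvec M sigma r s fP fN g p = Gvec M' sigma r s fP' fN' g' p) ->
  forall m n, (m <= 1)%nat -> (m + n <= P)%nat ->
  U M sigma r s fP fN g1 g m n = U M' sigma r s fP' fN' g1' g' m n.
Proof.
intros H0 HF HG m n Hm Hn. rewrite !U_of_U_pair.
destruct m as [|m]; f_equal; apply U_pair_ext with (P := P); auto; lia.
Qed.

Lemma Fvec_ext {V : ModuleSpace R_Ring} M r s (fP fN g1 fP' fN' g1' : nat -> nat -> V) p :
  (forall m n, (m + n <= M - 1)%nat -> fP m n = fP' m n) ->
  (forall m n, (m + n <= M - 1)%nat -> fN m n = fN' m n) ->
  (forall m n, (m + n <= M + 1)%nat -> g1 m n = g1' m n) ->
  Fvec M r s fP fN g1 p = Fvec M r s fP' fN' g1' p.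
Proof.
intros HP HN H1. unfold Fvec.
f_equal; apply sum_Lambda_ext; intros m n Hmn; rewrite ?HP, ?HN, ?H1 by lia; reflexivity.
Qed.

Lemma Gvec_ext {V : ModuleSpace R_Ring} M sigma r s (fP fN g fP' fN' g' : nat -> nat -> V) p :
  (forall m n, (m + n <= M - 1)%nat -> fP m n = fP' m n) ->
  (forall m n, (m + n <= M - 1)%nat -> fN m n = fN' m n) ->
  (forall m n, (m + n <= M)%nat -> g m n = g' m n) ->
  Gvec M sigma r s fP fN g p = Gvec M sigma r s fP' fN' g' p.
Proof.
intros HP HN H1. unfold Gvec.
f_equal; [|f_equal]; apply sum_Lambda_ext; intros m n Hmn;
  rewrite ?HP, ?HN, ?H1 by lia; reflexivity.
Qed.

Lemma U_data_ext {V : ModuleSpace R_Ring} M sigma r s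
    (fP fN g1 g fP' fN' g1' g' : nat -> nat -> V) m' n' :
  (forall m n, (m + n <= M - 1)%nat -> fP m n = fP' m n) ->
  (forall m n, (m + n <= M - 1)%nat -> fN m n = fN' m n) ->
  (forall m n, (m + n <= M + 1)%nat -> g1 m n = g1' m n) ->
  (forall m n, (m + n <= M)%nat -> g m n = g' m n) ->
  (m' <= 1)%nat ->
  U M sigma r s fP fN g1 g m' n' = U M sigma r s fP' fN' g1' g' m' n'.
Proof.
intros HP HN H1 H2 Hm. apply U_ext with (P := (m' + n')%nat); auto.
- apply H1; lia.
- intros; now apply Fvec_ext.
- intros; now apply Gvec_ext.
Qed.

Section UCurve.

Context (eps : R) (r s : R -> R).
Context (eps_pos : 0 < eps) (r_smooth : smooth1 eps r) (s_smooth : smooth1 eps s)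
  (r_0 : r 0 = 0) (s_0 : s 0 = 0)
  (regular : forall t, Rabs t < eps -> 0 < Derive r t ^ 2 + Derive s t ^ 2).

(** Since [r] and [s] vanish at [0], a monomial of degree [d] contributes
    nothing to Taylor coefficients of order below [d]; so the systems of index
    at most [M + 1] are the same for [M] and for any larger order. *)
Lemma U_order_independent {V : ModuleSpace R_Ring} M M' sigma
    (fP fN g1 g : nat -> nat -> V) m n :
  (1 <= M <= M')%nat -> (m <= 1)%nat -> (m + n <= M + 1)%nat ->
  U M' sigma r s fP fN g1 g m n = U M sigma r s fP fN g1 g m n.
Proof.
intros HM Hm Hn. apply U_ext with (P := (M + 1)%nat); auto.
- intros p Hp. unfold Fvec. f_equal; apply sum_Lambda_truncate; try lia; intros k l Hkl.
  + rewrite (h_coef_below eps) by (auto; lia). apply (scal_zero_l (V := V)).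
  + rewrite (r_coef_below eps) by (auto; lia). unfold Rdiv; rewrite Rmult_0_l.
    apply (scal_zero_l (V := V)).
- intros p Hp. unfold Gvec. f_equal; [|f_equal]; apply sum_Lambda_truncate; try lia;
    intros k l Hkl.
  + rewrite (ht_coef_below eps) by (auto; lia). apply (scal_zero_l (V := V)).
  + rewrite (rt_coef_below eps) by (auto; lia). unfold Rdiv; rewrite Rmult_0_l.
    apply (scal_zero_l (V := V)).
Qed.

(** The recursion is forward substitution in a block triangular system whose
    2x2 diagonal blocks are invertible. *)
Lemma U_solves M sigma (fP fN g1 g d : nat -> nat -> R) :
  d 0%nat 0%nat = g1 0%nat 0%nat ->
  (forall p, (1 <= p <= M + 1)%nat ->
     sum_n_m (fun n => g_coef r s 0 n p * d 0%nat n
                       + g_coef r s 1 (n - 1) p * d 1%nat (n - 1)%nat) 1 p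
     = Fvec M r s fP fN g1 p) ->
  (forall p, (1 <= p <= M + 1)%nat ->
     sum_n_m (fun n => gt_coef r s 0 n (p - 1) * d 0%nat n
                       + gt_coef r s 1 (n - 1) (p - 1) * d 1%nat (n - 1)%nat) 1 p
     = Gvec M sigma r s fP fN g (p - 1)) ->
  forall m n, (m <= 1)%nat -> (m + n <= M + 1)%nat ->
  U M sigma r s fP fN g1 g m n = d m n.
Proof.
intros H0 HF HG.
assert (Hpair : forall p, (p <= M + 1)%nat ->
  fst (U_pair M sigma r s fP fN g1 g p) = d 0%nat p /\
  ((1 <= p)%nat -> snd (U_pair M sigma r s fP fN g1 g p) = d 1%nat (p - 1)%nat)).
{ intros p. induction p as [p IH] using lt_wf_ind. intros Hp. destruct p as [|q].
  - split; [now rewrite H0|lia].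
  - enough (Heq : U_pair M sigma r s fP fN g1 g (S q) = (d 0%nat (S q), d 1%nat (S q - 1)%nat))
      by (rewrite Heq; split; reflexivity).
    rewrite U_pair_S. unfold U_step.
    specialize (HF (S q) ltac:(lia)). specialize (HG (S q) ltac:(lia)).
    assert (Hdet := transmission_determinant_neq_0 eps r s eps_pos r_smooth s_smooth
                      r_0 s_0 regular (S q) ltac:(lia)).
    set (A := fun n => g_coef r s 0 n (S q) * d 0%nat n
                       + g_coef r s 1 (n - 1) (S q) * d 1%nat (n - 1)%nat) in *.
    set (B := fun n => gt_coef r s 0 n (S q - 1) * d 0%nat n
                       + gt_coef r s 1 (n - 1) (S q - 1) * d 1%nat (n - 1)%nat) in *.
    rewrite (sum_n_m_ext_loc _ (fun n => Qmul r s (S q) (A n, B n))).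
    2: { intros n Hn. destruct (IH n ltac:(lia) ltac:(lia)) as [E0 E1].
         rewrite E0, E1 by lia. reflexivity. }
    assert (HQ : forall u v u' v', Qmul r s (S q) (u + u', v + v') =
               (plus (Qmul r s (S q) (u, v)) (Qmul r s (S q) (u', v')) : R * R)).
    { intros. unfold Qmul, minus, scal, plus, opp; simpl. unfold mult, prod_plus, plus; simpl.
      f_equal; ring. }
    assert (HQ0 : Qmul r s (S q) (0, 0) = (zero : R * R)).
    { unfold Qmul, minus, scal, plus, opp; simpl. unfold mult; simpl. unfold zero; simpl.
      unfold prod_zero, zero; simpl. f_equal; ring. }
    rewrite <- (sum_n_m_morphism (V := prod_AbelianMonoid R_AbelianMonoid R_AbelianMonoid)
       (W := prod_AbelianMonoid R_AbelianMonoid R_AbelianMonoid)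
       (Qmul r s (S q)) (fun n => (A n, B n))); [|exact HQ0|intros [u v] [u' v']; apply HQ].
    assert (Hsum : sum_n_m (fun n => (A n, B n) : prod_AbelianMonoid R_AbelianMonoid R_AbelianMonoid)
                1 (S q - 1) = (sum_n_m A 1 q, sum_n_m B 1 q)).
    { replace (S q - 1)%nat with q by lia.
      rewrite (surjective_pairing (sum_n_m _ 1 q)). f_equal.
      - apply (sum_n_m_morphism (V := prod_AbelianMonoid R_AbelianMonoid R_AbelianMonoid)
          (W := R_AbelianMonoid) fst); reflexivity.
      - apply (sum_n_m_morphism (V := prod_AbelianMonoid R_AbelianMonoid R_AbelianMonoid)
          (W := R_AbelianMonoid) snd); reflexivity. }
    rewrite Hsum, <- HF, <- HG. rewrite !sum_n_Sm by lia.
    change (@plus R_AbelianMonoid) with Rplus.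
    assert (HQm : forall u v u' v', minus (Qmul r s (S q) (u + u', v + v') : R * R)
               (Qmul r s (S q) (u, v)) = Qmul r s (S q) (u', v')).
    { intros. unfold Qmul, minus, scal, plus, opp; simpl.
      unfold mult, prod_plus, prod_opp, plus, opp; simpl. f_equal; ring. }
    etransitivity; [apply HQm|].
    unfold A, B, Qmul, minus, scal, plus, opp; simpl fst; simpl snd. simpl. unfold mult; simpl.
    simpl in Hdet. f_equal; field; exact Hdet. }
intros m n Hm Hn. rewrite U_of_U_pair. destruct m as [|[|m]]; [| |lia].
- now apply Hpair.
- rewrite (proj2 (Hpair (S n) ltac:(lia))) by lia. f_equal; lia.
Qed.

End UCurve.

Lemma U_linear {V W : ModuleSpace R_Ring} (L : V -> W) M sigma r s
    (fP fN g1 g : nat -> nat -> V) m n : linear_map L ->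
  L (U M sigma r s fP fN g1 g m n) =
  U M sigma r s (fun m n => L (fP m n)) (fun m n => L (fN m n))
    (fun m n => L (g1 m n)) (fun m n => L (g m n)) m n.
Proof.
intros HL. rewrite !U_of_U_pair.
destruct m; rewrite <- (U_pair_linear L) by exact HL; reflexivity.
Qed.

(** * The transmission coefficients as linear functionals of the symbols *)

Definition in_range (M : nat) (c : symbol) : Prop :=
  match c with
  | sym_fP m n | sym_fN m n => (m + n <= M - 1)%nat
  | sym_g1 m n => (m + n <= M + 1)%nat
  | sym_g m n => (m + n <= M)%nat
  end.

Lemma sym_same c : sym c c = 1.
Proof. unfold sym. now destruct symbol_eq_dec. Qed.

Lemma sym_other c c' : c <> c' -> sym c c' = 0.
Proof. intros H. unfold sym. now destruct symbol_eq_dec. Qed.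

Lemma linear_map_coefficient c : linear_map (fun phi : form => phi c : R).
Proof. split; reflexivity. Qed.

(** The coefficient of a symbol that does not occur in the data is computed by the
    recursion with all data zero. *)
Lemma T_out_of_range M sigma r s c m n : ~ in_range M c -> (m <= 1)%nat ->
  T M sigma r s c m n = 0.
Proof.
intros Hc Hm. unfold T, U_form.
rewrite (U_linear (W := R_ModuleSpace) (fun phi : form => phi c : R)) by apply linear_map_coefficient.
set (z := fun _ _ : nat => 0 : R).
rewrite (U_data_ext (V := R_ModuleSpace) M sigma r s _ _ _ _ z z z z);
  try (intros k l Hkl; apply sym_other; intros <-; apply Hc; exact Hkl); [|exact Hm].
assert (HL : linear_map (V := R_ModuleSpace) (W := R_ModuleSpace) (fun _ : R => 0)).
{ split; intros; unfold plus, scal; simpl; [|unfold mult; simpl]; ring. }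
rewrite <- Ropp_0. f_equal. symmetry.
exact (U_linear (V := R_ModuleSpace) (W := R_ModuleSpace) (fun _ : R => 0)
         M sigma r s z z z z m n HL).
Qed.

Lemma sum_n_single {V : AbelianMonoid} (a : nat -> V) n k : (k <= n)%nat ->
  (forall j, j <> k -> a j = zero) -> sum_n a n = a k.
Proof.
intros Hk Ha. induction Hk as [|n Hk IH].
- destruct k as [|k]; [apply sum_O|].
  rewrite sum_Sn, sum_n_eq_zero by (intros; apply Ha; lia). apply plus_zero_l.
- rewrite sum_Sn, IH, (Ha (S n)) by lia. apply plus_zero_r.
Qed.

Lemma sum_Lambda_single {V : AbelianMonoid} (a : nat -> nat -> V) K k l : (k + l <= K)%nat ->
  (forall m n, (m, n) <> (k, l) -> a m n = zero) -> sum_Lambda K a = a k l.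
Proof.
intros Hkl Ha. unfold sum_Lambda.
rewrite (sum_n_single _ K k).
- apply sum_n_single; [lia|]. intros j Hj; apply Ha; congruence.
- lia.
- intros j Hj. apply sum_n_eq_zero; intros; apply Ha; congruence.
Qed.

Lemma sum_Lambda_mult_l K c (a : nat -> nat -> R) :
  c * sum_Lambda K a = sum_Lambda K (fun m n => c * a m n).
Proof.
unfold sum_Lambda. symmetry.
etransitivity; [|apply (sum_n_mult_l (K := R_Ring))].
apply sum_n_ext; intros m. apply (sum_n_mult_l (K := R_Ring)).
Qed.

Lemma sum_Lambda1_mult_l K c (a : nat -> nat -> R) :
  c * sum_Lambda1 K a = sum_Lambda1 K (fun m n => c * a m n).
Proof.
unfold sum_Lambda1. to_R. rewrite Rmult_plus_distr_l.
f_equal; symmetry; apply (sum_n_mult_l (K := R_Ring)).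
Qed.

Lemma sum_Lambda_swap K K' (c : nat -> nat -> nat -> nat -> R) :
  sum_Lambda K (fun m n => sum_Lambda1 K' (fun m' n' => c m n m' n')) =
  sum_Lambda1 K' (fun m' n' => sum_Lambda K (fun m n => c m n m' n')).
Proof.
assert (Hsw : forall m' K'', sum_Lambda K (fun m n => sum_n (fun n' => c m n m' n') K'')
                    = sum_n (fun n' => sum_Lambda K (fun m n => c m n m' n')) K'').
{ intros m' K''. unfold sum_Lambda.
  rewrite <- (sum_n_switch (fun m n' => sum_n (fun n => c m n m' n') (K - m))).
  apply sum_n_ext; intros m. apply (sum_n_switch (fun n n' => c m n m' n')). }
unfold sum_Lambda1. rewrite (sum_Lambda_plus K). now rewrite !Hsw.
Qed.

Section Evaluation.

Context (M : nat) (vP vN v1 v : nat -> nat -> R).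

(** Only the symbols that occur in the data of order [M] are substituted, in
    agreement with the sums on the right-hand side of the scheme. *)
Definition evaluate (phi : form) : R :=
  sum_Lambda (M - 1) (fun m n => vP m n * phi (sym_fP m n))
  + sum_Lambda (M - 1) (fun m n => vN m n * phi (sym_fN m n))
  + sum_Lambda (M + 1) (fun m n => v1 m n * phi (sym_g1 m n))
  + sum_Lambda M (fun m n => v m n * phi (sym_g m n)).

Lemma linear_map_evaluate : linear_map (W := R_ModuleSpace) evaluate.
Proof.
assert (Hp : forall K (w : nat -> nat -> R) (e : nat -> nat -> symbol) (x y : form),
  sum_Lambda K (fun m n => w m n * plus x y (e m n)) =
  sum_Lambda K (fun m n => w m n * x (e m n)) + sum_Lambda K (fun m n => w m n * y (e m n))).
{ intros. etransitivity; [|apply (sum_Lambda_plus (V := R_AbelianMonoid))].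
  apply sum_Lambda_ext; intros. unfold plus; simpl. ring. }
assert (Hs : forall K (w : nat -> nat -> R) (e : nat -> nat -> symbol) c (x : form),
  sum_Lambda K (fun m n => w m n * scal c x (e m n)) =
  c * sum_Lambda K (fun m n => w m n * x (e m n))).
{ intros. rewrite sum_Lambda_mult_l. apply sum_Lambda_ext; intros.
  unfold scal; simpl. ring. }
split.
- intros x y. unfold evaluate. rewrite !Hp. unfold plus; simpl. ring.
- intros c x. unfold evaluate. rewrite !Hs. unfold scal; simpl. unfold mult; simpl. ring.
Qed.

Lemma evaluate_sym c : in_range M c ->
  evaluate (sym c) =
  match c with sym_fP m n => vP m n | sym_fN m n => vN m n | sym_g1 m n => v1 m n | sym_g m n => v m n end.
Proof.
intros Hc. unfold evaluate.
assert (Hz : forall K (w : nat -> nat -> R) (e : nat -> nat -> symbol), (forall m n, c <> e m n) ->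
  sum_Lambda K (fun m n => w m n * sym c (e m n)) = 0).
{ intros K w e He. apply (sum_Lambda_eq_zero (V := R_AbelianMonoid)). intros.
  rewrite sym_other by apply He. apply Rmult_0_r. }
assert (H1 : forall K (w : nat -> nat -> R) (e : nat -> nat -> symbol) m n,
  (forall m n m' n', e m n = e m' n' -> (m, n) = (m', n')) -> c = e m n -> (m + n <= K)%nat ->
  sum_Lambda K (fun m n => w m n * sym c (e m n)) = w m n).
{ intros K w e m n He -> HK. rewrite (sum_Lambda_single _ K m n HK).
  - rewrite sym_same. apply Rmult_1_r.
  - intros m' n' Hne. rewrite sym_other; [apply Rmult_0_r|].
    intros Heq. apply Hne. symmetry. now apply He. }
destruct c as [m n|m n|m n|m n]; simpl in Hc.
- rewrite (H1 _ vP sym_fP m n) by (congruence || assumption). rewrite !Hz by congruence. ring.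
- rewrite (H1 _ vN sym_fN m n) by (congruence || assumption). rewrite !Hz by congruence. ring.
- rewrite (H1 _ v1 sym_g1 m n) by (congruence || assumption). rewrite !Hz by congruence. ring.
- rewrite (H1 _ v sym_g m n) by (congruence || assumption). rewrite !Hz by congruence. ring.
Qed.

Lemma evaluate_U_form sigma r s m n : (m <= 1)%nat ->
  evaluate (U_form M sigma r s m n) = U M sigma r s vP vN v1 v m n.
Proof.
intros Hm. unfold U_form.
rewrite (U_linear (W := R_ModuleSpace) evaluate) by apply linear_map_evaluate.
apply U_data_ext; try assumption;
  intros k l Hkl; apply evaluate_sym; exact Hkl.
Qed.

Lemma evaluate_opp phi : evaluate (fun c => - phi c) = - evaluate phi.
Proof.
replace (- evaluate phi) with (evaluate (@scal R_Ring form_ModuleSpace (-1) phi)).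
- unfold evaluate.
  f_equal; [f_equal; [f_equal|]|]; apply sum_Lambda_ext; intros;
    unfold scal; simpl; ring.
- rewrite (proj2 linear_map_evaluate). unfold scal; simpl. unfold mult; simpl. ring.
Qed.

End Evaluation.

(** * The right-hand side of the scheme *)

Lemma sum_stencil_ext (a b : Z -> Z -> R) :
  (forall k l, a k l = b k l) -> sum_stencil a = sum_stencil b.
Proof. intros Hab. unfold sum_stencil. now rewrite !Hab. Qed.

Lemma sum_stencil_eq_zero (a : Z -> Z -> R) :
  (forall k l, a k l = 0) -> sum_stencil a = 0.
Proof. intros Ha. unfold sum_stencil. rewrite !Ha. ring. Qed.


(** Exchanging the two summations collects, for each [(m', n')], the coefficients
    [T] into the unknown from which they were extracted. *)
Lemma scheme_rhs_U psi h x y v0 w0 M sigma r s (fP fN g1 g : R -> R -> R) :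
  (1 <= M)%nat ->
  let d w m n := partial_derive m n w (x - v0) (y - w0) in
  scheme_rhs psi h x y v0 w0 Gpoly Hpoly M sigma r s fP fN g1 g =
  sum_Lambda (M - 1) (fun m n => d fP m n * J0_plus psi h x y v0 w0 Hpoly m n)
  + sum_Lambda (M - 1) (fun m n => d fN m n * J0_minus psi h x y v0 w0 Hpoly m n)
  - sum_Lambda1 (M + 1) (fun m n => I_minus psi h x y v0 w0 Gpoly m n
      * U M sigma r s (d fP) (d fN) (d g1) (d g) m n).
Proof.
intros HM d. unfold scheme_rhs, J_plus, J_minus, J_g1, J_g. fold (d fP) (d fN) (d g1) (d g).
set (I := I_minus psi h x y v0 w0 Gpoly).
assert (HI : forall K (w : nat -> nat -> R) (e : nat -> nat -> symbol),
  sum_Lambda K (fun m n => w m n * I_T psi h x y v0 w0 Gpoly M sigma r s (e m n)) =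
  sum_Lambda1 (M + 1) (fun m' n' => I m' n' *
     sum_Lambda K (fun m n => w m n * T M sigma r s (e m n) m' n'))).
{ intros K w e. unfold I_T. fold I.
  transitivity (sum_Lambda K (fun m n => sum_Lambda1 (M + 1) (fun m' n' =>
     I m' n' * (w m n * T M sigma r s (e m n) m' n')))).
  - apply sum_Lambda_ext; intros. rewrite sum_Lambda1_mult_l.
    apply sum_Lambda1_ext; [lia|]; intros; to_R; ring.
  - rewrite sum_Lambda_swap. apply sum_Lambda1_ext; [lia|]; intros.
    now rewrite sum_Lambda_mult_l. }
assert (Hsplit : forall K (w a : nat -> nat -> R) (e : nat -> nat -> symbol),
  sum_Lambda K (fun m n => w m n * (a m n + I_T psi h x y v0 w0 Gpoly M sigma r s (e m n))) =
  sum_Lambda K (fun m n => w m n * a m n) +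
  sum_Lambda K (fun m n => w m n * I_T psi h x y v0 w0 Gpoly M sigma r s (e m n))).
{ intros. etransitivity; [|apply (sum_Lambda_plus (V := R_AbelianMonoid))].
  apply sum_Lambda_ext; intros. to_R. ring. }
rewrite (Hsplit _ _ _ (fun m n => sym_fP m n)), (Hsplit _ _ _ (fun m n => sym_fN m n)).
rewrite (HI _ _ (fun m n => sym_fP m n)), (HI _ _ (fun m n => sym_fN m n)),
  (HI _ _ (fun m n => sym_g1 m n)), (HI _ _ (fun m n => sym_g m n)).
match goal with |- ?a + ?p + (?b + ?q) + ?c + ?e = _ =>
  transitivity (a + b + (p + q + c + e)); [ring|] end.
match goal with |- _ = ?b - ?w => change (b - w) with (b + - w) end. f_equal.
replace (- sum_Lambda1 (M + 1) (fun m n => I m n * U M sigma r s (d fP) (d fN) (d g1) (d g) m n))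
  with ((-1) * sum_Lambda1 (M + 1)
          (fun m n => I m n * U M sigma r s (d fP) (d fN) (d g1) (d g) m n)) by ring.
rewrite sum_Lambda1_mult_l.
rewrite <- !(sum_Lambda1_plus (V := R_AbelianMonoid)).
apply sum_Lambda1_ext; [lia|]. intros m n Hm Hn. to_R.
rewrite <- (evaluate_U_form M (d fP) (d fN) (d g1) (d g)) by exact Hm.
transitivity (I m n * evaluate M (d fP) (d fN) (d g1) (d g)
                        (fun c => - U_form M sigma r s m n c)).
- unfold evaluate, T. unfold d. cbv beta. ring.
- rewrite evaluate_opp. ring.
Qed.

(** The transmission coefficients that survive the truncation do not depend on the
    order, and those that belong to data beyond the range of [M] vanish. *)
Lemma scheme_rhs_drop_above eps psi h x y v0 w0 M M' sigma r s (fP fN g1 g : R -> R -> R) :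
  0 < eps -> smooth1 eps r -> smooth1 eps s -> r 0 = 0 -> s 0 = 0 ->
  (forall t, Rabs t < eps -> 0 < Derive r t ^ 2 + Derive s t ^ 2) ->
  (1 <= M <= M')%nat ->
  scheme_rhs psi h x y v0 w0 (drop_above (M + 1) Gpoly) (drop_above (M - 1) Hpoly)
    M' sigma r s fP fN g1 g =
  scheme_rhs psi h x y v0 w0 Gpoly Hpoly M sigma r s fP fN g1 g.
Proof.
intros He Hr Hs Hr0 Hs0 Hreg HM. unfold scheme_rhs.
assert (HI : forall m n, I_minus psi h x y v0 w0 (drop_above (M + 1) Gpoly) m n =
   if (m + n <=? M + 1)%nat then I_minus psi h x y v0 w0 Gpoly m n else 0).
{ intros. unfold I_minus, drop_above, sum_minus.
  destruct (m + n <=? M + 1)%nat; [reflexivity|].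
  apply sum_stencil_eq_zero; intros k l. rewrite Rmult_0_r. now destruct Rlt_dec. }
assert (HJm : forall m n, J0_minus psi h x y v0 w0 (drop_above (M - 1) Hpoly) m n =
   if (m + n <=? M - 1)%nat then J0_minus psi h x y v0 w0 Hpoly m n else 0).
{ intros. unfold J0_minus, drop_above, sum_minus.
  destruct (m + n <=? M - 1)%nat; [reflexivity|].
  apply sum_stencil_eq_zero; intros k l. rewrite Rmult_0_r. now destruct Rlt_dec. }
assert (HJp : forall m n, J0_plus psi h x y v0 w0 (drop_above (M - 1) Hpoly) m n =
   if (m + n <=? M - 1)%nat then J0_plus psi h x y v0 w0 Hpoly m n else 0).
{ intros. unfold J0_plus, drop_above, Defs.sum_plus.
  destruct (m + n <=? M - 1)%nat; [reflexivity|].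
  apply sum_stencil_eq_zero; intros k l. rewrite Rmult_0_r. now destruct Rge_dec. }
assert (HT : forall c, I_T psi h x y v0 w0 (drop_above (M + 1) Gpoly) M' sigma r s c =
                       I_T psi h x y v0 w0 Gpoly M sigma r s c).
{ intros c. unfold I_T. rewrite (sum_Lambda1_truncate (M + 1)).
  - apply sum_Lambda1_ext; [lia|]. intros m n Hm Hn.
    rewrite HI, (proj2 (Nat.leb_le _ _)) by lia. f_equal.
    unfold T, U_form. now rewrite (U_order_independent eps r s He Hr Hs Hr0 Hs0 Hreg M M') by lia.
  - lia.
  - intros m n Hmn. rewrite HI, (proj2 (Nat.leb_gt _ _)) by lia. apply Rmult_0_l. }
assert (HTz : forall c, ~ in_range M c -> I_T psi h x y v0 w0 Gpoly M sigma r s c = 0).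
{ intros c Hc. unfold I_T. apply (sum_Lambda1_eq_zero (V := R_AbelianMonoid)); [lia|].
  intros m n Hm Hn. rewrite T_out_of_range by assumption. apply Rmult_0_r. }
unfold J_plus, J_minus, J_g1, J_g.
f_equal; [f_equal; [f_equal|]|].
- rewrite (sum_Lambda_truncate (M - 1)); [|lia|].
  + apply sum_Lambda_ext; intros m n Hmn.
    rewrite HT, HJp, (proj2 (Nat.leb_le _ _)) by lia. reflexivity.
  + intros m n Hmn. rewrite HT, HJp, (proj2 (Nat.leb_gt _ _)), HTz by (simpl; lia).
    rewrite Rplus_0_l. apply Rmult_0_r.
- rewrite (sum_Lambda_truncate (M - 1)); [|lia|].
  + apply sum_Lambda_ext; intros m n Hmn.
    rewrite HT, HJm, (proj2 (Nat.leb_le _ _)) by lia. reflexivity.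
  + intros m n Hmn. rewrite HT, HJm, (proj2 (Nat.leb_gt _ _)), HTz by (simpl; lia).
    rewrite Rplus_0_l. apply Rmult_0_r.
- rewrite (sum_Lambda_truncate (M + 1)); [|lia|].
  + apply sum_Lambda_ext; intros m n Hmn. now rewrite HT.
  + intros m n Hmn. rewrite HT, HTz by (simpl; lia). apply Rmult_0_r.
- rewrite (sum_Lambda_truncate M); [|lia|].
  + apply sum_Lambda_ext; intros m n Hmn. now rewrite HT.
  + intros m n Hmn. rewrite HT, HTz by (simpl; lia). apply Rmult_0_r.
Qed.

(** * Smooth functions of two variables *)

Definition dX (w : R -> R -> R) (x y : R) : R := Derive (fun z => w z y) x.
Definition dY (w : R -> R -> R) (x y : R) : R := Derive (fun z => w x z) y.

Lemma smooth_on_dX D w : smooth_on D w -> smooth_on D (dX w).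
Proof. intros Hw k x y HD. apply (Hw (S k) x y HD). Qed.

Lemma smooth_on_dY D w : smooth_on D w -> smooth_on D (dY w).
Proof. intros Hw k x y HD. apply (Hw (S k) x y HD). Qed.

Lemma smooth_on_partial_derive D w m n : smooth_on D w -> smooth_on D (partial_derive m n w).
Proof.
intros Hw. induction m as [|m IH].
- induction n as [|n IH]; [exact Hw|]. exact (smooth_on_dY _ _ IH).
- exact (smooth_on_dX _ _ IH).
Qed.

Lemma smooth_on_continuous D w x y : smooth_on D w -> D (x, y) -> continuity_2d_pt w x y.
Proof. intros Hw HD. apply (Hw 0%nat x y HD). Qed.

Lemma smooth_on_is_derive_x D w x y : smooth_on D w -> D (x, y) ->
  is_derive (fun z => w z y) x (dX w x y).
Proof. intros Hw HD. apply Derive_correct. apply (Hw 1%nat x y HD). Qed.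

Lemma smooth_on_is_derive_y D w x y : smooth_on D w -> D (x, y) ->
  is_derive (fun z => w x z) y (dY w x y).
Proof. intros Hw HD. apply Derive_correct. apply (Hw 1%nat x y HD). Qed.

Lemma open_locally_2d (D : R * R -> Prop) x y :
  open D -> D (x, y) -> locally_2d (fun u v => D (u, v)) x y.
Proof.
intros HD Hxy. apply locally_2d_locally. apply (filter_imp D).
- now intros [u v].
- now apply HD.
Qed.

(** The derivative in [x] comes last in [partial_derive]; commuting it with the
    [y]-derivatives is the theorem of Schwarz. *)
Lemma partial_derive_dX D w m n x y : open D -> smooth_on D w -> D (x, y) ->
  partial_derive m n (dX w) x y = partial_derive (S m) n w x y.
Proof.
intros HO Hw HD. replace (S m) with (m + 1)%nat by lia.
transitivity (partial_derive m 0 (partial_derive 0 n (dX w)) x y).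
- reflexivity.
- rewrite <- (partial_derive_add_zero w m 0 1 n) by tauto.
  apply partial_derive_ext_loc.
  generalize (open_locally_2d D x y HO HD). apply locally_2d_impl, locally_2d_forall.
  intros u v Huv. symmetry. apply Derive_partial_derive_aux1.
  generalize (open_locally_2d D u v HO Huv). apply locally_2d_impl, locally_2d_forall.
  intros u' v' Huv'. now apply Hw.
Qed.

Lemma partial_derive_dY w m n x y :
  partial_derive m n (dY w) x y = partial_derive m (S n) w x y.
Proof.
apply Derive_n_ext; intros t. apply (Derive_n_Derive (fun z => w t z)).
Qed.

Lemma is_derive_line D w x y X Y t : open D -> smooth_on D w -> D (x + t * X, y + t * Y) ->
  is_derive (fun z => w (x + z * X) (y + z * Y)) t
    (X * dX w (x + t * X) (y + t * Y) + Y * dY w (x + t * X) (y + t * Y)).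
Proof.
intros HO Hw HD. set (x' := x + t * X) in *. set (y' := y + t * Y) in *.
assert (Hd : differentiable_pt_lim w x' y' (dX w x' y') (dY w x' y')).
{ apply filterdiff_differentiable_pt_lim.
  apply (is_derive_filterdiff w x' y' (dX w) (dY w x' y')).
  - apply (filter_imp D); [|now apply HO].
    intros [u v] Huv. now apply (smooth_on_is_derive_x D).
  - now apply (smooth_on_is_derive_y D).
  - apply (continuity_2d_pt_filterlim (dX w)).
    now apply (smooth_on_continuous D), HD; apply smooth_on_dX. }
apply is_derive_Reals.
replace (X * dX w x' y' + Y * dY w x' y') with (dX w x' y' * X + dY w x' y' * Y) by ring.
apply (derivable_pt_lim_comp_2d w (fun z => x + z * X) (fun z => y + z * Y)); [exact Hd| |];
  apply is_derive_Reals; auto_derive; auto; ring.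
Qed.

(** * Taylor polynomials *)

Definition homogeneous_part (N : nat) (a : nat -> nat -> R) (X Y : R) : R :=
  sum_n (fun m => a m (N - m)%nat * (dpow m X * dpow (N - m) Y)) N.

(** The bound on the degree is strict, so that the remainder has order [k] and
    the induction for Taylor's theorem can start from the zero polynomial. *)
Fixpoint jet_poly (k : nat) (a : nat -> nat -> R) (X Y : R) : R :=
  match k with
  | O => 0
  | S k' => jet_poly k' a X Y + homogeneous_part k' a X Y
  end.

Lemma jet_poly_sum_Lambda K a X Y :
  jet_poly (S K) a X Y = sum_Lambda K (fun m n => a m n * (dpow m X * dpow n Y)).
Proof.
induction K as [|K IH].
- simpl. unfold homogeneous_part, sum_Lambda. simpl Nat.sub. rewrite !sum_O. apply Rplus_0_l.
- rewrite sum_Lambda_S, <- IH. reflexivity.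
Qed.

Lemma jet_poly_ext k a b X Y :
  (forall m n, a m n = b m n) -> jet_poly k a X Y = jet_poly k b X Y.
Proof.
intros Hab. induction k as [|k IH]; [reflexivity|]. simpl. rewrite IH. f_equal.
apply sum_n_ext; intros m. now rewrite Hab.
Qed.

Lemma jet_poly_at_0 k a : jet_poly (S k) a 0 0 = a 0%nat 0%nat.
Proof.
assert (Hd : forall n, dpow (S n) 0 = 0).
{ intros n. unfold dpow, Rdiv. rewrite pow_i by lia. apply Rmult_0_l. }
induction k as [|k IH].
- rewrite jet_poly_sum_Lambda. unfold sum_Lambda. simpl Nat.sub. rewrite !sum_O, !dpow_0.
  to_R. ring.
- change (jet_poly (S (S k)) a 0 0) with (jet_poly (S k) a 0 0 + homogeneous_part (S k) a 0 0).
  rewrite IH. unfold homogeneous_part. rewrite (sum_n_eq_zero (V := R_AbelianMonoid)).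
  + to_R. ring.
  + intros m Hm. destruct m as [|m].
    * rewrite Nat.sub_0_r, Hd. to_R. ring.
    * rewrite Hd. to_R. ring.
Qed.

Lemma is_derive_dpow_line n x X t :
  is_derive (fun z => dpow n (x + z * X)) t
    (X * match n with O => 0 | S k => dpow k (x + t * X) end).
Proof.
apply (is_derive_comp (dpow n) (fun z => x + z * X)).
- apply is_derive_dpow.
- auto_derive; auto; ring.
Qed.

Lemma is_derive_homogeneous_part N a x y X Y t :
  is_derive (fun z => homogeneous_part (S N) a (x + z * X) (y + z * Y)) t
    (X * homogeneous_part N (fun m n => a (S m) n) (x + t * X) (y + t * Y)
     + Y * homogeneous_part N (fun m n => a m (S n)) (x + t * X) (y + t * Y)).
Proof.
set (dx := fun m => match m with O => 0 | S k => dpow k (x + t * X) end).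
set (dy := fun m => match m with O => 0 | S k => dpow k (y + t * Y) end).
eapply is_derive_value.
- unfold homogeneous_part.
  apply (is_derive_sum_n (K := R_AbsRing) (V := R_NormedModule)
    (fun m z => a m (S N - m)%nat * (dpow m (x + z * X) * dpow (S N - m) (y + z * Y)))
    (S N) t
    (fun m => a m (S N - m)%nat * (X * dx m * dpow (S N - m) (y + t * Y)
                + dpow m (x + t * X) * (Y * dy (S N - m)%nat)))).
  intros m Hm.
  apply (is_derive_scal (fun z => dpow m (x + z * X) * dpow (S N - m) (y + z * Y))).
  exact (is_derive_Rmult _ _ _ _ _ (is_derive_dpow_line m x X t)
           (is_derive_dpow_line (S N - m) y Y t)).
- transitivity
   (X * sum_n (fun m => a m (S N - m)%nat * (dx m * dpow (S N - m) (y + t * Y))) (S N)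
    + Y * sum_n (fun m => a m (S N - m)%nat * (dpow m (x + t * X) * dy (S N - m)%nat)) (S N)).
  + rewrite <- !(sum_n_mult_l (K := R_Ring)).
    etransitivity; [|apply (sum_n_plus (G := R_AbelianMonoid))].
    apply sum_n_ext; intros m. to_R. ring.
  + f_equal; f_equal.
    * rewrite sum_n_first. simpl dx. unfold homogeneous_part. to_R.
      rewrite Rmult_0_l, Rmult_0_r, Rplus_0_l. reflexivity.
    * rewrite sum_Sn. rewrite Nat.sub_diag. change (dy 0%nat) with 0. unfold homogeneous_part. to_R.
      rewrite !Rmult_0_r, Rplus_0_r. apply sum_n_ext_loc; intros m Hm.
      replace (S N - m)%nat with (S (N - m)) by lia. reflexivity.
Qed.

Lemma is_derive_jet_poly k a x y X Y t :
  is_derive (fun z => jet_poly (S k) a (x + z * X) (y + z * Y)) t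
    (X * jet_poly k (fun m n => a (S m) n) (x + t * X) (y + t * Y)
     + Y * jet_poly k (fun m n => a m (S n)) (x + t * X) (y + t * Y)).
Proof.
induction k as [|k IH].
- apply (is_derive_ext (fun _ => a 0%nat 0%nat)).
  + intros z. rewrite jet_poly_sum_Lambda. unfold sum_Lambda. simpl Nat.sub.
    rewrite !sum_O, !dpow_0. to_R. ring.
  + simpl. rewrite !Rmult_0_r, Rplus_0_r. apply is_derive_Rconst.
- eapply is_derive_value.
  + apply (is_derive_plus (K := R_AbsRing) (V := R_NormedModule)
      (fun z => jet_poly (S k) a (x + z * X) (y + z * Y))
      (fun z => homogeneous_part (S k) a (x + z * X) (y + z * Y))).
    * exact IH.
    * apply is_derive_homogeneous_part.
  + unfold plus; simpl. ring.
Qed.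

Lemma is_derive_jet_poly_x k a (X Y : R) :
  is_derive (fun z : R => jet_poly (S k) a z Y) X (jet_poly k (fun m n => a (S m) n) X Y).
Proof.
assert (H := is_derive_jet_poly k a 0 Y 1 0 X).
rewrite Rplus_0_l, Rmult_0_r, Rplus_0_r, Rmult_1_r, Rmult_0_l, Rplus_0_r, Rmult_1_l in H.
revert H. apply is_derive_ext. intros z. 
change (jet_poly (S k) a (0 + z * 1) (Y + z * 0) = jet_poly (S k) a z Y).
f_equal; [rewrite Rmult_1_r; apply Rplus_0_l|rewrite Rmult_0_r; apply Rplus_0_r].
Qed.

Lemma is_derive_jet_poly_y k a (X Y : R) :
  is_derive (fun z : R => jet_poly (S k) a X z) Y (jet_poly k (fun m n => a m (S n)) X Y).
Proof.
assert (H := is_derive_jet_poly k a X 0 0 1 Y).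
rewrite Rplus_0_l, Rmult_0_r, Rplus_0_r, Rmult_1_r, Rmult_0_l, Rplus_0_l, Rmult_1_l in H.
revert H. apply is_derive_ext. intros z.
change (jet_poly (S k) a (X + z * 0) (0 + z * 1) = jet_poly (S k) a X z).
f_equal; [rewrite Rmult_0_r; apply Rplus_0_r|rewrite Rmult_1_r; apply Rplus_0_l].
Qed.

Definition jet (w : R -> R -> R) (x y : R) (m n : nat) : R := partial_derive m n w x y.

Lemma rectangle_convex l1 l2 l3 l4 x y x' y' t :
  closed_Omega l1 l2 l3 l4 (x, y) -> closed_Omega l1 l2 l3 l4 (x', y') -> 0 <= t <= 1 ->
  closed_Omega l1 l2 l3 l4 (x + t * (x' - x), y + t * (y' - y)).
Proof. unfold closed_Omega; simpl. intros [H1 H2] [H3 H4] Ht. split; nra. Qed.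

(** A finite subcover of the rectangle by neighbourhoods on which [w] varies by at
    most [1]. *)
Lemma bounded_on_rectangle l1 l2 l3 l4 (w : R -> R -> R) :
  (forall x y, closed_Omega l1 l2 l3 l4 (x, y) -> continuity_2d_pt w x y) ->
  exists B, 0 <= B /\ forall x y, closed_Omega l1 l2 l3 l4 (x, y) -> Rabs (w x y) <= B.
Proof.
intros Hc.
assert (Hdelta : forall q : R * (R * unit), exists d : posreal,
  let '(x, (y, _)) := q in
  closed_Omega l1 l2 l3 l4 (x, y) ->
  forall u v, Rabs (u - x) < d -> Rabs (v - y) < d -> Rabs (w u v) <= Rabs (w x y) + 1).
{ intros [x [y z]]. destruct (classic (closed_Omega l1 l2 l3 l4 (x, y))) as [H|H].
  - destruct (Hc x y H (mkposreal 1 Rlt_0_1)) as [d Hd]. exists d. intros _ u v Hu Hv.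
    specialize (Hd u v Hu Hv). simpl in Hd.
    replace (w u v) with (w x y + (w u v - w x y)) by ring.
    eapply Rle_trans; [apply Rabs_triang|lra].
  - exists (mkposreal 1 Rlt_0_1). tauto. }
set (delta := fun q => proj1_sig (constructive_indefinite_description _ (Hdelta q))).
assert (Hd := fun q => proj2_sig (constructive_indefinite_description _ (Hdelta q))).
apply NNPP. intros Hno.
apply (compactness_list 2 (l1, (l3, tt)) (l2, (l4, tt)) delta). intros [l Hl]. apply Hno.
set (val := fun q : R * (R * unit) => Rabs (w (fst q) (fst (snd q))) + 1).
assert (Hmax : exists B, 0 <= B /\ forall q, List.In q l -> val q <= B).
{ clear Hl. induction l as [|q l [B [HB HBl]]].
  - exists 0. split; [lra|]. intros q [].
  - exists (Rmax B (val q)). split; [eapply Rle_trans; [exact HB|apply Rmax_l]|].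
    intros q' [<-|Hq']; [apply Rmax_r|]. eapply Rle_trans; [now apply HBl|apply Rmax_l]. }
destruct Hmax as [B [HB HBl]]. exists B. split; [exact HB|]. intros x y [Hx Hy]. simpl in Hx, Hy.
destruct (Hl (x, (y, tt))) as [[u [v []]] [Hin [[Hu [Hv _]] [Hxu [Hyv _]]]]].
{ simpl; tauto. }
eapply Rle_trans; [|now apply (HBl (u, (v, tt)))].
apply (Hd (u, (v, tt))); [|assumption|assumption]. split; simpl; assumption.
Qed.

(** By induction on [k]: along the segment joining the two points the derivative of
    the remainder is a combination of the remainders of lower order of the two
    partial derivatives.  The constant is uniform because the induction starts from
    a bound on the whole rectangle. *)
Lemma uniform_Taylor l1 l2 l3 l4 (D : R * R -> Prop) k :
  open D -> (forall q, closed_Omega l1 l2 l3 l4 q -> D q) ->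
  forall w, smooth_on D w ->
  exists C, 0 <= C /\ forall x y x' y',
    closed_Omega l1 l2 l3 l4 (x, y) -> closed_Omega l1 l2 l3 l4 (x', y') ->
    Rabs (w x' y' - jet_poly k (jet w x y) (x' - x) (y' - y))
      <= C * (Rabs (x' - x) + Rabs (y' - y)) ^ k.
Proof.
intros HO HD. induction k as [|k IH]; intros w Hw.
- destruct (bounded_on_rectangle l1 l2 l3 l4 w) as [B [HB HBw]].
  + intros x y Hq. apply (smooth_on_continuous D); [assumption|now apply HD].
  + exists B. split; [assumption|]. intros x y x' y' _ Hq. simpl.
    rewrite Rminus_0_r, Rmult_1_r. now apply HBw.
- destruct (IH _ (smooth_on_dX _ _ Hw)) as [C1 [HC1 H1]].
  destruct (IH _ (smooth_on_dY _ _ Hw)) as [C2 [HC2 H2]].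
  exists (C1 + C2). split; [lra|]. intros x y x' y' Hq Hq'.
  set (X := x' - x). set (Y := y' - y). set (rho := Rabs X + Rabs Y).
  assert (Hrho : 0 <= rho) by (apply Rplus_le_le_0_compat; apply Rabs_pos).
  set (phi := fun t => w (x + t * X) (y + t * Y)
                       - jet_poly (S k) (jet w x y) (0 + t * X) (0 + t * Y)).
  set (phi' := fun t =>
     X * (dX w (x + t * X) (y + t * Y)
          - jet_poly k (jet (dX w) x y) (0 + t * X) (0 + t * Y))
     + Y * (dY w (x + t * X) (y + t * Y)
          - jet_poly k (jet (dY w) x y) (0 + t * X) (0 + t * Y))).
  assert (Hseg : forall t, 0 <= t <= 1 -> closed_Omega l1 l2 l3 l4 (x + t * X, y + t * Y))
    by (intros t Ht; now apply rectangle_convex).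
  assert (Hphi : forall t, 0 <= t <= 1 -> is_derive phi t (phi' t)).
  { intros t Ht. eapply is_derive_value.
    - apply (is_derive_minus (K := R_AbsRing) (V := R_NormedModule)
        (fun z => w (x + z * X) (y + z * Y))
        (fun z => jet_poly (S k) (jet w x y) (0 + z * X) (0 + z * Y))).
      + apply (is_derive_line D); [assumption..|]. now apply HD, Hseg.
      + apply is_derive_jet_poly.
    - unfold phi', minus, plus, opp; simpl.
      rewrite (jet_poly_ext k (jet (dX w) x y) (fun m n => jet w x y (S m) n))
        by (intros; now apply (partial_derive_dX D); [..|apply HD]).
      rewrite (jet_poly_ext k (jet (dY w) x y) (fun m n => jet w x y m (S n)))
        by (intros; apply partial_derive_dY).
      ring. }
  destruct (MVT_gen phi 0 1 phi') as [c [Hc Hmvt]].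
  { intros t Ht. rewrite Rmin_left, Rmax_right in Ht by lra. apply Hphi; lra. }
  { intros t Ht. rewrite Rmin_left, Rmax_right in Ht by lra.
    apply continuity_pt_filterlim.
    apply (ex_derive_continuous (K := R_AbsRing) (V := R_NormedModule)).
    exists (phi' t). apply Hphi; lra. }
  rewrite Rmin_left, Rmax_right in Hc by lra.
  assert (Hphi0 : phi 0 = 0).
  { unfold phi. rewrite !Rmult_0_l, !Rplus_0_r, jet_poly_at_0. unfold jet, partial_derive. simpl.
    ring. }
  assert (Hphi1 : phi 1 = w x' y' - jet_poly (S k) (jet w x y) X Y).
  { unfold phi. rewrite !Rmult_1_l, !Rplus_0_l.
    replace (x + X) with x' by (unfold X; ring). now replace (y + Y) with y' by (unfold Y; ring). }
  rewrite <- Hphi1. replace (phi 1) with (phi' c) by lra. unfold phi'.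
  assert (Hpow : (Rabs (c * X) + Rabs (c * Y)) ^ k <= rho ^ k).
  { apply pow_incr. rewrite !Rabs_mult, (Rabs_pos_eq c) by lra. unfold rho.
    assert (0 <= Rabs X) by apply Rabs_pos. assert (0 <= Rabs Y) by apply Rabs_pos.
    split; nra. }
  assert (Hrk : 0 <= rho ^ k) by now apply pow_le.
  specialize (H1 x y _ _ Hq (Hseg c Hc)). specialize (H2 x y _ _ Hq (Hseg c Hc)).
  replace (x + c * X - x) with (c * X) in * by ring.
  replace (y + c * Y - y) with (c * Y) in * by ring.
  rewrite !Rplus_0_l. eapply Rle_trans; [apply Rabs_triang|]. rewrite !Rabs_mult.
  set (e1 := Rabs (dX w _ _ - _)) in *. set (e2 := Rabs (dY w _ _ - _)) in *.
  assert (He1 : e1 <= C1 * rho ^ k) by (eapply Rle_trans; [exact H1|]; now apply Rmult_le_compat_l).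
  assert (He2 : e2 <= C2 * rho ^ k) by (eapply Rle_trans; [exact H2|]; now apply Rmult_le_compat_l).
  apply Rle_trans with (Rabs X * (C1 * rho ^ k) + Rabs Y * (C2 * rho ^ k)).
  + apply Rplus_le_compat; apply Rmult_le_compat_l; auto using Rabs_pos.
  + simpl pow.
    assert (Rabs X <= rho) by (unfold rho; assert (0 <= Rabs Y) by apply Rabs_pos; lra).
    assert (Rabs Y <= rho) by (unfold rho; assert (0 <= Rabs X) by apply Rabs_pos; lra).
    assert (0 <= C1 * rho ^ k) by now apply Rmult_le_pos.
    assert (0 <= C2 * rho ^ k) by now apply Rmult_le_pos.
    nra.
Qed.

(** * Sums of smooth families *)

Lemma smooth1_sum_Lambda eps K (F : nat -> nat -> R -> R) :
  (forall m n, smooth1 eps (F m n)) -> smooth1 eps (fun t => sum_Lambda K (fun m n => F m n t)).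
Proof.
intros HF. unfold sum_Lambda.
apply (smooth1_sum_n eps (fun m t => sum_n (fun n => F m n t) (K - m))); intros m _.
now apply (smooth1_sum_n eps (fun n t => F m n t)).
Qed.

Lemma smooth1_sum_Lambda1 eps K (F : nat -> nat -> R -> R) :
  (forall m n, smooth1 eps (F m n)) -> smooth1 eps (fun t => sum_Lambda1 K (fun m n => F m n t)).
Proof.
intros HF. unfold sum_Lambda1.
apply smooth1_plus.
- now apply (smooth1_sum_n eps (fun n t => F 0%nat n t)).
- now apply (smooth1_sum_n eps (fun n t => F 1%nat n t)).
Qed.

Lemma taylor_coef_sum_Lambda eps K (F : nat -> nat -> R -> R) p : 0 < eps ->
  (forall m n, smooth1 eps (F m n)) ->
  taylor_coef p (fun t => sum_Lambda K (fun m n => F m n t)) =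
  sum_Lambda K (fun m n => taylor_coef p (F m n)).
Proof.
intros He HF. unfold sum_Lambda.
rewrite (taylor_coef_sum_n eps (fun m t => sum_n (fun n => F m n t) (K - m))); [|assumption|].
- apply sum_n_ext; intros m. now apply (taylor_coef_sum_n eps (fun n t => F m n t)).
- intros m _. now apply (smooth1_sum_n eps (fun n t => F m n t)).
Qed.

Lemma taylor_coef_sum_Lambda1 eps K (F : nat -> nat -> R -> R) p : 0 < eps ->
  (forall m n, smooth1 eps (F m n)) ->
  taylor_coef p (fun t => sum_Lambda1 K (fun m n => F m n t)) =
  sum_Lambda1 K (fun m n => taylor_coef p (F m n)).
Proof.
intros He HF. unfold sum_Lambda1.
rewrite <- (taylor_coef_sum_n eps (fun n t => F 0%nat n t)) by auto.
rewrite <- (taylor_coef_sum_n eps (fun n t => F 1%nat n t)) by auto.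
apply (taylor_coef_plus eps); [assumption| |].
- now apply (smooth1_sum_n eps (fun n t => F 0%nat n t)).
- now apply (smooth1_sum_n eps (fun n t => F 1%nat n t)).
Qed.

Lemma is_derive_sum_Lambda K (F F' : nat -> nat -> R -> R) x :
  (forall m n, is_derive (F m n) x (F' m n x)) ->
  is_derive (fun z => sum_Lambda K (fun m n => F m n z)) x (sum_Lambda K (fun m n => F' m n x)).
Proof.
intros HF. unfold sum_Lambda.
apply (is_derive_sum_n (K := R_AbsRing) (V := R_NormedModule)
  (fun m z => sum_n (fun n => F m n z) (K - m))). intros m _.
now apply (is_derive_sum_n (K := R_AbsRing) (V := R_NormedModule) (fun n z => F m n z)).
Qed.

Lemma is_derive_sum_Lambda1 K (F F' : nat -> nat -> R -> R) x :
  (forall m n, is_derive (F m n) x (F' m n x)) ->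
  is_derive (fun z => sum_Lambda1 K (fun m n => F m n z)) x (sum_Lambda1 K (fun m n => F' m n x)).
Proof.
intros HF. unfold sum_Lambda1.
apply (is_derive_plus (K := R_AbsRing) (V := R_NormedModule)
  (fun z => sum_n (fun n => F 0%nat n z) K) (fun z => sum_n (fun n => F 1%nat n z) (K - 1))).
- now apply (is_derive_sum_n (K := R_AbsRing) (V := R_NormedModule) (fun n z => F 0%nat n z)).
- now apply (is_derive_sum_n (K := R_AbsRing) (V := R_NormedModule) (fun n z => F 1%nat n z)).
Qed.

Lemma sum_Lambda_minus K (a b : nat -> nat -> R) :
  sum_Lambda K (fun m n => a m n - b m n) = sum_Lambda K a - sum_Lambda K b.
Proof.
unfold Rminus. replace (- sum_Lambda K b) with ((-1) * sum_Lambda K b) by ring.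
rewrite sum_Lambda_mult_l. etransitivity; [|apply (sum_Lambda_plus (V := R_AbelianMonoid))].
apply sum_Lambda_ext; intros. to_R. ring.
Qed.

Lemma sum_Lambda1_minus K (a b : nat -> nat -> R) :
  sum_Lambda1 K (fun m n => a m n - b m n) = sum_Lambda1 K a - sum_Lambda1 K b.
Proof.
unfold Rminus. replace (- sum_Lambda1 K b) with ((-1) * sum_Lambda1 K b) by ring.
rewrite sum_Lambda1_mult_l. etransitivity; [|apply (sum_Lambda1_plus (V := R_AbelianMonoid))].
unfold sum_Lambda1. to_R. f_equal; apply sum_n_ext; intros; to_R; ring.
Qed.

(** The terms beyond the antidiagonal [p] and the constant term drop out, and the
    rest is grouped in the pairs [(0, n), (1, n - 1)] of the recursion. *)
Lemma sum_Lambda1_triangular K p (a : nat -> nat -> R) : (1 <= p <= K)%nat ->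
  a 0%nat 0%nat = 0 -> (forall m n, (p < m + n)%nat -> a m n = 0) ->
  sum_Lambda1 K a = sum_n_m (fun n => a 0%nat n + a 1%nat (n - 1)%nat) 1 p.
Proof.
intros Hp H0 Ha. rewrite (sum_Lambda1_truncate p) by (lia || exact Ha).
clear Ha. destruct Hp as [Hp _]. induction Hp as [|p Hp IH].
- rewrite sum_n_n. unfold sum_Lambda1. simpl Nat.sub. rewrite sum_Sn, !sum_O, H0. to_R. ring.
- rewrite sum_Lambda1_S, sum_n_Sm, IH by lia. to_R.
  replace (S p - 1)%nat with p by lia. ring.
Qed.

(** * The transmission conditions along the curve *)

Lemma lead_bounded p f L : lead p f L ->
  exists B d, 0 <= B /\ 0 < d /\ forall t, 0 < t < d -> Rabs (f t) <= B * t ^ p.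
Proof.
intros (C & d & Hd & H). exists (Rabs L + Rabs C), (Rmin 1 d).
assert (0 <= Rabs L) by apply Rabs_pos. assert (0 <= Rabs C) by apply Rabs_pos.
split; [lra|]. split; [apply Rmin_glb_lt; lra|]. intros t Ht.
assert (Rmin 1 d <= 1) by apply Rmin_l. assert (Rmin 1 d <= d) by apply Rmin_r.
specialize (H t ltac:(lra)). assert (Htp : 0 < t ^ p) by (apply pow_lt; lra).
simpl pow in *. set (tp := t ^ p) in *.
replace (f t) with (L * tp + (f t - L * tp)) by ring.
eapply Rle_trans; [apply Rabs_triang|]. rewrite Rabs_mult, (Rabs_pos_eq tp) by lra.
assert (C <= Rabs C) by apply Rle_abs.
assert (C * (t * tp) <= Rabs C * tp); [|lra].
apply Rle_trans with (Rabs C * (t * tp)).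
- apply Rmult_le_compat_r; nra.
- apply Rmult_le_compat_l; nra.
Qed.

Lemma flux_is_derive (w : R -> R -> R) r s t l l' :
  is_derive (fun z : R => w z (s t)) (r t) l -> is_derive (fun z : R => w (r t) z) (s t) l' ->
  flux w r s t = l * Derive s t - l' * Derive r t.
Proof.
intros H1 H2. unfold flux.
rewrite (is_derive_unique (fun z : R => w z (s t)) (r t) l H1).
now rewrite (is_derive_unique (fun z : R => w (r t) z) (s t) l' H2).
Qed.

Lemma is_derive_Hpoly_x m n x y :
  is_derive (fun z => Hpoly m n z y) x (- Gpoly_dx (S (S m)) n x y).
Proof.
apply (is_derive_ext (fun z => - Gpoly (S (S m)) n z y)); [intros; now rewrite Hpoly_Gpoly|].
apply (is_derive_opp (K := R_AbsRing) (V := R_NormedModule)), is_derive_Gpoly_x.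
Qed.

Lemma is_derive_Hpoly_y m n x y :
  is_derive (fun z => Hpoly m n x z) y (- Gpoly_dy (S (S m)) n x y).
Proof.
apply (is_derive_ext (fun z => - Gpoly (S (S m)) n x z)); [intros; now rewrite Hpoly_Gpoly|].
apply (is_derive_opp (K := R_AbsRing) (V := R_NormedModule)), is_derive_Gpoly_y.
Qed.

(** Differentiating the reorganised Taylor polynomial of [a], which is the same
    function as the original one. *)
Lemma flux_jet_poly K (a f : nat -> nat -> R) r s t :
  (forall m n, a (S (S m)) n + a m (S (S n)) = - f m n) ->
  jet_poly (S (S K)) (fun m n => a (S m) n) (r t) (s t) * Derive s t
  - jet_poly (S (S K)) (fun m n => a m (S n)) (r t) (s t) * Derive r t
  = sum_Lambda1 (S (S K)) (fun m n => a m n * flux (Gpoly m n) r s t)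
    + sum_Lambda K (fun m n => f m n * flux (Hpoly m n) r s t).
Proof.
intros Hf.
rewrite <- (flux_is_derive _ r s t _ _ (is_derive_jet_poly_x (S (S K)) a (r t) (s t))
             (is_derive_jet_poly_y (S (S K)) a (r t) (s t))).
set (W := fun x y => sum_Lambda1 (S (S K)) (fun m n => a m n * Gpoly m n x y)
                     + sum_Lambda K (fun m n => f m n * Hpoly m n x y)).
assert (HW : forall x y, jet_poly (S (S (S K))) a x y = W x y).
{ intros x y. rewrite jet_poly_sum_Lambda. apply jet_reorganisation. auto. }
transitivity (flux W r s t).
{ unfold flux. f_equal; f_equal; apply Derive_ext; intros; apply HW. }
assert (Hx : forall x y, is_derive (fun z => W z y) x
   (sum_Lambda1 (S (S K)) (fun m n => a m n * Gpoly_dx m n x y)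
    + sum_Lambda K (fun m n => f m n * - Gpoly_dx (S (S m)) n x y))).
{ intros x y. apply (is_derive_plus (K := R_AbsRing) (V := R_NormedModule)
    (fun z => sum_Lambda1 (S (S K)) (fun m n => a m n * Gpoly m n z y))
    (fun z => sum_Lambda K (fun m n => f m n * Hpoly m n z y))).
  - apply (is_derive_sum_Lambda1 _ (fun m n z => a m n * Gpoly m n z y)
      (fun m n z => a m n * Gpoly_dx m n z y)).
    intros; apply (is_derive_scal (fun z => Gpoly m n z y)), is_derive_Gpoly_x.
  - apply (is_derive_sum_Lambda _ (fun m n z => f m n * Hpoly m n z y)
      (fun m n z => f m n * - Gpoly_dx (S (S m)) n z y)).
    intros; apply (is_derive_scal (fun z => Hpoly m n z y)), is_derive_Hpoly_x. }
assert (Hy : forall x y, is_derive (fun z => W x z) y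
   (sum_Lambda1 (S (S K)) (fun m n => a m n * Gpoly_dy m n x y)
    + sum_Lambda K (fun m n => f m n * - Gpoly_dy (S (S m)) n x y))).
{ intros x y. apply (is_derive_plus (K := R_AbsRing) (V := R_NormedModule)
    (fun z => sum_Lambda1 (S (S K)) (fun m n => a m n * Gpoly m n x z))
    (fun z => sum_Lambda K (fun m n => f m n * Hpoly m n x z))).
  - apply (is_derive_sum_Lambda1 _ (fun m n z => a m n * Gpoly m n x z)
      (fun m n z => a m n * Gpoly_dy m n x z)).
    intros; apply (is_derive_scal (fun z => Gpoly m n x z)), is_derive_Gpoly_y.
  - apply (is_derive_sum_Lambda _ (fun m n z => f m n * Hpoly m n x z)
      (fun m n z => f m n * - Gpoly_dy (S (S m)) n x z)).
    intros; apply (is_derive_scal (fun z => Hpoly m n x z)), is_derive_Hpoly_y. }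
rewrite (flux_is_derive W r s t _ _ (Hx _ _) (Hy _ _)).
transitivity (sum_Lambda1 (S (S K)) (fun m n =>
     Derive s t * (a m n * Gpoly_dx m n (r t) (s t))
     - Derive r t * (a m n * Gpoly_dy m n (r t) (s t)))
  + sum_Lambda K (fun m n => Derive s t * (f m n * - Gpoly_dx (S (S m)) n (r t) (s t))
     - Derive r t * (f m n * - Gpoly_dy (S (S m)) n (r t) (s t)))).
- rewrite sum_Lambda_minus, sum_Lambda1_minus, <- !sum_Lambda_mult_l, <- !sum_Lambda1_mult_l.
  ring.
- f_equal.
  + apply sum_Lambda1_ext; [lia|]; intros. rewrite flux_Gpoly. to_R; ring.
  + apply sum_Lambda_ext; intros. rewrite flux_Hpoly, flux_Gpoly. to_R; ring.
Qed.

Section Transmission.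

Context (l1 l2 l3 l4 : R) (D : R * R -> Prop) (D_open : open D)
  (D_rectangle : forall q, closed_Omega l1 l2 l3 l4 q -> D q).
Context (x0 y0 eps : R) (r s : R -> R).
Context (eps_pos : 0 < eps) (r_smooth : smooth1 eps r) (s_smooth : smooth1 eps s)
  (r_0 : r 0 = 0) (s_0 : s 0 = 0)
  (regular : forall t, Rabs t < eps -> 0 < Derive r t ^ 2 + Derive s t ^ 2)
  (curve_inside : forall t, Rabs t < eps -> closed_Omega l1 l2 l3 l4 (r t + x0, s t + y0)).

Lemma Taylor_along_curve w k : smooth_on D w ->
  lead k (fun t => w (r t + x0) (s t + y0) - jet_poly (S k) (jet w x0 y0) (r t) (s t)) 0.
Proof.
intros Hw.
destruct (uniform_Taylor l1 l2 l3 l4 D (S k) D_open D_rectangle w Hw) as [C [HC H]].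
destruct (lead_bounded _ _ _ (lead_r eps r eps_pos r_smooth r_0)) as (B1 & d1 & HB1 & Hd1 & H1).
destruct (lead_bounded _ _ _ (lead_s eps s eps_pos s_smooth s_0)) as (B2 & d2 & HB2 & Hd2 & H2).
exists (C * (B1 + B2) ^ S k), (Rmin eps (Rmin d1 d2)).
split; [repeat apply Rmin_glb_lt; assumption|]. intros t Ht.
assert (Rmin eps (Rmin d1 d2) <= eps) by apply Rmin_l.
assert (Rmin eps (Rmin d1 d2) <= Rmin d1 d2) by apply Rmin_r.
assert (Rmin d1 d2 <= d1) by apply Rmin_l. assert (Rmin d1 d2 <= d2) by apply Rmin_r.
specialize (H1 t ltac:(lra)). specialize (H2 t ltac:(lra)).
assert (Hbase := curve_inside 0). rewrite Rabs_R0, r_0, s_0, !Rplus_0_l in Hbase.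
specialize (H x0 y0 (r t + x0) (s t + y0) (Hbase eps_pos)
  (curve_inside t ltac:(rewrite Rabs_pos_eq; lra))).
replace (r t + x0 - x0) with (r t) in H by ring.
replace (s t + y0 - y0) with (s t) in H by ring.
rewrite Rmult_0_l, Rminus_0_r. eapply Rle_trans; [exact H|].
rewrite Rmult_assoc, <- Rpow_mult_distr. apply Rmult_le_compat_l; [assumption|].
apply pow_incr. split; [apply Rplus_le_le_0_compat; apply Rabs_pos|].
rewrite pow_1 in *. lra.
Qed.

Context (K : nat) (sigma : R) (uP uN fP fN g1 g : R -> R -> R).
Context (uP_smooth : smooth_on D uP) (uN_smooth : smooth_on D uN)
  (g1_smooth : smooth_on D g1) (g_smooth : smooth_on D g).
Context
  (pde_P : forall m n, jet uP x0 y0 (S (S m)) n + jet uP x0 y0 m (S (S n)) = - jet fP x0 y0 m n)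
  (pde_N : forall m n, jet uN x0 y0 (S (S m)) n + jet uN x0 y0 m (S (S n)) = - jet fN x0 y0 m n)
  (jump_value : forall t, Rabs t < eps ->
     uP (r t + x0) (s t + y0) - uN (r t + x0) (s t + y0) = g1 (r t + x0) (s t + y0))
  (jump_flux : forall t, Rabs t < eps ->
     (dX uP (r t + x0) (s t + y0) * Derive s t - dY uP (r t + x0) (s t + y0) * Derive r t)
     - (dX uN (r t + x0) (s t + y0) * Derive s t - dY uN (r t + x0) (s t + y0) * Derive r t)
     = sigma * (sqrt (Derive r t ^ 2 + Derive s t ^ 2) * g (r t + x0) (s t + y0))).

Let d (m n : nat) : R := jet uP x0 y0 m n - jet uN x0 y0 m n.
Let df (m n : nat) : R := jet fP x0 y0 m n - jet fN x0 y0 m n.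

Lemma d_pde m n : d (S (S m)) n + d m (S (S n)) = - df m n.
Proof. unfold d, df. assert (H1 := pde_P m n). assert (H2 := pde_N m n). lra. Qed.

Lemma jet_poly_minus k a b X Y :
  jet_poly k (fun m n => a m n - b m n) X Y = jet_poly k a X Y - jet_poly k b X Y.
Proof.
destruct k as [|k]; [simpl; ring|]. rewrite !jet_poly_sum_Lambda, <- sum_Lambda_minus.
apply sum_Lambda_ext; intros. to_R; ring.
Qed.

(** On the curve [uP - uN - g1] vanishes; replacing the three functions by their
    Taylor polynomials leaves an error [O(t^(K+3))]. *)
Lemma value_system p : (p <= S (S K))%nat ->
  sum_Lambda1 (S (S K)) (fun m n => d m n * g_coef r s m n p)
  + sum_Lambda K (fun m n => df m n * h_coef r s m n p)
  - sum_Lambda (S (S K)) (fun m n =>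
      jet g1 x0 y0 m n / (INR (fact m) * INR (fact n)) * r_coef r s m n p) = 0.
Proof.
intros Hp.
set (Psi := fun t =>
  sum_Lambda1 (S (S K)) (fun m n => d m n * Gpoly m n (r t) (s t))
  + sum_Lambda K (fun m n => df m n * Hpoly m n (r t) (s t))
  - sum_Lambda (S (S K)) (fun m n =>
      jet g1 x0 y0 m n / (INR (fact m) * INR (fact n)) * (r t ^ m * s t ^ n))).
assert (S1 : smooth1 eps (fun t => sum_Lambda1 (S (S K)) (fun m n => d m n * Gpoly m n (r t) (s t)))).
{ apply (smooth1_sum_Lambda1 eps _ (fun m n t => d m n * Gpoly m n (r t) (s t))).
  intros; apply smooth1_scal; now apply smooth1_Gpoly. }
assert (S2h : forall m n, smooth1 eps (fun t => Hpoly m n (r t) (s t))).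
{ intros m n. apply (smooth1_ext eps (fun t => (-1) * Gpoly (S (S m)) n (r t) (s t))).
  - intros; rewrite Hpoly_Gpoly; ring.
  - apply smooth1_scal; now apply smooth1_Gpoly. }
assert (S2 : smooth1 eps (fun t => sum_Lambda K (fun m n => df m n * Hpoly m n (r t) (s t)))).
{ apply (smooth1_sum_Lambda eps _ (fun m n t => df m n * Hpoly m n (r t) (s t))).
  intros; now apply smooth1_scal. }
assert (S3 : smooth1 eps (fun t => sum_Lambda (S (S K)) (fun m n =>
      jet g1 x0 y0 m n / (INR (fact m) * INR (fact n)) * (r t ^ m * s t ^ n)))).
{ apply (smooth1_sum_Lambda eps _ (fun m n t =>
      jet g1 x0 y0 m n / (INR (fact m) * INR (fact n)) * (r t ^ m * s t ^ n))).
  intros; apply smooth1_scal; now apply smooth1_monomial. }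
assert (Hlead : lead (S (S K)) Psi 0).
{ apply (lead_ext eps (S (S K)) (fun t =>
     ((uN (r t + x0) (s t + y0) - jet_poly (S (S (S K))) (jet uN x0 y0) (r t) (s t))
      - (uP (r t + x0) (s t + y0) - jet_poly (S (S (S K))) (jet uP x0 y0) (r t) (s t)))
     + (g1 (r t + x0) (s t + y0) - jet_poly (S (S (S K))) (jet g1 x0 y0) (r t) (s t)))); [lra| |].
  - intros t Ht. unfold Psi.
    rewrite <- (jet_reorganisation K d df) by (intros; apply d_pde).
    rewrite <- jet_poly_sum_Lambda. unfold d. rewrite jet_poly_minus.
    rewrite <- (jump_value t) by (rewrite Rabs_pos_eq; lra).
    replace (sum_Lambda (S (S K)) _) with (jet_poly (S (S (S K))) (jet g1 x0 y0) (r t) (s t)).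
    + ring.
    + rewrite jet_poly_sum_Lambda. apply sum_Lambda_ext; intros m n _. unfold dpow, Rdiv.
      rewrite Rinv_mult. to_R; ring.
  - replace 0 with (0 - 0 + 0) by ring.
    apply lead_plus; [apply lead_minus|]; now apply Taylor_along_curve. }
assert (Hz : taylor_coef p Psi = 0).
{ assert (Hs : smooth1 eps Psi) by (apply smooth1_minus; [now apply smooth1_plus|assumption]).
  destruct (Nat.eq_dec p (S (S K))) as [->|Hne].
  - now apply (lead_taylor_coef eps).
  - apply (lead_taylor_coef_below eps Psi (S (S K)) 0); auto; lia. }
rewrite <- Hz. unfold Psi.
rewrite (taylor_coef_minus eps) by (auto using smooth1_plus).
rewrite (taylor_coef_plus eps) by auto.
rewrite (taylor_coef_sum_Lambda1 eps _ (fun m n t => d m n * Gpoly m n (r t) (s t)));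
  [|assumption|intros; apply smooth1_scal; now apply smooth1_Gpoly].
rewrite (taylor_coef_sum_Lambda eps _ (fun m n t => df m n * Hpoly m n (r t) (s t)));
  [|assumption|intros; now apply smooth1_scal].
rewrite (taylor_coef_sum_Lambda eps _ (fun m n t =>
      jet g1 x0 y0 m n / (INR (fact m) * INR (fact n)) * (r t ^ m * s t ^ n)));
  [|assumption|intros; apply smooth1_scal; now apply smooth1_monomial].
f_equal; [f_equal|].
- apply sum_Lambda1_ext; [lia|]; intros. symmetry; apply taylor_coef_scal.
- apply sum_Lambda_ext; intros. symmetry; apply taylor_coef_scal.
- apply sum_Lambda_ext; intros. symmetry; apply taylor_coef_scal.
Qed.

(** The same for the fluxes, at one order less, because the Taylor polynomials of
    the gradients have one degree less. *)
Lemma flux_system p : (p <= S K)%nat ->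
  sum_Lambda1 (S (S K)) (fun m n => d m n * gt_coef r s m n p)
  + sum_Lambda K (fun m n => df m n * ht_coef r s m n p)
  - sigma * sum_Lambda (S K) (fun m n =>
      jet g x0 y0 m n / (INR (fact m) * INR (fact n)) * rt_coef r s m n p) = 0.
Proof.
intros Hp.
set (speed := fun t => sqrt (Derive r t ^ 2 + Derive s t ^ 2)).
assert (Hspeed : smooth1 eps speed) by now apply smooth1_speed.
assert (Hr' := smooth1_Derive eps r r_smooth). assert (Hs' := smooth1_Derive eps s s_smooth).
set (Psi := fun t =>
  sum_Lambda1 (S (S K)) (fun m n => d m n * flux (Gpoly m n) r s t)
  + sum_Lambda K (fun m n => df m n * flux (Hpoly m n) r s t)
  - sigma * sum_Lambda (S K) (fun m n =>
      jet g x0 y0 m n / (INR (fact m) * INR (fact n)) * (r t ^ m * s t ^ n * speed t))).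
assert (S1g : forall m n, smooth1 eps (flux (Gpoly m n) r s))
  by (intros; now apply smooth1_flux_Gpoly).
assert (S1 : smooth1 eps (fun t => sum_Lambda1 (S (S K)) (fun m n => d m n * flux (Gpoly m n) r s t))).
{ apply (smooth1_sum_Lambda1 eps _ (fun m n t => d m n * flux (Gpoly m n) r s t)).
  intros; now apply smooth1_scal. }
assert (S2h : forall m n, smooth1 eps (flux (Hpoly m n) r s)).
{ intros m n. apply (smooth1_ext eps (fun t => (-1) * flux (Gpoly (S (S m)) n) r s t)).
  - intros; rewrite flux_Hpoly; ring.
  - now apply smooth1_scal. }
assert (S2 : smooth1 eps (fun t => sum_Lambda K (fun m n => df m n * flux (Hpoly m n) r s t))).
{ apply (smooth1_sum_Lambda eps _ (fun m n t => df m n * flux (Hpoly m n) r s t)).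
  intros; now apply smooth1_scal. }
assert (S3m : forall m n, smooth1 eps (fun t => r t ^ m * s t ^ n * speed t)).
{ intros m n. apply (smooth1_mult eps (fun t => r t ^ m * s t ^ n) speed); [|assumption].
  now apply smooth1_monomial. }
assert (S3 : smooth1 eps (fun t => sum_Lambda (S K) (fun m n =>
      jet g x0 y0 m n / (INR (fact m) * INR (fact n)) * (r t ^ m * s t ^ n * speed t)))).
{ apply (smooth1_sum_Lambda eps _ (fun m n t =>
      jet g x0 y0 m n / (INR (fact m) * INR (fact n)) * (r t ^ m * s t ^ n * speed t))).
  intros; now apply smooth1_scal. }
set (rem := fun w t => w (r t + x0) (s t + y0) - jet_poly (S (S K)) (jet w x0 y0) (r t) (s t)).
assert (Hrem : forall w, smooth_on D w -> lead (S K) (rem w) 0)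
  by (intros; now apply Taylor_along_curve).
assert (Hlead : lead (S K) Psi 0).
{ apply (lead_ext eps (S K) (fun t =>
     ((rem (dX uN) t * Derive s t - rem (dY uN) t * Derive r t)
      - (rem (dX uP) t * Derive s t - rem (dY uP) t * Derive r t))
     + sigma * (rem g t * speed t))); [lra| |].
  - intros t Ht. unfold Psi.
    assert (Hbase : D (x0, y0)).
    { apply D_rectangle. assert (Hb := curve_inside 0).
      rewrite Rabs_R0, r_0, s_0, !Rplus_0_l in Hb. auto. }
    rewrite <- (flux_jet_poly K d df) by (intros; apply d_pde).
    rewrite (jet_poly_ext _ (fun m n => d (S m) n)
       (fun m n => jet (dX uP) x0 y0 m n - jet (dX uN) x0 y0 m n))
      by (intros; unfold d, jet; now rewrite !(partial_derive_dX D)).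
    rewrite (jet_poly_ext _ (fun m n => d m (S n))
       (fun m n => jet (dY uP) x0 y0 m n - jet (dY uN) x0 y0 m n))
      by (intros; unfold d, jet; now rewrite !partial_derive_dY).
    rewrite !jet_poly_minus.
    assert (Hj := jump_flux t ltac:(rewrite Rabs_pos_eq; lra)). fold (speed t) in Hj.
    replace (sum_Lambda (S K) _) with (jet_poly (S (S K)) (jet g x0 y0) (r t) (s t) * speed t).
    + unfold rem. lra.
    + rewrite jet_poly_sum_Lambda, Rmult_comm, sum_Lambda_mult_l.
      apply sum_Lambda_ext; intros m n _. unfold dpow, Rdiv. rewrite Rinv_mult. to_R; ring.
  - replace 0 with ((0 * Derive s 0 - 0 * Derive r 0) - (0 * Derive s 0 - 0 * Derive r 0)
                    + sigma * (0 * speed 0)) by ring.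
    assert (Hmul : forall w c, smooth_on D w -> smooth1 eps c ->
              lead (S K) (fun t => rem w t * c t) (0 * c 0)).
    { intros w c Hw Hc. rewrite <- (Nat.add_0_r (S K)).
      apply lead_mult; [now apply Hrem|now apply (lead_value_at_0 eps)]. }
    apply lead_plus; [apply lead_minus; apply lead_minus|apply lead_scal];
      apply Hmul; auto using smooth_on_dX, smooth_on_dY. }
assert (Hz : taylor_coef p Psi = 0).
{ assert (Hs : smooth1 eps Psi)
    by (apply smooth1_minus; [now apply smooth1_plus|now apply smooth1_scal]).
  destruct (Nat.eq_dec p (S K)) as [->|Hne].
  - now apply (lead_taylor_coef eps).
  - apply (lead_taylor_coef_below eps Psi (S K) 0); auto; lia. }
rewrite <- Hz. unfold Psi.
rewrite (taylor_coef_minus eps) by (auto using smooth1_plus, smooth1_scal).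
rewrite (taylor_coef_plus eps) by auto.
rewrite taylor_coef_scal.
rewrite (taylor_coef_sum_Lambda1 eps _ (fun m n t => d m n * flux (Gpoly m n) r s t));
  [|assumption|intros; now apply smooth1_scal].
rewrite (taylor_coef_sum_Lambda eps _ (fun m n t => df m n * flux (Hpoly m n) r s t));
  [|assumption|intros; now apply smooth1_scal].
rewrite (taylor_coef_sum_Lambda eps _ (fun m n t =>
      jet g x0 y0 m n / (INR (fact m) * INR (fact n)) * (r t ^ m * s t ^ n * speed t)));
  [|assumption|intros; now apply smooth1_scal].
f_equal; [f_equal|f_equal].
- apply sum_Lambda1_ext; [lia|]; intros. symmetry; apply taylor_coef_scal.
- apply sum_Lambda_ext; intros. symmetry; apply taylor_coef_scal.
- apply sum_Lambda_ext; intros. symmetry; apply taylor_coef_scal.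
Qed.

Lemma U_jump m n : (m <= 1)%nat -> (m + n <= S (S K))%nat ->
  U (S K) sigma r s (jet fP x0 y0) (jet fN x0 y0) (jet g1 x0 y0) (jet g x0 y0) m n
  = jet uP x0 y0 m n - jet uN x0 y0 m n.
Proof.
intros Hm Hn.
refine (U_solves eps r s eps_pos r_smooth s_smooth r_0 s_0 regular (S K) sigma
  _ _ _ _ d _ _ _ m n Hm _); [| | |lia].
- unfold d, jet, partial_derive. simpl.
  generalize (jump_value 0). rewrite Rabs_R0, r_0, s_0, !Rplus_0_l. auto.
- intros p Hp.
  replace (sum_n_m _ 1 p) with (sum_Lambda1 (S (S K)) (fun m n => d m n * g_coef r s m n p)).
  + assert (H := value_system p ltac:(lia)).
    unfold Fvec. replace (S K - 1)%nat with K by lia. replace (S K + 1)%nat with (S (S K)) by lia.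
    match goal with |- ?a = _ => transitivity
      (- sum_Lambda K (fun m n => df m n * h_coef r s m n p)
       + sum_Lambda (S (S K)) (fun m n =>
           jet g1 x0 y0 m n / (INR (fact m) * INR (fact n)) * r_coef r s m n p)) end; [to_R; lra|].
    apply (f_equal2 Rplus).
    * replace (- sum_Lambda K (fun m n => df m n * h_coef r s m n p)) with
        ((-1) * sum_Lambda K (fun m n => df m n * h_coef r s m n p)) by ring.
      rewrite sum_Lambda_mult_l. apply sum_Lambda_ext; intros.
      unfold df, scal, minus, plus, opp; simpl. unfold mult; simpl. ring.
    * apply sum_Lambda_ext; intros. unfold scal; simpl. unfold mult; simpl. unfold Rdiv; ring.
  + rewrite (sum_Lambda1_triangular (S (S K)) p); [|lia| |].
    * apply sum_n_m_ext; intros k. to_R; ring.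
    * replace (g_coef r s 0 0 p) with 0; [ring|]. symmetry. unfold g_coef, taylor_coef.
      rewrite (Derive_n_ext _ (fun _ => 1)) by (intros; now rewrite Gpoly_n0, dpow_0).
      destruct p as [|p]; [lia|]. rewrite Derive_n_const. unfold Rdiv; ring.
    * intros k l Hkl. rewrite (g_coef_below eps) by (auto; lia). ring.
- intros p Hp.
  replace (sum_n_m _ 1 p) with (sum_Lambda1 (S (S K)) (fun m n => d m n * gt_coef r s m n (p - 1))).
  + assert (H := flux_system (p - 1) ltac:(lia)).
    unfold Gvec. replace (S K - 1)%nat with K by lia.
    match goal with |- ?a = _ => transitivity
      (- sum_Lambda K (fun m n => df m n * ht_coef r s m n (p - 1))
       + sigma * sum_Lambda (S K) (fun m n =>
           jet g x0 y0 m n / (INR (fact m) * INR (fact n)) * rt_coef r s m n (p - 1))) end; [to_R; lra|].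
    apply (f_equal2 Rplus).
    * replace (- sum_Lambda K (fun m n => df m n * ht_coef r s m n (p - 1))) with
        ((-1) * sum_Lambda K (fun m n => df m n * ht_coef r s m n (p - 1))) by ring.
      rewrite sum_Lambda_mult_l. apply sum_Lambda_ext; intros.
      unfold df, scal, minus, plus, opp; simpl. unfold mult; simpl. ring.
    * unfold scal at 1; simpl. unfold mult; simpl. f_equal.
      apply sum_Lambda_ext; intros. unfold scal; simpl. unfold mult; simpl. unfold Rdiv; ring.
  + rewrite (sum_Lambda1_triangular (S (S K)) p); [|lia| |].
    * apply sum_n_m_ext; intros k. to_R; ring.
    * replace (gt_coef r s 0 0 (p - 1)) with 0; [ring|]. symmetry. unfold gt_coef.
      rewrite (taylor_coef_ext eps _ (fun t => 0 * t)); [|assumption|].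
      -- rewrite (taylor_coef_scal 0 (fun t => t)); ring.
      -- intros. rewrite flux_Gpoly. simpl. ring.
    * intros k l Hkl. rewrite (gt_coef_below eps) by (auto; lia). ring.
Qed.

End Transmission.

(** * One-sided limits at the interface *)

Lemma open_Omega l1 l2 l3 l4 : open (Omega l1 l2 l3 l4).
Proof.
intros [x y] [[H1 H2] [H3 H4]]; simpl in *.
apply (locally_2d_locally (fun u v => Omega l1 l2 l3 l4 (u, v))).
assert (Hd : 0 < Rmin (Rmin (x - l1) (l2 - x)) (Rmin (y - l3) (l4 - y)))
  by (repeat apply Rmin_glb_lt; lra).
exists (mkposreal _ Hd). simpl. intros u v Hu Hv.
assert (E1 := Rmin_l (Rmin (x - l1) (l2 - x)) (Rmin (y - l3) (l4 - y))).
assert (E2 := Rmin_r (Rmin (x - l1) (l2 - x)) (Rmin (y - l3) (l4 - y))).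
assert (E3 := Rmin_l (x - l1) (l2 - x)). assert (E4 := Rmin_r (x - l1) (l2 - x)).
assert (E5 := Rmin_l (y - l3) (l4 - y)). assert (E6 := Rmin_r (y - l3) (l4 - y)).
apply Rabs_def2 in Hu. apply Rabs_def2 in Hv.
unfold Omega; simpl. lra.
Qed.

(** The factor [sgn] treats the positive and the negative region at once. *)
Lemma open_sign_region (P Q : R * R -> Prop) (psi : R -> R -> R) (sgn : R) :
  open P -> (forall x y, P (x, y) -> continuity_2d_pt psi x y) ->
  (forall q, Q q <-> P q /\ sgn * psi (fst q) (snd q) > 0) -> sgn ^ 2 = 1 -> open Q.
Proof.
intros HP Hc HQ Hsgn [x y] Hq. apply HQ in Hq. destruct Hq as [Hq Hpos]. simpl in Hpos.
apply (filter_imp (fun q => P q /\ Rabs (psi (fst q) (snd q) - psi x y) < sgn * psi x y)).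
- intros [u v] [H1 H2]. apply HQ. split; [assumption|]. simpl in *.
  apply Rabs_def2 in H2. assert (sgn = 1 \/ sgn = -1) as [-> | ->] by nra; lra.
- apply filter_and; [now apply HP|].
  apply (locally_2d_locally (fun u v => Rabs (psi u v - psi x y) < sgn * psi x y)).
  exact (Hc x y Hq (mkposreal _ Hpos)).
Qed.

Definition limit_point (P : R * R -> Prop) (p : R * R) : Prop :=
  forall Q : R * R -> Prop, locally p Q -> exists q, Q q /\ P q.

(** Points arbitrarily close on the normal line witness this; it makes one-sided
    limits at the interface unique. *)
Lemma normal_limit_point S P N x0 y0 n : unit_normal_towards S P N x0 y0 n ->
  limit_point P (x0, y0) /\ limit_point N (x0, y0).
Proof.
intros (Hn & _ & delta & Hdelta & H). destruct n as [n1 n2]; simpl in *.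
assert (Hb1 : Rabs n1 <= 1) by (apply Rabs_le; nra).
assert (Hb2 : Rabs n2 <= 1) by (apply Rabs_le; nra).
assert (Htau : forall e : posreal, exists tau, 0 < tau < delta /\ tau < e /\
          Rabs (tau * n1) < e /\ Rabs (tau * n2) < e).
{ intros e. assert (He := cond_pos e).
  assert (0 < Rmin delta e / 2) by (assert (0 < Rmin delta e) by (apply Rmin_glb_lt; lra); lra).
  exists (Rmin delta e / 2). assert (Rmin delta e <= delta) by apply Rmin_l.
  assert (Rmin delta e <= e) by apply Rmin_r.
  rewrite !Rabs_mult, (Rabs_pos_eq (Rmin delta e / 2)) by lra.
  assert (0 <= Rabs n1) by apply Rabs_pos. assert (0 <= Rabs n2) by apply Rabs_pos.
  repeat split; nra. }
split; intros Q HQ;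
  (assert (HQ' : locally_2d (fun u v => Q (u, v)) x0 y0)
     by (apply locally_2d_locally; revert HQ; apply filter_imp; now intros [u v]));
  destruct HQ' as [e He]; destruct (Htau e) as (tau & Ht & _ & H1 & H2);
  destruct (H tau Ht) as [HP HN].
- exists (x0 + tau * n1, y0 + tau * n2). split; [|assumption]. apply He.
  + now replace (x0 + tau * n1 - x0) with (tau * n1) by ring.
  + now replace (y0 + tau * n2 - y0) with (tau * n2) by ring.
- exists (x0 - tau * n1, y0 - tau * n2). split; [|assumption]. apply He.
  + replace (x0 - tau * n1 - x0) with (- (tau * n1)) by ring. now rewrite Rabs_Ropp.
  + replace (y0 - tau * n2 - y0) with (- (tau * n2)) by ring. now rewrite Rabs_Ropp.
Qed.

Lemma limit_within_unique (P : R * R -> Prop) (w W : R -> R -> R) x y a :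
  limit_point P (x, y) -> (forall u v, P (u, v) -> w u v = W u v) ->
  continuity_2d_pt W x y ->
  filterlim (fun q : R * R => w (fst q) (snd q)) (within P (locally ((x, y) : R * R))) (locally a) ->
  a = W x y.
Proof.
intros Hacc Heq Hc Hlim.
assert (HF : ProperFilter' (within P (locally ((x, y) : R * R)))).
{ constructor; [|apply within_filter, locally_filter].
  intros Hf. destruct (Hacc (fun q => P q -> False) Hf) as [q [Hq HP]]. exact (Hq HP). }
apply (filterlim_locally_unique (K := R_AbsRing) (V := R_NormedModule)
  (F := within P (locally ((x, y) : R * R))) (fun q => w (fst q) (snd q))); [exact Hlim|].
apply (filterlim_ext_loc (fun q : R * R => W (fst q) (snd q))).
- unfold within. apply filter_forall. intros [u v] HP. symmetry. now apply Heq.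
- eapply filterlim_filter_le_1; [apply filter_le_within|].
  now apply continuity_2d_pt_filterlim.
Qed.

Lemma partial_derive_relation (O : R * R -> Prop) (f a b : R -> R -> R) :
  open O -> smooth_on O a -> smooth_on O b ->
  (forall x y, O (x, y) -> f x y = - (a x y + b x y)) ->
  forall m n x y, O (x, y) ->
  partial_derive m n f x y = - (partial_derive m n a x y + partial_derive m n b x y).
Proof.
intros HO Ha Hb Hf. induction m as [|m IH].
- induction n as [|n IH]; [exact Hf|]. intros x y Hxy.
  change (dY (partial_derive 0 n f) x y
          = - (dY (partial_derive 0 n a) x y + dY (partial_derive 0 n b) x y)).
  unfold dY at 1. apply is_derive_unique.
  apply (is_derive_ext_loc (fun z => - (partial_derive 0 n a x z + partial_derive 0 n b x z))).
  + generalize (locally_2d_1d_const_x _ _ _ (open_locally_2d O x y HO Hxy)).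
    apply filter_imp. intros z Hz. symmetry. now apply IH.
  + apply (is_derive_opp (K := R_AbsRing) (V := R_NormedModule)
      (fun z => partial_derive 0 n a x z + partial_derive 0 n b x z)).
    apply (is_derive_plus (K := R_AbsRing) (V := R_NormedModule)
      (fun z => partial_derive 0 n a x z) (fun z => partial_derive 0 n b x z));
      apply (smooth_on_is_derive_y O); auto using smooth_on_partial_derive.
- intros n x y Hxy.
  change (dX (partial_derive m n f) x y
          = - (dX (partial_derive m n a) x y + dX (partial_derive m n b) x y)).
  unfold dX at 1. apply is_derive_unique.
  apply (is_derive_ext_loc (fun z => - (partial_derive m n a z y + partial_derive m n b z y))).
  + generalize (locally_2d_1d_const_y _ _ _ (open_locally_2d O x y HO Hxy)).
    apply filter_imp. intros z Hz. symmetry. now apply IH.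
  + apply (is_derive_opp (K := R_AbsRing) (V := R_NormedModule)
      (fun z => partial_derive m n a z y + partial_derive m n b z y)).
    apply (is_derive_plus (K := R_AbsRing) (V := R_NormedModule)
      (fun z => partial_derive m n a z y) (fun z => partial_derive m n b z y));
      apply (smooth_on_is_derive_x O); auto using smooth_on_partial_derive.
Qed.

(** In the open region the equation may be differentiated, and by continuity the
    differentiated equations persist at the interface. *)
Lemma interface_jet_relation (D P : R * R -> Prop) (u f w fw : R -> R -> R) x0 y0 :
  open D -> open P -> (forall q, P q -> D q) -> D (x0, y0) -> limit_point P (x0, y0) ->
  smooth_on D w -> smooth_on D fw ->
  (forall x y, P (x, y) -> w x y = u x y) -> (forall x y, P (x, y) -> fw x y = f x y) ->
  (forall x y, P (x, y) ->
     - (partial_derive 2 0 u x y + partial_derive 0 2 u x y) = f x y) ->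
  forall m n, jet w x0 y0 (S (S m)) n + jet w x0 y0 m (S (S n)) = - jet fw x0 y0 m n.
Proof.
intros HDo HPo HPD HD Hacc Hw Hfw Hwu Hfwf Hpde m n.
assert (Hsub : forall v, smooth_on D v -> smooth_on P v)
  by (intros v Hv k x y Hq; apply Hv; now apply HPD).
assert (Hrel : forall x y, P (x, y) ->
  partial_derive m n fw x y = - (partial_derive (S (S m)) n w x y + partial_derive m (S (S n)) w x y)).
{ intros x y Hq.
  rewrite <- (partial_derive_dX D _ (S m) n), <- (partial_derive_dX D _ m n), <- !partial_derive_dY;
    auto using smooth_on_dX.
  apply (partial_derive_relation P fw (dX (dX w)) (dY (dY w))); auto using smooth_on_dX, smooth_on_dY.
  intros x' y' Hq'. rewrite Hfwf, <- Hpde by assumption. f_equal. f_equal.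
  - symmetry. apply (partial_derive_ext_loc w u 2 0).
    generalize (open_locally_2d P x' y' HPo Hq'). apply locally_2d_impl, locally_2d_forall. auto.
  - symmetry. apply (partial_derive_ext_loc w u 0 2).
    generalize (open_locally_2d P x' y' HPo Hq'). apply locally_2d_impl, locally_2d_forall. auto. }
assert (H : 0 = jet w x0 y0 (S (S m)) n + jet w x0 y0 m (S (S n)) + jet fw x0 y0 m n).
{ apply (limit_within_unique P (fun _ _ => 0) (fun x y => partial_derive (S (S m)) n w x y
     + partial_derive m (S (S n)) w x y + partial_derive m n fw x y)); [assumption| | |].
  - intros x y Hq. rewrite (Hrel x y Hq). ring.
  - repeat apply continuity_2d_pt_plus; apply (smooth_on_continuous D);
      auto using smooth_on_partial_derive.
  - apply filterlim_const. }
lra.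
Qed.

Lemma jump_value_extension (P N : R * R -> Prop) (w W W' : R -> R -> R) x0 y0 c :
  limit_point P (x0, y0) -> limit_point N (x0, y0) ->
  (forall x y, P (x, y) -> w x y = W x y) -> (forall x y, N (x, y) -> w x y = W' x y) ->
  continuity_2d_pt W x0 y0 -> continuity_2d_pt W' x0 y0 ->
  jump P N w x0 y0 c -> W x0 y0 - W' x0 y0 = c.
Proof.
intros HP HN HW HW' Hc Hc' (a & b & Ha & Hb & <-).
f_equal; symmetry;
  [apply (limit_within_unique P w W)|apply (limit_within_unique N w W')]; assumption.
Qed.

Lemma dX_extension (P : R * R -> Prop) u w x y : open P -> P (x, y) ->
  (forall x y, P (x, y) -> w x y = u x y) -> Derive (fun z => u z y) x = dX w x y.
Proof.
intros HO Hq Hwu. apply Derive_ext_loc.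
generalize (locally_2d_1d_const_y _ _ _ (open_locally_2d P x y HO Hq)).
apply filter_imp. intros z Hz. symmetry. now apply Hwu.
Qed.

Lemma dY_extension (P : R * R -> Prop) u w x y : open P -> P (x, y) ->
  (forall x y, P (x, y) -> w x y = u x y) -> Derive (fun z => u x z) y = dY w x y.
Proof.
intros HO Hq Hwu. apply Derive_ext_loc.
generalize (locally_2d_1d_const_x _ _ _ (open_locally_2d P x y HO Hq)).
apply filter_imp. intros z Hz. symmetry. now apply Hwu.
Qed.

(** * Accuracy of the scheme *)

Lemma sum_stencil_sum_Lambda K (a : nat -> nat -> R) (c : Z -> Z -> R)
    (F : nat -> nat -> Z -> Z -> R) :
  sum_stencil (fun k l => c k l * sum_Lambda K (fun m n => a m n * F m n k l)) =
  sum_Lambda K (fun m n => a m n * sum_stencil (fun k l => c k l * F m n k l)).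
Proof.
unfold sum_stencil. rewrite !sum_Lambda_mult_l.
rewrite <- !(sum_Lambda_plus (V := R_AbelianMonoid)).
apply sum_Lambda_ext; intros. to_R. ring.
Qed.

Lemma sum_stencil_sum_Lambda1 K (a : nat -> nat -> R) (c : Z -> Z -> R)
    (F : nat -> nat -> Z -> Z -> R) : (1 <= K)%nat ->
  sum_stencil (fun k l => c k l * sum_Lambda1 K (fun m n => a m n * F m n k l)) =
  sum_Lambda1 K (fun m n => a m n * sum_stencil (fun k l => c k l * F m n k l)).
Proof.
intros HK. unfold sum_stencil. rewrite !sum_Lambda1_mult_l.
rewrite <- !(sum_Lambda1_plus (V := R_AbelianMonoid)).
apply sum_Lambda1_ext; [assumption|]; intros. to_R. ring.
Qed.

(** The [G] part of the polynomial on the positive side is continued to all nine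
    points, where the stencil annihilates it; the correction that this requires on
    the negative side is the jump of the derivatives, that is, [U]. *)
Lemma scheme_exact_on_Taylor_polynomials psi h x y v0 w0 K sigma r s
    (fP fN g1 g : R -> R -> R) (A B : nat -> nat -> R) :
  (S (S K) <= 7)%nat ->
  let d w := jet w (x - v0) (y - w0) in
  (forall m n, A (S (S m)) n + A m (S (S n)) = - d fP m n) ->
  (forall m n, B (S (S m)) n + B m (S (S n)) = - d fN m n) ->
  (forall m n, (m <= 1)%nat -> (m + n <= S (S K))%nat ->
     U (S K) sigma r s (d fP) (d fN) (d g1) (d g) m n = A m n - B m n) ->
  scheme_lhs (fun k l =>
    if Rge_dec (psi (x + IZR k * h) (y + IZR l * h)) 0
    then jet_poly (S (S (S K))) A (v0 + IZR k * h) (w0 + IZR l * h)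
    else jet_poly (S (S (S K))) B (v0 + IZR k * h) (w0 + IZR l * h))
  = scheme_rhs psi h x y v0 w0 Gpoly Hpoly (S K) sigma r s fP fN g1 g.
Proof.
intros HK d HA HB HU.
rewrite scheme_rhs_U by lia. fold (d fP) (d fN) (d g1) (d g).
change (fun m n => partial_derive m n fP (x - v0) (y - w0)) with (d fP).
set (GA := fun k l => sum_Lambda1 (S (S K)) (fun m n =>
             A m n * Gpoly m n (v0 + IZR k * h) (w0 + IZR l * h))).
set (GD := fun k l => sum_Lambda1 (S (S K)) (fun m n =>
             (A m n - B m n) * Gpoly m n (v0 + IZR k * h) (w0 + IZR l * h))).
set (HfP := fun k l => sum_Lambda K (fun m n =>
             d fP m n * Hpoly m n (v0 + IZR k * h) (w0 + IZR l * h))).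
set (HfN := fun k l => sum_Lambda K (fun m n =>
             d fN m n * Hpoly m n (v0 + IZR k * h) (w0 + IZR l * h))).
set (cP := fun k l => if Rge_dec (psi (x + IZR k * h) (y + IZR l * h)) 0
                      then stencil_coef k l else 0).
set (cN := fun k l => if Rlt_dec (psi (x + IZR k * h) (y + IZR l * h)) 0
                      then stencil_coef k l else 0).
transitivity (sum_stencil (fun k l => stencil_coef k l * GA k l)
  + sum_stencil (fun k l => cP k l * HfP k l) + sum_stencil (fun k l => cN k l * HfN k l)
  - sum_stencil (fun k l => cN k l * GD k l)).
- set (iP := fun k l => if Rge_dec (psi (x + IZR k * h) (y + IZR l * h)) 0 then 1 else 0).
  set (iN := fun k l => if Rlt_dec (psi (x + IZR k * h) (y + IZR l * h)) 0 then 1 else 0).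
  assert (Hkl : forall k l, (if Rge_dec (psi (x + IZR k * h) (y + IZR l * h)) 0
    then jet_poly (S (S (S K))) A (v0 + IZR k * h) (w0 + IZR l * h)
    else jet_poly (S (S (S K))) B (v0 + IZR k * h) (w0 + IZR l * h)) =
    GA k l + iP k l * HfP k l + iN k l * (HfN k l - GD k l)).
  { intros k l. unfold iP, iN. rewrite !jet_poly_sum_Lambda.
    rewrite (jet_reorganisation K A (d fP)), (jet_reorganisation K B (d fN)) by auto.
    fold (GA k l) (HfP k l) (HfN k l).
    replace (sum_Lambda1 (S (S K)) (fun m n =>
               B m n * Gpoly m n (v0 + IZR k * h) (w0 + IZR l * h))) with (GA k l - GD k l).
    - destruct Rge_dec; destruct Rlt_dec; (lra || ring).
    - unfold GA, GD. rewrite <- sum_Lambda1_minus. apply sum_Lambda1_ext; [lia|].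
      intros. to_R; ring. }
  assert (HcP : forall k l, cP k l = stencil_coef k l * iP k l)
    by (intros; unfold cP, iP; destruct Rge_dec; ring).
  assert (HcN : forall k l, cN k l = stencil_coef k l * iN k l)
    by (intros; unfold cN, iN; destruct Rlt_dec; ring).
  unfold scheme_lhs. rewrite !Hkl. unfold sum_stencil. rewrite !HcP, !HcN.
  clearbody iP iN GA GD HfP HfN. unfold stencil_coef. ring.
- unfold GA, GD, HfP, HfN.
  rewrite 2!sum_stencil_sum_Lambda1, 2!sum_stencil_sum_Lambda by lia.
  rewrite (sum_Lambda1_eq_zero (V := R_AbelianMonoid)) with (K := S (S K)); [|lia|].
  2: { intros m n Hm Hn. rewrite stencil_annihilates_Gpoly by lia. apply Rmult_0_r. }
  replace (S K - 1)%nat with K by lia. replace (S K + 1)%nat with (S (S K)) by lia.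
  to_R. rewrite Rplus_0_l. apply (f_equal2 Rminus); [apply (f_equal2 Rplus)|].
  + apply sum_Lambda_ext; intros. f_equal. 
    apply sum_stencil_ext; intros k l. unfold cP. destruct Rge_dec; ring.
  + apply sum_Lambda_ext; intros. f_equal. 
    apply sum_stencil_ext; intros k l. unfold cN. destruct Rlt_dec; ring.
  + apply sum_Lambda1_ext; [lia|]; intros m n Hm Hn. rewrite <- HU by assumption.
    etransitivity; [apply Rmult_comm|]. apply (f_equal2 Rmult); [|reflexivity].
    apply sum_stencil_ext; intros k l. unfold cN. destruct Rlt_dec; ring.
Qed.

Lemma grid_node_inside l1 l2 l3 l4 N0 N1 i j a b :
  l1 < l2 -> l4 - l3 = INR N0 * (l2 - l1) ->
  (1 <= N1)%nat -> (1 <= i <= N1 - 1)%nat -> (1 <= j <= N0 * N1 - 1)%nat ->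
  -1 <= a <= 1 -> -1 <= b <= 1 ->
  let h := mesh l1 l2 N1 in
  closed_Omega l1 l2 l3 l4 (l1 + INR i * h + a * h, l3 + INR j * h + b * h).
Proof.
intros Hl HN HN1 Hi Hj Ha Hb h.
assert (HN1' : 0 < INR N1) by (apply lt_0_INR; lia).
assert (Hh : 0 < h) by (apply Rdiv_lt_0_compat; lra).
assert (Hx : l2 = l1 + INR N1 * h) by (unfold h, mesh; field; lra).
assert (Hy : l4 = l3 + INR (N0 * N1) * h)
  by (rewrite mult_INR; unfold h, mesh; replace l4 with (l3 + INR N0 * (l2 - l1)) by lra; field; lra).
assert (Hi1 : 1 <= INR i) by (apply (le_INR 1); lia).
assert (Hj1 : 1 <= INR j) by (apply (le_INR 1); lia).
assert (Hi2 : INR i + 1 <= INR N1) by (rewrite <- S_INR; apply le_INR; lia).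
assert (Hj2 : INR j + 1 <= INR (N0 * N1)) by (rewrite <- S_INR; apply le_INR; lia).
unfold closed_Omega; simpl. rewrite Hx at 1. rewrite Hy at 1. split; nra.
Qed.

Lemma Omega_closed l1 l2 l3 l4 q : Omega l1 l2 l3 l4 q -> closed_Omega l1 l2 l3 l4 q.
Proof. unfold Omega, closed_Omega. lra. Qed.

Section Problem.

Context (l1 l2 l3 l4 : R) (N0 : nat) (D : R * R -> Prop) (psi : R -> R -> R)
  (nu : R -> R -> R * R) (u f g0 g1 g uP uN fP fN : R -> R -> R).
Context (l12 : l1 < l2) (l34 : l4 - l3 = INR N0 * (l2 - l1)) (D_open : open D)
  (D_rectangle : forall q, closed_Omega l1 l2 l3 l4 q -> D q)
  (psi_smooth : smooth_on D psi)
  (normal : forall x0 y0, Gamma l1 l2 l3 l4 psi (x0, y0) ->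
     unit_normal_towards (Gamma l1 l2 l3 l4 psi) (Omega_plus l1 l2 l3 l4 psi)
       (Omega_minus l1 l2 l3 l4 psi) x0 y0 (nu x0 y0))
  (g1_smooth : smooth_on D g1) (g_smooth : smooth_on D g)
  (u_ext : smooth_extensions l1 l2 l3 l4 psi D u uP uN)
  (f_ext : smooth_extensions l1 l2 l3 l4 psi D f fP fN)
  (problem : interface_problem l1 l2 l3 l4 psi nu u f g0 g1 g).

Let OmP := Omega_plus l1 l2 l3 l4 psi.
Let OmN := Omega_minus l1 l2 l3 l4 psi.
Let Ga := Gamma l1 l2 l3 l4 psi.

Lemma Omega_inside q : Omega l1 l2 l3 l4 q -> D q.
Proof. intros Hq. now apply D_rectangle, Omega_closed. Qed.

Lemma open_Omega_plus : open OmP.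
Proof.
apply (open_sign_region (Omega l1 l2 l3 l4) _ psi 1); [apply open_Omega| | |ring].
- intros x y Hq. apply (smooth_on_continuous D); [assumption|now apply Omega_inside].
- intros q. unfold OmP, Omega_plus. now rewrite Rmult_1_l.
Qed.

Lemma open_Omega_minus : open OmN.
Proof.
apply (open_sign_region (Omega l1 l2 l3 l4) _ psi (-1)); [apply open_Omega| | |ring].
- intros x y Hq. apply (smooth_on_continuous D); [assumption|now apply Omega_inside].
- intros q. unfold OmN, Omega_minus. split; intros [H1 H2]; split; auto; lra.
Qed.

Lemma interface_jets x0 y0 : Ga (x0, y0) -> forall m n,
  jet uP x0 y0 (S (S m)) n + jet uP x0 y0 m (S (S n)) = - jet fP x0 y0 m n /\
  jet uN x0 y0 (S (S m)) n + jet uN x0 y0 m (S (S n)) = - jet fN x0 y0 m n.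
Proof.
intros HG m n. destruct (normal_limit_point _ _ _ _ _ _ (normal x0 y0 HG)) as [HaP HaN].
destruct u_ext as (HuP & HuN & HuP' & HuN'). destruct f_ext as (HfP & HfN & HfP' & HfN').
destruct problem as (Hpde & _).
assert (HD : D (x0, y0)) by (apply Omega_inside, HG).
split.
- apply (interface_jet_relation D OmP u f); auto using open_Omega_plus.
  + intros q [Hq _]. now apply Omega_inside.
  + intros x y [Hq Hpos]. apply Hpde; [assumption|]. intros [_ H0]. simpl in *. lra.
- apply (interface_jet_relation D OmN u f); auto using open_Omega_minus.
  + intros q [Hq _]. now apply Omega_inside.
  + intros x y [Hq Hneg]. apply Hpde; [assumption|]. intros [_ H0]. simpl in *. lra.
Qed.

Lemma interface_jumps x0 y0 : Ga (x0, y0) ->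
  uP x0 y0 - uN x0 y0 = g1 x0 y0 /\
  (dX uP x0 y0 * fst (nu x0 y0) + dY uP x0 y0 * snd (nu x0 y0))
  - (dX uN x0 y0 * fst (nu x0 y0) + dY uN x0 y0 * snd (nu x0 y0)) = g x0 y0.
Proof.
intros HG. destruct (normal_limit_point _ _ _ _ _ _ (normal x0 y0 HG)) as [HaP HaN].
destruct u_ext as (HuP & HuN & HuP' & HuN').
destruct problem as (_ & _ & Hj1 & Hj2).
assert (HD : D (x0, y0)) by (apply Omega_inside, HG).
split.
- apply (jump_value_extension OmP OmN u); auto.
  + intros x y Hq; symmetry; now apply HuP'.
  + intros x y Hq; symmetry; now apply HuN'.
  + now apply (smooth_on_continuous D).
  + now apply (smooth_on_continuous D).
- set (n := nu x0 y0).
  apply (jump_value_extension OmP OmN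
    (fun a b => Derive (fun z => u z b) a * fst n + Derive (fun z => u a z) b * snd n)
    (fun a b => dX uP a b * fst n + dY uP a b * snd n)
    (fun a b => dX uN a b * fst n + dY uN a b * snd n)); [assumption|assumption| | | | |].
  + intros x y Hq. rewrite (dX_extension OmP u uP) by auto using open_Omega_plus.
    now rewrite (dY_extension OmP u uP) by auto using open_Omega_plus.
  + intros x y Hq. rewrite (dX_extension OmN u uN) by auto using open_Omega_minus.
    now rewrite (dY_extension OmN u uN) by auto using open_Omega_minus.
  + apply continuity_2d_pt_plus; apply continuity_2d_pt_mult;
      try apply continuity_2d_pt_const; apply (smooth_on_continuous D);
      auto using smooth_on_dX, smooth_on_dY.
  + apply continuity_2d_pt_plus; apply continuity_2d_pt_mult;
      try apply continuity_2d_pt_const; apply (smooth_on_continuous D);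
      auto using smooth_on_dX, smooth_on_dY.
  + now apply Hj2.
Qed.

(** The parameterization identifies [(s', - r')] with [sigma] times the speed times
    the unit normal, which turns the jump of the normal derivative into a jump of
    the flux. *)
Lemma configuration_U N1 i j v0 w0 r s sigma K :
  stencil_configuration l1 l2 l3 l4 N0 psi nu N1 i j v0 w0 r s sigma ->
  let h := mesh l1 l2 N1 in
  let x0 := l1 + INR i * h - v0 in
  let y0 := l3 + INR j * h - w0 in
  forall m n, (m <= 1)%nat -> (m + n <= S (S K))%nat ->
  U (S K) sigma r s (jet fP x0 y0) (jet fN x0 y0) (jet g1 x0 y0) (jet g x0 y0) m n
  = jet uP x0 y0 m n - jet uN x0 y0 m n.
Proof.
intros (_ & _ & _ & _ & _ & _ & HG & _ & eps & Hpar & Hnu) h x0 y0 m n Hm Hn.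
fold h in HG, Hpar, Hnu. fold x0 y0 in HG, Hpar, Hnu.
destruct Hpar as (He & Hsm & Hr0 & Hs0 & Hreg & Hcurve & _).
destruct u_ext as (HuP & HuN & _ & _).
apply (U_jump l1 l2 l3 l4 D D_open D_rectangle x0 y0 eps r s); auto.
- intros k t Ht. now apply Hsm.
- intros k t Ht. now apply Hsm.
- intros t Ht. apply Omega_closed. now apply Hcurve.
- intros m' n'. now apply interface_jets.
- intros m' n'. now apply interface_jets.
- intros t Ht. now apply interface_jumps, Hcurve.
- intros t Ht. destruct (interface_jumps _ _ (Hcurve t Ht)) as [_ Hj].
  destruct (Hnu t Ht) as [H1 H2]. assert (Hp := sqrt_lt_R0 _ (Hreg t Ht)).
  set (sp := sqrt (Derive r t ^ 2 + Derive s t ^ 2)) in *.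
  assert (E1 : Derive s t = sigma * fst (nu (r t + x0) (s t + y0)) * sp)
    by (rewrite <- H1; field; lra).
  assert (E2 : Derive r t = - (sigma * snd (nu (r t + x0) (s t + y0)) * sp))
    by (rewrite <- H2; field; lra).
  rewrite E1, E2, <- Hj. ring.
Qed.

Lemma accuracy K : (S (S K) <= 7)%nat ->
  accuracy_order (S K) l1 l2 l3 l4 N0 psi nu uP uN fP fN g1 g.
Proof.
intros HK. destruct u_ext as (HuP & HuN & _ & _).
destruct (uniform_Taylor l1 l2 l3 l4 D (S (S (S K))) D_open D_rectangle uP HuP) as [CP [HCP TP]].
destruct (uniform_Taylor l1 l2 l3 l4 D (S (S (S K))) D_open D_rectangle uN HuN) as [CN [HCN TN]].
(* the absolute values of the nine weights add up to 40 *)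
exists (40 * ((CP + CN) * 4 ^ (S K + 2))), 1. split; [lra|].
intros N1 i j v0 w0 r s sigma Hconf h x y _.
assert (HU := configuration_U N1 i j v0 w0 r s sigma K Hconf). fold h x y in HU. cbv zeta in HU.
destruct Hconf as (HN1 & Hi & Hj & _ & Hv & Hw & HG & _).
fold h in Hv, Hw, HG. fold x y in HG.
assert (Hjet := interface_jets _ _ HG).
rewrite <- (scheme_exact_on_Taylor_polynomials psi h x y v0 w0 K sigma r s fP fN g1 g
  (jet uP (x - v0) (y - w0)) (jet uN (x - v0) (y - w0)) HK
  (fun m n => proj1 (Hjet m n)) (fun m n => proj2 (Hjet m n)) HU).
assert (Hh : 0 < h) by lra.
set (E := (CP + CN) * 4 ^ (S K + 2) * h ^ (S K + 2)).
assert (Herr : forall k l, -1 <= IZR k <= 1 -> -1 <= IZR l <= 1 ->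
  Rabs (exact_value psi h x y uP uN k l
    - (if Rge_dec (psi (x + IZR k * h) (y + IZR l * h)) 0
       then jet_poly (S (S (S K))) (jet uP (x - v0) (y - w0)) (v0 + IZR k * h) (w0 + IZR l * h)
       else jet_poly (S (S (S K))) (jet uN (x - v0) (y - w0)) (v0 + IZR k * h) (w0 + IZR l * h)))
  <= E).
{ intros k l Hk Hl.
  assert (Hbase : closed_Omega l1 l2 l3 l4 (x - v0, y - w0)) by (apply Omega_closed, HG).
  assert (Hnode : closed_Omega l1 l2 l3 l4 (x + IZR k * h, y + IZR l * h))
    by now apply (grid_node_inside l1 l2 l3 l4 N0).
  specialize (TP _ _ _ _ Hbase Hnode). specialize (TN _ _ _ _ Hbase Hnode).
  replace (x + IZR k * h - (x - v0)) with (v0 + IZR k * h) in * by ring.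
  replace (y + IZR l * h - (y - w0)) with (w0 + IZR l * h) in * by ring.
  set (rho := Rabs (v0 + IZR k * h) + Rabs (w0 + IZR l * h)) in *.
  (* the base point and the node differ from the centre by at most [h] in each
     coordinate, hence from each other by at most [2 h] *)
  assert (Hrho : 0 <= rho <= 4 * h).
  { unfold rho. split; [apply Rplus_le_le_0_compat; apply Rabs_pos|].
    assert (Rabs (v0 + IZR k * h) <= 2 * h) by (apply Rabs_le; nra).
    assert (Rabs (w0 + IZR l * h) <= 2 * h) by (apply Rabs_le; nra). lra. }
  assert (Hpow : rho ^ S (S (S K)) <= 4 ^ (S K + 2) * h ^ (S K + 2)).
  { rewrite <- Rpow_mult_distr. replace (S K + 2)%nat with (S (S (S K))) by lia.
    now apply pow_incr. }
  assert (Hpow0 : 0 <= rho ^ S (S (S K))) by (apply pow_le; lra).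
  unfold exact_value, E. rewrite Rmult_assoc.
  set (b := 4 ^ (S K + 2) * h ^ (S K + 2)) in *.
  destruct Rge_dec; [eapply Rle_trans; [exact TP|]|eapply Rle_trans; [exact TN|]]; nra. }
assert (Hm1 : -1 <= IZR (-1) <= 1) by lra. assert (H0 : -1 <= IZR 0 <= 1) by lra.
assert (Hp1 : -1 <= IZR 1 <= 1) by lra.
set (P := fun k l => if Rge_dec (psi (x + IZR k * h) (y + IZR l * h)) 0
       then jet_poly (S (S (S K))) (jet uP (x - v0) (y - w0)) (v0 + IZR k * h) (w0 + IZR l * h)
       else jet_poly (S (S (S K))) (jet uN (x - v0) (y - w0)) (v0 + IZR k * h) (w0 + IZR l * h)).
assert (Herr' : forall k l, -1 <= IZR k <= 1 -> -1 <= IZR l <= 1 ->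
  - E <= exact_value psi h x y uP uN k l - P k l <= E)
  by (intros k l Hk Hl; apply Rabs_le_between; now apply Herr).
replace (40 * ((CP + CN) * 4 ^ (S K + 2)) * h ^ (S K + 2)) with (40 * E) by (unfold E; ring).
unfold scheme_lhs. clear Herr. clearbody P E.
assert (E1 := Herr' _ _ Hm1 Hm1). assert (E2 := Herr' _ _ Hm1 H0).
assert (E3 := Herr' _ _ Hm1 Hp1). assert (E4 := Herr' _ _ H0 Hm1).
assert (E5 := Herr' _ _ H0 H0). assert (E6 := Herr' _ _ H0 Hp1).
assert (E7 := Herr' _ _ Hp1 Hm1). assert (E8 := Herr' _ _ Hp1 H0).
assert (E9 := Herr' _ _ Hp1 Hp1).
apply Rabs_le. lra.
Qed.

Lemma configuration_scheme_rhs_drop_above N1 i j v0 w0 r s sigma M M' :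
  stencil_configuration l1 l2 l3 l4 N0 psi nu N1 i j v0 w0 r s sigma -> (1 <= M <= M')%nat ->
  let h := mesh l1 l2 N1 in
  let x := l1 + INR i * h in
  let y := l3 + INR j * h in
  scheme_rhs psi h x y v0 w0 Gpoly Hpoly M sigma r s fP fN g1 g
  = scheme_rhs psi h x y v0 w0 (drop_above (M + 1) Gpoly) (drop_above (M - 1) Hpoly)
      M' sigma r s fP fN g1 g.
Proof.
intros (_ & _ & _ & _ & _ & _ & _ & _ & eps & Hpar & _) HM h x y.
destruct Hpar as (He & Hsm & Hr0 & Hs0 & Hreg & _).
symmetry. apply (scheme_rhs_drop_above eps); auto; intros k t Ht; now apply Hsm.
Qed.

End Problem.

Theorem theorem2p4 :
  forall (l1 l2 l3 l4 : R) (N0 : nat) (D : R * R -> Prop)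
    (psi : R -> R -> R) (nu : R -> R -> R * R)
    (u f g0 g1 g uP uN fP fN : R -> R -> R),
  l1 < l2 ->
  (1 <= N0)%nat ->
  l4 - l3 = INR N0 * (l2 - l1) ->
  open D ->
  (forall q : R * R, closed_Omega l1 l2 l3 l4 q -> D q) ->
  smooth_on D psi ->
  smooth_curve (Gamma l1 l2 l3 l4 psi) ->
  (forall x0 y0 : R, Gamma l1 l2 l3 l4 psi (x0, y0) ->
     unit_normal_towards (Gamma l1 l2 l3 l4 psi) (Omega_plus l1 l2 l3 l4 psi)
       (Omega_minus l1 l2 l3 l4 psi) x0 y0 (nu x0 y0)) ->
  smooth_on_sides l1 l2 l3 l4 g0 ->
  smooth_on D g1 ->
  smooth_on D g ->
  smooth_extensions l1 l2 l3 l4 psi D u uP uN ->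
  smooth_extensions l1 l2 l3 l4 psi D f fP fN ->
  interface_problem l1 l2 l3 l4 psi nu u f g0 g1 g ->
  accuracy_order 6 l1 l2 l3 l4 N0 psi nu uP uN fP fN g1 g /\
  (forall M : nat, M = 3%nat \/ M = 4%nat \/ M = 5%nat ->
     (forall (N1 i j : nat) (v0 w0 : R) (r s : R -> R) (sigma : R),
        stencil_configuration l1 l2 l3 l4 N0 psi nu N1 i j v0 w0 r s sigma ->
        let h := mesh l1 l2 N1 in
        let x := l1 + INR i * h in
        let y := l3 + INR j * h in
        scheme_rhs psi h x y v0 w0 Gpoly Hpoly M sigma r s fP fN g1 g
        = scheme_rhs psi h x y v0 w0
            (drop_above (M + 1) Gpoly) (drop_above (M - 1) Hpoly) 6 sigma r s fP fN g1 g) /\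
     accuracy_order M l1 l2 l3 l4 N0 psi nu uP uN fP fN g1 g).
Proof.
intros l1 l2 l3 l4 N0 D psi nu u f g0 g1 g uP uN fP fN Hl HN0 Hl34 HD HDr Hpsi _ Hnu _
  Hg1 Hg Hu Hf Hprob.
assert (Hacc : forall K, (S (S K) <= 7)%nat ->
  accuracy_order (S K) l1 l2 l3 l4 N0 psi nu uP uN fP fN g1 g).
{ intros K HK. eapply accuracy; eassumption. }
split; [apply Hacc; lia|]. intros M HM. split.
- intros N1 i j v0 w0 r s sigma Hconf.
  eapply configuration_scheme_rhs_drop_above; [eassumption|lia].
- destruct M as [|K]; [lia|]. apply Hacc; lia.
Qed.
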